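(* Consider scheduling on unrelated machines with all jobs available at time $0$, and suppose at most $g$ jobs are overpredicted ($\hat p_j>p_j$), where $g$ is known to the algorithm. For any sufficiently small $\varepsilon>0$ there exists an online algorithm that is $14.48(1+\varepsilon)$-competitive for minimizing total completion time while performing at most $$O\Big(\frac{1}{\varepsilon^3}\Big(\sum_j\log\Big(\frac{p_j}{\hat p_j}+1\Big)+\frac{g}{\varepsilon}\log p_{\max}\Big)\Big)$$ preemptions and migrations in total, where $p_{\max}=\max_jp_j$.
   Context: Unrelated machines: a set $M$ of machines and $n$ jobs, all available at time $0$. Job $j$ is processed at rate $\lambda_{ij}\ge0$ on machine $i$ (known in advance); each machine processes at most one job at a time and each job runs on at most one machine at a time; preemption and migration are allowed. Job $j$ has processing requirement $p_j\ge1$, unknown to the algorithm until $j$ completes, and a prediction $\hat p_j$ known at time $0$; it completes at time $C_j$ once it has received $p_j$ units of processing. A preemption is an interruption of a job before completion; a migration is resuming a job on a different machine. An algorithm is $c$-competitive if on every instance $\sum_jC_j$ is at most $c$ times the optimal offline total completion time. *)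

(* Defs.v *)
From Stdlib Require Import Reals Lra Lia List Bool.
Import ListNotations.
Open Scope R_scope.

Definition Rltb (x y : R) : bool := if Rlt_dec x y then true else false.
Definition Rleb (x y : R) : bool := if Rle_dec x y then true else false.
Definition Reqb (x y : R) : bool := if Req_EM_T x y then true else false.

Fixpoint sumR (n : nat) (f : nat -> R) : R :=
  match n with O => 0 | S k => sumR k f + f k end.

Fixpoint maxR (n : nat) (f : nat -> R) : R :=
  match n with O => 0 | S k => Rmax (maxR k f) (f k) end.

Definition countN (n : nat) (b : nat -> bool) : nat :=
  length (filter b (seq 0 n)).

(* A segment: job [sj] is processed on machine [sm] during [ss, se). *)
Record seg := mkSeg { sm : nat; sj : nat; ss : R; se : R }.
Definition schedule := list seg.
Definition seg0 : seg := mkSeg 0 0 0 0.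
Definition segk (S : schedule) (k : nat) : seg := nth k S seg0.

Definition valid_schedule (m n : nat) (S : schedule) : Prop :=
  (forall k, (k < length S)%nat ->
     (sm (segk S k) < m)%nat /\ (sj (segk S k) < n)%nat /\
     0 <= ss (segk S k) /\ ss (segk S k) < se (segk S k)) /\
  (forall k1 k2, (k1 < length S)%nat -> (k2 < length S)%nat -> k1 <> k2 ->
     (sm (segk S k1) = sm (segk S k2) \/ sj (segk S k1) = sj (segk S k2)) ->
     se (segk S k1) <= ss (segk S k2) \/ se (segk S k2) <= ss (segk S k1)).

Definition overlap (a b c d : R) : R := Rmax 0 (Rmin b d - Rmax a c).

Definition work (lam : nat -> nat -> R) (S : schedule) (j : nat) (t : R) : R :=
  fold_right (fun s acc =>
     (if Nat.eqb (sj s) j then lam (sm s) j * overlap (ss s) (se s) 0 t else 0) + acc)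
   0 S.

Definition completes (lam : nat -> nat -> R) (S : schedule) (p : nat -> R)
    (j : nat) (C : R) : Prop :=
  p j <= work lam S j C /\ (forall t, t < C -> work lam S j t < p j).

Definition feasible (m n : nat) (lam : nat -> nat -> R) (p : nat -> R)
    (S : schedule) (C : nat -> R) : Prop :=
  valid_schedule m n S /\ (forall j, (j < n)%nat -> completes lam S p j (C j)).

Definition total_completion (n : nat) (C : nat -> R) : R := sumR n C.

Definition is_preemption (S : schedule) (C : nat -> R) (k : nat) : bool :=
  let s := segk S k in
  Rltb (se s) (C (sj s)) &&
  negb (existsb (fun k' => let s' := segk S k' in
                   Nat.eqb (sj s') (sj s) && Reqb (ss s') (se s))
                (seq 0 (length S))).

(* Migration at the start of segment k': the previous piece of the same job
   ran on a different machine (job not yet completed). *)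
Definition is_migration (S : schedule) (C : nat -> R) (k' : nat) : bool :=
  let s' := segk S k' in
  let idx := seq 0 (length S) in
  Rltb (ss s') (C (sj s')) &&
  existsb (fun k => let s := segk S k in
     negb (Nat.eqb k k') && Nat.eqb (sj s) (sj s') &&
     Rleb (se s) (ss s') && negb (Nat.eqb (sm s) (sm s')) &&
     forallb (fun k'' => let s'' := segk S k'' in
        negb (Nat.eqb (sj s'') (sj s') && Rltb (se s) (se s'') &&
              Rleb (se s'') (ss s'))) idx) idx.

Definition num_preempt_migr (S : schedule) (C : nat -> R) : nat :=
  countN (length S) (is_preemption S C) + countN (length S) (is_migration S C).

Definition state (S : schedule) (i : nat) (s : R) : option nat :=
  match find (fun x => Nat.eqb (sm x) i && Rleb (ss x) s && Rltb s (se x)) S with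
  | Some x => Some (sj x) | None => None end.

(* An algorithm maps the instance data known at time 0 (m, n, rates lam,
   predictions phat, the bound g) together with the true processing times p
   to a schedule.  It is online/non-clairvoyant: its behaviour on [0,t) only
   depends on information revealed before t. *)
Definition algorithm : Type :=
  nat -> nat -> (nat -> nat -> R) -> (nat -> R) -> nat -> (nat -> R) -> schedule.

Definition completed_before (lam : nat -> nat -> R) (S : schedule)
    (p : nat -> R) (j : nat) (t : R) : Prop :=
  exists t', t' < t /\ p j <= work lam S j t'.

Definition nonclairvoyant (A : algorithm) : Prop :=
  forall m n lam phat g (p p' : nat -> R) (t : R),
    (forall j, (j < n)%nat -> 1 <= p j) ->
    (forall j, (j < n)%nat -> 1 <= p' j) ->
    (forall j, (n <= j)%nat -> p' j = p j) ->
    (forall j, (j < n)%nat ->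
       let S := A m n lam phat g p in
       (completed_before lam S p j t /\ p' j = p j) \/
       (~ completed_before lam S p j t /\ work lam S j t <= p' j)) ->
    forall i s, s < t ->
      state (A m n lam phat g p) i s = state (A m n lam phat g p') i s.

Definition num_overpredicted (n : nat) (p phat : nat -> R) : nat :=
  countN n (fun j => Rltb (p j) (phat j)).

(* Main.v *)
(** Jobs are assigned to machines by an integral equilibrium of Nash welfare: on a machine with [n_i]
    jobs each of them runs at rate [lam i j / n_i], and no job gains by moving to a machine [i'] where
    its rate would be [lam i' j / (n_i' + 1)].  When jobs leave, the equilibrium can be repaired so that
    no remaining rate drops.  For an optimal schedule running [j] on [i] at time [t], monotonicity and
    the equilibrium condition bound [(kappa * C_j - t) * lam i j] by
    [kappa * p_j * (n_i (t / kappa) + 1)], and summing over the optimal schedule gives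
    [kappa * (1 - kappa) * ALG <= (1 + kappa) * OPT], a ratio below 6 for [kappa = 2/5]; the [+ 1] is paid
    by the running times in the optimum.  Rounds of geometrically growing length make this
    discrete: in a round each job gets one contiguous slot, and slots that are short compared with
    [theta_j] are skipped, so that [j] is run only [O (1 + log (p_j / theta_j))] times.

    If [51 * g < n], the rounds use [theta_j = max 1 phat_j] until at most [51 * g] jobs are left; the
    at most [g] overpredicted jobs then form a small fraction of the jobs alive.  Afterwards, a second
    run starts from scratch with [theta_j = 1].  If [n <= 51 * g], the first part is replaced by a
    nonpreemptive schedule of minimal total cost that gives each job [11/10] units, abandoned as soon as
    some job turns out to be longer: this avoids any interruption when [ln p_max] is too small to pay
    for one.  Either way the two parts cost at most [14.48 * OPT] together, so the algorithm does
    not depend on [eps]. *)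

Require Import Defs.
From Stdlib Require Import Reals Lra Lia List Bool Psatz Classical ClassicalEpsilon.
From Stdlib Require Import FunctionalExtensionality Permutation Wf_nat.
Import ListNotations.
Open Scope R_scope.

(** * Sums, overlaps and the dual bound *)


(** The value [kappa = 2/5] approximates [sqrt 2 - 1], where [(1 + kappa) / (kappa * (1 - kappa))]
    attains its minimum [3 + 2 * sqrt 2]. Skipped slots and rounds of positive length raise this to
    [32/5] for each run of the rounds.

    The dual argument tolerates skipping only if the skipped amount is a small fraction of [p_j],
    hence [theta_j <= p_j]. With predictions this fails exactly for the overpredicted jobs. They get
    no dual variable, and the others, at least 50 out of every 51 alive, pay for them. In the second
    run [theta_j = 1 <= p_j] holds for all jobs; work done earlier is disregarded, so the costs of
    the two parts simply add up.

    The other obstacle is the additive constant in the number of runs of a job, which the target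
    bound lacks. If [51 * g < n], it is paid by the term [ln 2] that every job not overpredicted
    contributes at least; otherwise it is charged to [g * ln p_max].

    An [algorithm] is handed the true sizes. Non-clairvoyance is obtained by letting them enter a
    state only through comparisons with work already done. *)

Definition lsum {X : Type} (L : list X) (f : X -> R) : R :=
  fold_right (fun x acc => f x + acc) 0 L.

Lemma lsum_cons {X} (x : X) L f : lsum (x :: L) f = f x + lsum L f.
Proof. reflexivity. Qed.

Lemma lsum_app {X} (L M : list X) f : lsum (L ++ M) f = lsum L f + lsum M f.
Proof.
  induction L; [unfold lsum; simpl; lra|].
  simpl app. rewrite !lsum_cons, IHL; lra.
Qed.

Lemma lsum_ext {X} (L : list X) f g :
  (forall x, In x L -> f x = g x) -> lsum L f = lsum L g.
Proof.
  induction L; intros H; [reflexivity|]. rewrite !lsum_cons, H by (left; auto).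
  rewrite IHL; auto. intros; apply H; right; auto.
Qed.

Lemma lsum_le {X} (L : list X) f g :
  (forall x, In x L -> f x <= g x) -> lsum L f <= lsum L g.
Proof.
  induction L; intros H; [apply Rle_refl|]. rewrite !lsum_cons.
  apply Rplus_le_compat; [apply H; left; auto|]. apply IHL; intros; apply H; right; auto.
Qed.

Lemma lsum_plus {X} (L : list X) f g : lsum L (fun x => f x + g x) = lsum L f + lsum L g.
Proof. induction L; [unfold lsum; simpl; lra|]. rewrite !lsum_cons, IHL; lra. Qed.

Lemma lsum_scal {X} (L : list X) c f : lsum L (fun x => c * f x) = c * lsum L f.
Proof. induction L; [unfold lsum; simpl; lra|]. rewrite !lsum_cons, IHL; lra. Qed.

Lemma lsum_const {X} (L : list X) c : lsum L (fun _ => c) = INR (length L) * c.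
Proof.
  induction L; [unfold lsum; simpl; lra|]. rewrite lsum_cons, IHL.
  simpl length; rewrite S_INR; lra.
Qed.

Lemma lsum_nonneg {X} (L : list X) f : (forall x, In x L -> 0 <= f x) -> 0 <= lsum L f.
Proof.
  intros H. replace 0 with (lsum L (fun _ : X => 0)) by (rewrite lsum_const; lra).
  apply lsum_le; auto.
Qed.

Lemma lsum_swap {X Y} (L : list X) (M : list Y) f :
  lsum L (fun x => lsum M (fun y => f x y)) = lsum M (fun y => lsum L (fun x => f x y)).
Proof.
  induction L.
  - symmetry. transitivity (lsum M (fun _ : Y => 0)); [reflexivity|]. rewrite lsum_const; unfold lsum; simpl; lra.
  - rewrite lsum_cons, IHL, <- lsum_plus. apply lsum_ext; intros; reflexivity.
Qed.

Lemma lsum_map {X Y} (h : X -> Y) (L : list X) f : lsum (map h L) f = lsum L (fun x => f (h x)).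
Proof. induction L; [reflexivity|]. simpl map; rewrite !lsum_cons, IHL; auto. Qed.

Lemma lsum_filter {X} (P : X -> bool) (L : list X) f :
  lsum (filter P L) f = lsum L (fun x => if P x then f x else 0).
Proof.
  induction L; [reflexivity|]. simpl filter. rewrite lsum_cons.
  destruct (P a); rewrite ?lsum_cons, IHL; lra.
Qed.

Lemma lsum_perm {X} (L M : list X) f : Permutation L M -> lsum L f = lsum M f.
Proof.
  induction 1; rewrite ?lsum_cons; auto; lra.
Qed.

Lemma lsum_flat_map {X Y} (h : X -> list Y) (L : list X) f :
  lsum (flat_map h L) f = lsum L (fun x => lsum (h x) f).
Proof. induction L; [reflexivity|]. simpl flat_map. rewrite lsum_app, lsum_cons, IHL; auto. Qed.

Lemma sumR_lsum n f : sumR n f = lsum (seq 0 n) f.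
Proof.
  induction n; [reflexivity|].
  rewrite seq_S, lsum_app, <- IHn. unfold lsum; simpl; lra.
Qed.

Lemma lsum_pick (L : list nat) j f : NoDup L -> In j L ->
  lsum L (fun x => if Nat.eqb x j then f x else 0) = f j.
Proof.
  induction L; intros Hn Hi; [destruct Hi|]. rewrite lsum_cons. inversion Hn; subst.
  destruct (Nat.eqb_spec a j).
  - subst. rewrite (lsum_ext L _ (fun _ => 0)); [rewrite lsum_const; lra|].
    intros x Hx. destruct (Nat.eqb_spec x j); auto. subst; tauto.
  - destruct Hi; [congruence|]. rewrite IHL; auto; lra.
Qed.

Lemma lsum_indicator_le (L : list nat) j c : NoDup L -> 0 <= c ->
  lsum L (fun x => if Nat.eqb j x then c else 0) <= c.
Proof.
  intros Hn Hc. destruct (in_dec Nat.eq_dec j L).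
  - rewrite (lsum_ext L _ (fun x => if Nat.eqb x j then c else 0)).
    + rewrite (lsum_pick L j (fun _ => c)); auto; lra.
    + intros; rewrite Nat.eqb_sym; auto.
  - rewrite (lsum_ext L _ (fun _ => 0)); [rewrite lsum_const; lra|].
    intros x Hx. destruct (Nat.eqb_spec j x); auto. subst; tauto.
Qed.

Ltac minmax := unfold overlap, Rmax, Rmin in *;
  repeat match goal with
  | |- context [Rle_dec ?a ?b] => destruct (Rle_dec a b)
  | H : context [Rle_dec ?a ?b] |- _ => destruct (Rle_dec a b)
  end; try lra.

Lemma overlap_nonneg a b c d : 0 <= overlap a b c d.
Proof. minmax. Qed.

Lemma overlap_cut_left a b u v h : h <= a -> overlap a b u v <= overlap a b (Rmax u (Rmin v h)) v.
Proof. intros; minmax. Qed.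

Lemma overlap_cut_right a b u v h : b <= h -> overlap a b u v <= overlap a b u (Rmax u (Rmin v h)).
Proof. intros; minmax. Qed.

Lemma overlap_inside a b c d : a <= b -> c <= a -> b <= d -> overlap a b c d = b - a.
Proof. intros; minmax. Qed.

Lemma overlap_shrink a b a' b' c d : a <= a' -> b' <= b -> overlap a' b' c d <= overlap a b c d.
Proof. intros; minmax. Qed.

Lemma overlap_mono_window a b c d d' : d <= d' -> overlap a b c d <= overlap a b c d'.
Proof. intros; minmax. Qed.

Lemma ForallOrdPairs_filter {X} (Q : X -> X -> Prop) P (L : list X) :
  ForallOrdPairs Q L -> ForallOrdPairs Q (filter P L).
Proof.
  induction 1; simpl; [constructor|]. destruct (P a); auto. constructor; auto.
  rewrite Forall_forall in *. intros x Hx; apply H. apply filter_In in Hx; tauto.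
Qed.

Lemma ForallOrdPairs_impl {X} (Q Q' : X -> X -> Prop) (L : list X) :
  (forall x y, In x L -> In y L -> Q x y -> Q' x y) -> ForallOrdPairs Q L -> ForallOrdPairs Q' L.
Proof.
  intros H F; induction F; constructor.
  - rewrite Forall_forall in *. intros y Hy; apply H; simpl; auto.
  - apply IHF. intros; apply H; simpl; auto.
Qed.

Lemma ForallOrdPairs_app {X} (Q : X -> X -> Prop) (L M : list X) :
  ForallOrdPairs Q L -> ForallOrdPairs Q M ->
  (forall x y, In x L -> In y M -> Q x y) -> ForallOrdPairs Q (L ++ M).
Proof.
  intros F G H; induction F; simpl; auto. constructor.
  - apply Forall_app; split; auto. apply Forall_forall; intros; apply H; simpl; auto.
  - apply IHF; intros; apply H; simpl; auto.
Qed.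

Lemma ForallOrdPairs_map {X Y} (h : Y -> X) (Q : X -> X -> Prop) (L : list Y) :
  ForallOrdPairs (fun a b => Q (h a) (h b)) L -> ForallOrdPairs Q (map h L).
Proof.
  induction 1; simpl; constructor; auto.
  rewrite Forall_forall in *. intros x Hx. apply in_map_iff in Hx.
  destruct Hx as [y [<- Hy]]; auto.
Qed.

Lemma NoDup_ForallOrdPairs {X} (Q : X -> X -> Prop) (L : list X) :
  NoDup L -> (forall x y, In x L -> In y L -> x <> y -> Q x y) -> ForallOrdPairs Q L.
Proof.
  induction 1; intros HQ; constructor.
  - apply Forall_forall. intros y Hy. apply HQ; simpl; auto. congruence.
  - apply IHNoDup. intros; apply HQ; simpl; auto.
Qed.

(* Cut the window at the first interval; each other interval lies on one side of it. *)
Lemma disjoint_overlap_le {X} (lo hi : X -> R) (L : list X) :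
  ForallOrdPairs (fun x y => hi x <= lo y \/ hi y <= lo x) L ->
  (forall x, In x L -> lo x <= hi x) ->
  forall u v, u <= v -> lsum L (fun x => overlap (lo x) (hi x) u v) <= v - u.
Proof.
  induction 1 as [|x L Hx HL IH]; intros Hle u v Huv; [unfold lsum; simpl; lra|].
  rewrite lsum_cons.
  set (a := Rmax u (Rmin v (lo x))). set (b := Rmax u (Rmin v (hi x))).
  assert (Hlx : lo x <= hi x) by (apply Hle; left; auto).
  assert (u <= a /\ a <= b /\ b <= v) as (H1 & H2 & H3) by (unfold a, b; minmax).
  assert (Hxab : overlap (lo x) (hi x) u v <= b - a) by (unfold a, b; minmax).
  assert (IH1 := IH (fun y Hy => Hle y (or_intror Hy)) u a H1).
  assert (IH2 := IH (fun y Hy => Hle y (or_intror Hy)) b v H3).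
  assert (lsum L (fun y => overlap (lo y) (hi y) u v) <=
          lsum L (fun y => overlap (lo y) (hi y) u a + overlap (lo y) (hi y) b v)).
  { apply lsum_le. intros y Hy. rewrite Forall_forall in Hx.
    assert (Hly : lo y <= hi y) by (apply Hle; right; auto).
    assert (P1 := overlap_nonneg (lo y) (hi y) u a). assert (P2 := overlap_nonneg (lo y) (hi y) b v).
    destruct (Hx y Hy) as [Hxy|Hxy].
    - assert (Q := overlap_cut_left (lo y) (hi y) u v (hi x) Hxy). fold b in Q. lra.
    - assert (Q := overlap_cut_right (lo y) (hi y) u v (lo x) Hxy). fold a in Q. lra. }
  rewrite lsum_plus in H. lra.
Qed.

Definition compat (s1 s2 : seg) : Prop :=
  (sm s1 = sm s2 \/ sj s1 = sj s2) -> se s1 <= ss s2 \/ se s2 <= ss s1.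

(** Compatibility is symmetric, so the condition on pairs of positions can be stated along the list,
    in a form stable under filtering and appending. *)
Lemma valid_scheduleE m n S :
  valid_schedule m n S <->
  (forall s, In s S -> (sm s < m)%nat /\ (sj s < n)%nat /\ 0 <= ss s /\ ss s < se s) /\
  ForallOrdPairs compat S.
Proof.
  split.
  - intros [H1 H2]. split.
    + intros s Hs. destruct (In_nth _ _ seg0 Hs) as [k [Hk Hs']]. rewrite <- Hs'. apply H1; auto.
    + clear H1. unfold segk in H2. induction S as [|s S IH]; constructor.
      * apply Forall_forall. intros s' Hs'. destruct (In_nth _ _ seg0 Hs') as [k [Hk E]].
        intros Hc. assert (P := H2 O (Datatypes.S k)). simpl in P. rewrite E in P. apply P; auto; lia.
      * apply IH. intros k1 k2 Hk1 Hk2 Hn. apply (H2 (Datatypes.S k1) (Datatypes.S k2)); simpl; lia.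
  - intros [H1 H2]. split.
    + intros k Hk. apply H1. apply nth_In; auto.
    + clear H1. unfold segk. induction H2 as [|s S Hs HS IH]; simpl; [lia|].
      rewrite Forall_forall in Hs.
      intros [|k1] [|k2] Hk1 Hk2 Hn Hc; [congruence| | |].
      * apply (Hs (nth k2 S seg0)); auto. apply nth_In; lia.
      * assert (P := Hs (nth k1 S seg0) ltac:(apply nth_In; lia)).
        destruct P; auto. destruct Hc; auto.
      * apply IH; auto; lia.
Qed.

(** * Work as a function of time, and completion times *)

Section Work.
Variable lam : nat -> nat -> R.
Hypothesis lam_ge0 : forall i j, 0 <= lam i j.

Lemma workE S j t :
  work lam S j t =
  lsum S (fun s => if Nat.eqb (sj s) j then lam (sm s) j * overlap (ss s) (se s) 0 t else 0).
Proof. reflexivity. Qed.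

Lemma work_app S1 S2 j t : work lam (S1 ++ S2) j t = work lam S1 j t + work lam S2 j t.
Proof. rewrite !workE; apply lsum_app. Qed.

Lemma work_mono S j t t' : t <= t' -> work lam S j t <= work lam S j t'.
Proof.
  intros H. rewrite !workE. apply lsum_le. intros s _. destruct (Nat.eqb (sj s) j); [|lra].
  apply Rmult_le_compat_l; auto. apply overlap_mono_window; auto.
Qed.

Lemma work_nonneg S j t : 0 <= work lam S j t.
Proof.
  rewrite workE. apply lsum_nonneg. intros s _. destruct (Nat.eqb (sj s) j); [|lra].
  apply Rmult_le_pos; auto. apply overlap_nonneg.
Qed.

Lemma work_le0 S j t : t <= 0 -> work lam S j t = 0.
Proof.
  intros H. rewrite workE. rewrite (lsum_ext S _ (fun _ => 0)); [rewrite lsum_const; lra|].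
  intros s _. destruct (Nat.eqb (sj s) j); auto.
  replace (overlap (ss s) (se s) 0 t) with 0; [lra|]. minmax.
Qed.

Lemma work_before S j t : (forall s, In s S -> t <= ss s) -> work lam S j t = 0.
Proof.
  intros H. rewrite workE. rewrite (lsum_ext S _ (fun _ => 0)); [rewrite lsum_const; lra|].
  intros s Hs. specialize (H s Hs). destruct (Nat.eqb (sj s) j); auto.
  replace (overlap (ss s) (se s) 0 t) with 0; [lra|]. minmax.
Qed.

Lemma work_after S j t t' : (forall s, In s S -> se s <= t) -> t <= t' ->
  work lam S j t' = work lam S j t.
Proof.
  intros H Ht. rewrite !workE. apply lsum_ext.
  intros s Hs. specialize (H s Hs). destruct (Nat.eqb (sj s) j); auto.
  f_equal. minmax.
Qed.

Lemma work_lipschitz S j : exists L, 0 <= L /\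
  forall t t', t <= t' -> work lam S j t' <= work lam S j t + L * (t' - t).
Proof.
  exists (lsum S (fun s => lam (sm s) j)). split; [apply lsum_nonneg; auto|].
  intros t t' H. rewrite !workE.
  replace (lsum S (fun s => lam (sm s) j) * (t' - t)) with (lsum S (fun s => (t' - t) * lam (sm s) j))
    by (rewrite lsum_scal; lra).
  rewrite <- lsum_plus. apply lsum_le. intros s _.
  assert (0 <= lam (sm s) j) by auto.
  assert (overlap (ss s) (se s) 0 t' <= overlap (ss s) (se s) 0 t + (t' - t)) by minmax.
  destruct (Nat.eqb (sj s) j); nra.
Qed.

(** The completion time is the supremum of the times with less than [p j] done; [work] is Lipschitz
    in time, so the demand is met at the supremum itself. *)
Lemma completes_exists S p j T : 0 < p j -> p j <= work lam S j T ->
  exists C, completes lam S p j C.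
Proof.
  intros Hp HT.
  destruct (work_lipschitz S j) as [L [HL Lip]].
  destruct (completeness (fun t => work lam S j t < p j)) as [C [Hub Hlub]].
  - exists T. intros t Ht. destruct (Rle_or_lt t T); auto.
    assert (work lam S j T <= work lam S j t) by (apply work_mono; lra). lra.
  - exists 0. rewrite work_le0; lra.
  - exists C. split.
    + destruct (Rle_or_lt (p j) (work lam S j C)) as [|Hc]; auto. exfalso.
      set (d := (p j - work lam S j C) / (2 * (L + 1))).
      assert (0 < d) by (unfold d; apply Rdiv_lt_0_compat; lra).
      assert (C + d <= C); [|lra]. apply Hub.
      assert (Q := Lip C (C + d) ltac:(lra)).
      assert (d * (2 * (L + 1)) = p j - work lam S j C) by (unfold d; field; lra). nra.
    + intros t Ht. destruct (Rlt_or_le (work lam S j t) (p j)) as [|Hc]; auto. exfalso.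
      assert (C <= t); [|lra]. apply Hlub. intros u Hu.
      destruct (Rle_or_lt u t); auto.
      assert (work lam S j t <= work lam S j u) by (apply work_mono; lra). lra.
Qed.

Lemma completes_le S p j C T : completes lam S p j C -> p j <= work lam S j T -> C <= T.
Proof.
  intros [_ H] HT. destruct (Rle_or_lt C T) as [|Hc]; auto.
  specialize (H T Hc). lra.
Qed.

End Work.

(** A piece of dual load: height [bw] on machine [bm] during [[bu, bv]]. A list of blocks encodes
    one step function of time per machine. *)
Record block := mkBlock { bm : nat; bw : R; bu : R; bv : R }.

(* Dual fitting: [alpha] and the load function carried by the blocks of [V] play the roles of the
   dual variables of the preemptive relaxation; the extra [kap * (b - a)] is what integrality of the
   assignments costs, and it is charged to the running time of each job in the optimum. *)
Lemma opt_dual m n lam p S C (alpha : nat -> R) (V : list block) (kap : R) :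
  (forall i j, 0 <= lam i j) -> (forall j, (j < n)%nat -> 1 <= p j) ->
  feasible m n lam p S C -> 0 <= kap ->
  (forall x, In x V -> 0 <= bw x /\ bu x <= bv x) ->
  (forall i j a b, (i < m)%nat -> (j < n)%nat -> C j < alpha j -> 0 <= a -> a <= b -> b <= C j ->
     (alpha j - C j) * lam i j * (b - a) <=
     p j * (lsum V (fun x => if Nat.eqb (bm x) i then bw x * overlap a b (bu x) (bv x) else 0)
            + kap * (b - a))) ->
  sumR n alpha <= (1 + kap) * sumR n C + lsum V (fun x => bw x * (bv x - bu x)).
Proof.
  intros Hlam Hp [Hval HC] Hkap HV H.
  apply valid_scheduleE in Hval. destruct Hval as [Hok Hpair].
  assert (HC0 : forall j, (j < n)%nat -> 0 <= C j).
  { intros j Hj. destruct (HC j Hj) as [H1 H2]. destruct (Rle_or_lt 0 (C j)); auto.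
    rewrite work_le0 in H1 by lra. specialize (Hp j Hj). lra. }
  set (ld := fun s a b => lsum V (fun x => if Nat.eqb (bm x) (sm s) then bw x * overlap a b (bu x) (bv x) else 0)).
  assert (Hld0 : forall s a b, 0 <= ld s a b).
  { intros. apply lsum_nonneg. intros x Hx. destruct (Nat.eqb (bm x) (sm s)); [|lra].
    apply Rmult_le_pos; [apply HV; auto|apply overlap_nonneg]. }
  rewrite !sumR_lsum.
  (* The dual value of a job is paid by its completion time, the load met by its segments, and [kap]
     times its running time. *)
  assert (Step : forall j, (j < n)%nat ->
    alpha j <= C j + (lsum S (fun s => if Nat.eqb (sj s) j then ld s (ss s) (se s) else 0)
      + kap * lsum S (fun s => if Nat.eqb (sj s) j then overlap (ss s) (se s) 0 (C j) else 0))).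
  { intros j Hj. specialize (HC0 j Hj).
    assert (P1 : 0 <= lsum S (fun s => if Nat.eqb (sj s) j then ld s (ss s) (se s) else 0)).
    { apply lsum_nonneg. intros s _. destruct (Nat.eqb (sj s) j); auto; lra. }
    assert (P2 : 0 <= lsum S (fun s => if Nat.eqb (sj s) j then overlap (ss s) (se s) 0 (C j) else 0)).
    { apply lsum_nonneg. intros s _. destruct (Nat.eqb (sj s) j); [apply overlap_nonneg|lra]. }
    destruct (Rle_or_lt (alpha j) (C j)) as [|Hlt].
    { assert (0 <= kap * lsum S (fun s => if Nat.eqb (sj s) j then overlap (ss s) (se s) 0 (C j) else 0))
        by (apply Rmult_le_pos; auto). lra. }
    destruct (HC j Hj) as [Hw _]. specialize (Hp j Hj).
    enough (p j * (alpha j - C j) <= p j *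
      (lsum S (fun s => if Nat.eqb (sj s) j then ld s (ss s) (se s) else 0)
      + kap * lsum S (fun s => if Nat.eqb (sj s) j then overlap (ss s) (se s) 0 (C j) else 0))).
    { apply Rmult_le_reg_l in H0; lra. }
    apply Rle_trans with ((alpha j - C j) * work lam S j (C j)); [nra|].
    rewrite workE, <- lsum_scal, <- lsum_scal, <- lsum_plus, <- lsum_scal.
    apply lsum_le. intros s Hs. destruct (Nat.eqb_spec (sj s) j); [|lra].
    destruct (Hok s Hs) as (Hm & _ & Hs0 & Hse).
    (* The segment cut at [C j]; if it starts later, then [a = b] and nothing is left of it. *)
    set (a := Rmin (ss s) (C j)). set (b := Rmin (se s) (C j)).
    assert (Ho : overlap (ss s) (se s) 0 (C j) = b - a) by (unfold a, b; minmax).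
    assert (0 <= a /\ a <= b /\ b <= C j) as (Ha & Hab & Hb) by (unfold a, b; minmax).
    rewrite Ho. specialize (H (sm s) j a b Hm Hj Hlt Ha Hab Hb).
    eapply Rle_trans; [|eapply Rle_trans; [exact H|]].
    { apply Req_le; ring. }
    apply Rmult_le_compat_l; [lra|]. apply Rplus_le_compat_r.
    change (ld s a b <= ld s (ss s) (se s)). unfold ld. apply lsum_le. intros x Hx.
    destruct (Nat.eqb (bm x) (sm s)); [|lra]. apply Rmult_le_compat_l; [apply HV; auto|].
    destruct (Rle_or_lt (ss s) (C j)).
    - apply overlap_shrink; [unfold a; rewrite Rmin_left; lra|apply Rmin_l].
    - apply Rle_trans with 0; [|apply overlap_nonneg].
      unfold a, b. rewrite !Rmin_right by lra. minmax. }
  eapply Rle_trans; [apply lsum_le; intros j Hj; apply Step; apply in_seq in Hj; lia|].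
  rewrite lsum_plus, lsum_plus, lsum_scal.
  (* A job never runs twice at once, so its running time until [C j] is at most [C j]. *)
  assert (Q1 : lsum (seq 0 n) (fun j => lsum S (fun s => if Nat.eqb (sj s) j then overlap (ss s) (se s) 0 (C j) else 0))
     <= lsum (seq 0 n) C).
  { apply lsum_le. intros j Hj. apply in_seq in Hj.
    rewrite <- lsum_filter. apply Rle_trans with (C j - 0); [|lra].
    apply disjoint_overlap_le.
    - eapply ForallOrdPairs_impl; [|apply ForallOrdPairs_filter; exact Hpair].
      intros x y Hx Hy Hc. apply filter_In in Hx, Hy. apply Hc. right.
      destruct Hx as [_ Hx], Hy as [_ Hy]. apply Nat.eqb_eq in Hx, Hy. congruence.
    - intros s Hs. apply filter_In in Hs. destruct (Hok s); [tauto|]. lra.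
    - apply HC0; lia. }
  (* Each segment belongs to a single job and the segments of one machine are disjoint, so a block
     is collected at most once over its window. *)
  assert (Q2 : lsum (seq 0 n) (fun j => lsum S (fun s => if Nat.eqb (sj s) j then ld s (ss s) (se s) else 0))
     <= lsum V (fun x => bw x * (bv x - bu x))).
  { rewrite lsum_swap. eapply Rle_trans.
    { apply lsum_le. intros s _. apply lsum_indicator_le; [apply seq_NoDup|apply Hld0]. }
    unfold ld. rewrite lsum_swap. apply lsum_le. intros x Hx. destruct (HV x Hx) as [Hw Huv].
    rewrite (lsum_ext S _ (fun s => bw x * (if Nat.eqb (sm s) (bm x) then overlap (ss s) (se s) (bu x) (bv x) else 0))).
    2:{ intros s _. rewrite Nat.eqb_sym. destruct (Nat.eqb (sm s) (bm x)); lra. }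
    rewrite lsum_scal. apply Rmult_le_compat_l; auto.
    rewrite <- lsum_filter. apply disjoint_overlap_le; auto.
    - eapply ForallOrdPairs_impl; [|apply ForallOrdPairs_filter; exact Hpair].
      intros y z Hy Hz Hc. apply filter_In in Hy, Hz. apply Hc. left.
      destruct Hy as [_ Hy], Hz as [_ Hz]. apply Nat.eqb_eq in Hy, Hz. congruence.
    - intros s Hs. apply filter_In in Hs. destruct (Hok s); [tauto|]. lra. }
  assert (kap * lsum (seq 0 n) (fun j => lsum S (fun s => if Nat.eqb (sj s) j then overlap (ss s) (se s) 0 (C j) else 0))
    <= kap * lsum (seq 0 n) C) by (apply Rmult_le_compat_l; auto).
  rewrite Rmult_plus_distr_r. unfold ld in *. lra.
Qed.

(** * Nash equilibria *)


(** Assignments are coded as lists of machine indices: they form a finite list, over which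
    maximisers exist. *)
Fixpoint codes (m n : nat) : list (list nat) :=
  match n with
  | O => [[]]
  | S k => flat_map (fun l => map (fun v => v :: l) (seq 0 m)) (codes m k)
  end.

Lemma codesP m n l : In l (codes m n) <-> length l = n /\ Forall (fun v => (v < m)%nat) l.
Proof.
  revert l; induction n; intros l; simpl.
  - split.
    + intros [<-|[]]; auto.
    + intros [H _]. destruct l; auto; discriminate.
  - rewrite in_flat_map. split.
    + intros [l' [H1 H2]]. apply in_map_iff in H2. destruct H2 as [v [<- Hv]].
      apply IHn in H1. apply in_seq in Hv. simpl. split; [lia|]. constructor; [lia|tauto].
    + intros [H1 H2]. destruct l as [|v l]; [discriminate|]. inversion H2; subst.
      exists l. split; [apply IHn; simpl in H1; split; auto|].
      apply in_map_iff. exists v; split; auto. apply in_seq; lia.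
Qed.

Lemma list_argmax {X} (L : list X) (P : X -> Prop) (f : X -> R) :
  (exists x, In x L /\ P x) ->
  exists x, In x L /\ P x /\ forall y, In y L -> P y -> f y <= f x.
Proof.
  induction L as [|a L IH]; intros [x [Hx Px]]; [destruct Hx|].
  destruct (classic (exists y, In y L /\ P y)) as [HL|HL].
  - destruct (IH HL) as [z (Hz & Pz & Mz)].
    destruct (classic (P a /\ f z < f a)) as [[Pa Ha]|Ha].
    + exists a; split; [left; auto|split; auto]. intros y [<-|Hy] Py; [lra|].
      specialize (Mz y Hy Py). lra.
    + exists z; split; [right; auto|split; auto]. intros y [<-|Hy] Py; auto.
      destruct (Rle_or_lt (f a) (f z)); auto. tauto.
  - exists a. assert (P a) by (destruct Hx; [congruence|exfalso; eauto]).
    split; [left; auto|split; auto]. intros y [<-|Hy] Py; [lra|exfalso; eauto].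
Qed.

Definition asg (s : list nat) (j : nat) : nat := nth j s O.

Definition upd (s : list nat) (j a : nat) : list nat :=
  map (fun x => if Nat.eqb x j then a else asg s x) (seq 0 (length s)).

Lemma asg_map_seq (f : nat -> nat) n x : (x < n)%nat -> asg (map f (seq 0 n)) x = f x.
Proof.
  intros H. unfold asg. rewrite (nth_indep _ O (f O)) by (rewrite length_map, length_seq; auto).
  rewrite map_nth, seq_nth; auto.
Qed.

Lemma asg_upd s j a x : (x < length s)%nat -> asg (upd s j a) x = if Nat.eqb x j then a else asg s x.
Proof. intros H. unfold upd. rewrite asg_map_seq; auto. Qed.

Lemma asg_codes m n s j : In s (codes m n) -> (j < n)%nat -> (asg s j < m)%nat.
Proof.
  intros Hs Hj. apply codesP in Hs. destruct Hs as [Hl Hs]. rewrite Forall_forall in Hs.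
  apply Hs. apply nth_In. lia.
Qed.

Lemma map_codes m n f : (forall x, (x < n)%nat -> (f x < m)%nat) -> In (map f (seq 0 n)) (codes m n).
Proof.
  intros H. apply codesP. rewrite length_map, length_seq. split; auto.
  apply Forall_forall. intros v Hv. apply in_map_iff in Hv. destruct Hv as [x [<- Hx]].
  apply in_seq in Hx. apply H; lia.
Qed.

Lemma upd_codes m n s j a : In s (codes m n) -> (a < m)%nat -> In (upd s j a) (codes m n).
Proof.
  intros Hs Ha. assert (length s = n) by (apply codesP in Hs; tauto). unfold upd. rewrite H.
  apply map_codes. intros x Hx. destruct (Nat.eqb x j); auto. eapply asg_codes; eauto.
Qed.

Definition cnt (A : list nat) (s : list nat) (i : nat) : nat :=
  length (filter (fun l => Nat.eqb (asg s l) i) A).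

Definition bool2R (b : bool) : R := if b then 1 else 0.

Lemma cnt_lsum A s i : INR (cnt A s i) = lsum A (fun l => bool2R (Nat.eqb (asg s l) i)).
Proof.
  unfold cnt. rewrite <- (Rmult_1_r (INR _)), <- lsum_const, lsum_filter. reflexivity.
Qed.

Lemma cnt_perm A B s i : Permutation A B -> cnt A s i = cnt B s i.
Proof. intros H. apply INR_eq. rewrite !cnt_lsum. apply lsum_perm; auto. Qed.

Lemma cnt_upd A s j a i : NoDup A -> In j A -> (forall x, In x A -> (x < length s)%nat) ->
  INR (cnt A (upd s j a) i) =
  INR (cnt A s i) + bool2R (Nat.eqb a i) - bool2R (Nat.eqb (asg s j) i).
Proof.
  intros Hn Hj Hl. rewrite !cnt_lsum.
  rewrite (lsum_ext A _ (fun l => bool2R (Nat.eqb (asg s l) i) +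
     (if Nat.eqb l j then bool2R (Nat.eqb a i) - bool2R (Nat.eqb (asg s j) i) else 0))).
  - rewrite lsum_plus, (lsum_pick A j (fun _ => bool2R (Nat.eqb a i) - bool2R (Nat.eqb (asg s j) i))); auto. lra.
  - intros x Hx. rewrite asg_upd by auto. destruct (Nat.eqb_spec x j); subst; lra.
Qed.

Lemma cnt_pos A s j : In j A -> (1 <= cnt A s (asg s j))%nat.
Proof.
  intros H. unfold cnt.
  assert (In j (filter (fun l => Nat.eqb (asg s l) (asg s j)) A)) by (apply filter_In; rewrite Nat.eqb_refl; auto).
  destruct (filter (fun l => Nat.eqb (asg s l) (asg s j)) A); [destruct H0|simpl; lia].
Qed.

(** The logarithm of [k!]. *)
Fixpoint lnf (k : nat) : R := match k with O => 0 | S k => lnf k + ln (INR (S k)) end.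

Section Nash.
Variables (lam : nat -> nat -> R) (m n : nat).
Hypothesis lam_ge0 : forall i j, 0 <= lam i j.
Hypothesis lam_pos : forall j, (j < n)%nat -> exists i, (i < m)%nat /\ 0 < lam i j.

Definition lam_at (s : list nat) (j : nat) : R := lam (asg s j) j.

Definition nash (A s : list nat) : Prop :=
  In s (codes m n) /\
  forall j, In j A -> 0 < lam_at s j /\
    forall i, (i < m)%nat ->
      lam i j * INR (cnt A s (asg s j)) <= lam_at s j * (INR (cnt A s i) + 1).

Definition rate (A s : list nat) (j : nat) : R := lam_at s j / INR (cnt A s (asg s j)).

Lemma INR_cnt_pos A s j : In j A -> 1 <= INR (cnt A s (asg s j)).
Proof. intros H. apply (le_INR 1). apply cnt_pos; auto. Qed.

Lemma rate_pos A s j : nash A s -> In j A -> 0 < rate A s j.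
Proof.
  intros [_ H] Hj. destruct (H j Hj) as [H1 _]. apply Rdiv_lt_0_compat; auto.
  pose proof (INR_cnt_pos A s j Hj). lra.
Qed.

Lemma nash_perm A B s : Permutation A B -> nash A s -> nash B s.
Proof.
  intros HP [H1 H2]. split; auto. intros j Hj.
  destruct (H2 j) as [H3 H4]; [eapply Permutation_in; [apply Permutation_sym; eauto|auto]|].
  split; auto. intros i Hi. rewrite <- !(cnt_perm A B) by auto. auto.
Qed.

Lemma positive_codes : exists s, In s (codes m n) /\ forall j, (j < n)%nat -> 0 < lam_at s j.
Proof.
  destruct (choice (fun j i => (j < n)%nat -> (i < m)%nat /\ 0 < lam i j)) as [f Hf].
  - intros j. destruct (Nat.lt_ge_cases j n) as [Hj|Hj].
    + destruct (lam_pos j Hj) as [i Hi]. exists i; auto.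
    + exists O; lia.
  - exists (map f (seq 0 n)). split.
    + apply map_codes. intros; apply Hf; auto.
    + intros j Hj. unfold lam_at. rewrite asg_map_seq by auto. apply Hf; auto.
Qed.

(* Maximisers of the logarithmic Nash welfare [sum_j ln lam - sum_i ln (n_i!)] are equilibria. *)
Lemma nash_exists A : NoDup A -> incl A (seq 0 n) -> exists s, nash A s.
Proof.
  intros Hn Hi.
  assert (HAn : forall j, In j A -> (j < n)%nat) by (intros j Hj; apply Hi, in_seq in Hj; lia).
  destruct (list_argmax (codes m n) (fun s => forall j, In j A -> 0 < lam_at s j)
     (fun s => lsum A (fun j => ln (lam_at s j)) - lsum (seq 0 m) (fun i => lnf (cnt A s i))))
     as [s (Hs & Ps & Ms)].
  { destruct positive_codes as [s [H1 H2]]. exists s; auto. }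
  exists s. split; auto. intros j Hj. split; auto. intros a Ha.
  assert (Hls : length s = n) by (apply codesP in Hs; tauto).
  destruct (Nat.eq_dec a (asg s j)) as [->|Hne].
  { unfold lam_at. pose proof (lam_ge0 (asg s j) j). nra. }
  pose proof (INR_cnt_pos A s j Hj) as Hc1. pose proof (pos_INR (cnt A s a)) as Hc2.
  pose proof (Ps j Hj) as Hlj.
  destruct (Req_dec (lam a j) 0) as [H0|H0]; [rewrite H0; nra|].
  assert (Hla : 0 < lam a j) by (pose proof (lam_ge0 a j); lra).
  assert (Hup : forall x, In x A -> asg (upd s j a) x = if Nat.eqb x j then a else asg s x)
    by (intros x Hx; apply asg_upd; rewrite Hls; auto).
  specialize (Ms (upd s j a) (upd_codes m n s j a Hs Ha)).
  lapply Ms; clear Ms.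
  2:{ intros x Hx. unfold lam_at. rewrite Hup by auto. destruct (Nat.eqb_spec x j); [congruence|]. apply Ps; auto. }
  intros Ms.
  assert (E1 : lsum A (fun x => ln (lam_at (upd s j a) x)) =
     lsum A (fun x => ln (lam_at s x)) + (ln (lam a j) - ln (lam_at s j))).
  { rewrite (lsum_ext A _ (fun x => ln (lam_at s x) + (if Nat.eqb x j then ln (lam a j) - ln (lam_at s j) else 0))).
    - rewrite lsum_plus, (lsum_pick A j (fun _ => ln (lam a j) - ln (lam_at s j))); auto.
    - intros x Hx. unfold lam_at. rewrite Hup by auto. destruct (Nat.eqb_spec x j); subst; lra. }
  (* Only two occupancies change: the log-factorial of machine [a] gains [ln (n_a + 1)], that of the
     machine left by [j] loses the logarithm of its occupancy. *)
  assert (E2 : lsum (seq 0 m) (fun i => lnf (cnt A (upd s j a) i)) =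
     lsum (seq 0 m) (fun i => lnf (cnt A s i)) + ln (INR (cnt A s a) + 1) - ln (INR (cnt A s (asg s j)))).
  { rewrite (lsum_ext (seq 0 m) _ (fun i => lnf (cnt A s i) +
       ((if Nat.eqb i a then ln (INR (cnt A s a) + 1) else 0) +
        (if Nat.eqb i (asg s j) then - ln (INR (cnt A s (asg s j))) else 0)))).
    - rewrite !lsum_plus.
      rewrite (lsum_pick (seq 0 m) a (fun _ => ln (INR (cnt A s a) + 1))); [|apply seq_NoDup|apply in_seq; lia].
      rewrite (lsum_pick (seq 0 m) (asg s j) (fun _ => - ln (INR (cnt A s (asg s j))))); [|apply seq_NoDup|].
      + lra.
      + apply in_seq. pose proof (asg_codes m n s j Hs (HAn j Hj)). lia.
    - intros i Hi'. assert (Q := cnt_upd A s j a i Hn Hj ltac:(rewrite Hls; auto)).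
      destruct (Nat.eqb_spec i a), (Nat.eqb_spec i (asg s j)); subst; try congruence.
      + rewrite Nat.eqb_refl in Q. destruct (Nat.eqb_spec (asg s j) a); [congruence|].
        unfold bool2R in Q. replace (cnt A (upd s j a) a) with (S (cnt A s a)).
        * cbn [lnf]. rewrite S_INR. lra.
        * apply INR_eq. rewrite S_INR. lra.
      + rewrite Nat.eqb_refl in Q. destruct (Nat.eqb_spec a (asg s j)); [congruence|].
        unfold bool2R in Q. replace (cnt A s (asg s j)) with (S (cnt A (upd s j a) (asg s j))).
        * cbn [lnf]. lra.
        * apply INR_eq. rewrite S_INR. lra.
      + destruct (Nat.eqb_spec a i); [congruence|]. destruct (Nat.eqb_spec (asg s j) i); [congruence|].
        unfold bool2R in Q. replace (cnt A (upd s j a) i) with (cnt A s i); [lra|].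
        apply INR_eq. lra. }
  rewrite E1, E2 in Ms.
  assert (ln (lam a j * INR (cnt A s (asg s j))) <= ln (lam_at s j * (INR (cnt A s a) + 1))).
  { rewrite !ln_mult by lra. lra. }
  destruct (Rle_or_lt (lam a j * INR (cnt A s (asg s j))) (lam_at s j * (INR (cnt A s a) + 1))) as [|Hlt]; auto.
  apply ln_increasing in Hlt; [lra|]. apply Rmult_lt_0_compat; lra.
Qed.

(* When a job leaves, the vacancy travels along a chain of strictly improving moves. Among the
   assignments with a single vacancy relative to [s], a maximiser of the total rate measured with
   the old occupancies is an equilibrium. *)
Lemma nash_remove A s l : NoDup (l :: A) -> incl (l :: A) (seq 0 n) -> nash (l :: A) s ->
  exists s', nash A s' /\ forall j, In j A -> rate (l :: A) s j <= rate A s' j.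
Proof.
  intros Hnd Hincl [Hs HN]. set (B := l :: A) in *.
  assert (HnA : NoDup A) by (inversion Hnd; auto).
  assert (HBn : forall j, In j B -> (j < n)%nat) by (intros j Hj; apply Hincl, in_seq in Hj; lia).
  assert (HAB : forall j, In j A -> In j B) by (intros; right; auto).
  set (N := fun i => INR (cnt B s i)).
  assert (HN0 : forall i, 0 <= N i) by (intros; apply pos_INR).
  (* Candidates have the occupancies [N] minus one at a hole [a], and no rate below its old value
     when rates are measured with [N]. The old [s], with the hole at the machine of [l], is one of
     them. *)
  destruct (list_argmax (codes m n)
    (fun s' => (exists a, (a < m)%nat /\ forall i, INR (cnt A s' i) = N i - bool2R (Nat.eqb a i)) /\
       forall j, In j A -> 0 < lam_at s' j /\
         lam_at s j * N (asg s' j) <= lam_at s' j * N (asg s j))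
    (fun s' => lsum A (fun j => lam_at s' j / N (asg s' j)))) as [s' (Hs' & [[a [Ha Hole]] Ps] & Ms)].
  { exists s. split; auto. split.
    - exists (asg s l). split; [eapply asg_codes; eauto; apply HBn; left; auto|].
      intros i. unfold N. rewrite !cnt_lsum. unfold B. rewrite lsum_cons. lra.
    - intros j Hj. split; [apply HN; auto|lra]. }
  assert (Hls : length s' = n) by (apply codesP in Hs'; tauto).
  assert (Hge : forall j, In j A -> 1 <= INR (cnt A s' (asg s' j)) <= N (asg s' j)).
  { intros j Hj. pose proof (INR_cnt_pos A s' j Hj). rewrite Hole in H. rewrite Hole.
    unfold bool2R in *. destruct (Nat.eqb a (asg s' j)); lra. }
  assert (Hold : forall j, In j A -> 1 <= N (asg s j)) by (intros; apply INR_cnt_pos; auto).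
  exists s'. split.
  - split; auto. intros j Hj. destruct (Ps j Hj) as [Hpos Hcmp]. split; auto. intros i Hi.
    destruct (HN j (HAB j Hj)) as [Hsj HNj]. specialize (HNj i Hi). fold (N i) (N (asg s j)) in HNj.
    destruct (Hge j Hj) as [G1 G2]. specialize (Hold j Hj).
    (* If moving into the hole paid, the move would produce a candidate with a larger total, whose
       hole is the machine left behind. *)
    destruct (Nat.eq_dec i a) as [->|Hia].
    + assert (Hca : INR (cnt A s' a) + 1 = N a) by (rewrite Hole, Nat.eqb_refl; unfold bool2R; lra).
      rewrite Hca.
      destruct (Nat.eq_dec (asg s' j) a) as [Hja|Hja].
      { rewrite Hja in *. unfold lam_at in *. rewrite Hja in *. apply Rmult_le_compat_l; [apply lam_ge0|lra]. }
      destruct (Req_dec (lam a j) 0) as [H0|H0]; [rewrite H0; specialize (HN0 a); nra|].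
      assert (Hla : 0 < lam a j) by (pose proof (lam_ge0 a j); lra).
      assert (HNa : 1 <= N a) by (rewrite <- Hca; pose proof (pos_INR (cnt A s' a)); lra).
      apply Rle_trans with (lam a j * N (asg s' j)); [apply Rmult_le_compat_l; lra|].
      destruct (Rle_or_lt (lam a j * N (asg s' j)) (lam_at s' j * N a)) as [|Hlt]; auto. exfalso.
      assert (Himp : lam_at s' j / N (asg s' j) < lam a j / N a).
      { apply (Rmult_lt_reg_r (N (asg s' j) * N a)); [apply Rmult_lt_0_compat; lra|].
        replace (lam_at s' j / N (asg s' j) * (N (asg s' j) * N a)) with (lam_at s' j * N a) by (field; lra).
        replace (lam a j / N a * (N (asg s' j) * N a)) with (lam a j * N (asg s' j)) by (field; lra). auto. }
      assert (Hup : forall x, In x A -> asg (upd s' j a) x = if Nat.eqb x j then a else asg s' x)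
        by (intros x Hx; apply asg_upd; rewrite Hls; auto).
      specialize (Ms (upd s' j a) (upd_codes m n s' j a Hs' Ha)). lapply Ms; clear Ms.
      * rewrite (lsum_ext A (fun x => lam_at (upd s' j a) x / _) (fun x => lam_at s' x / N (asg s' x) +
          (if Nat.eqb x j then lam a j / N a - lam_at s' j / N (asg s' j) else 0))).
        -- rewrite lsum_plus, (lsum_pick A j (fun _ => lam a j / N a - lam_at s' j / N (asg s' j))); auto. lra.
        -- intros x Hx. unfold lam_at. rewrite Hup by auto. destruct (Nat.eqb_spec x j); subst; lra.
      * split.
        -- exists (asg s' j). split; [eapply asg_codes; eauto|].
           intros i. rewrite cnt_upd by (try rewrite Hls; auto). rewrite Hole. lra.
        -- intros x Hx. unfold lam_at at 1 3. rewrite Hup by auto.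
           destruct (Nat.eqb_spec x j); [subst x|apply Ps; auto]. split; auto.
           apply (Rmult_le_reg_r (N (asg s' j))); [lra|]. nra.
    (* Away from the hole the occupancy of [i] is the old one, so the old equilibrium condition
       combines with the fact that the rate of [j] has not dropped. *)
    + rewrite (Hole i). replace (bool2R (Nat.eqb a i)) with 0 by (unfold bool2R; destruct (Nat.eqb_spec a i); congruence).
      apply Rle_trans with (lam i j * N (asg s' j)); [apply Rmult_le_compat_l; auto; lra|].
      apply (Rmult_le_reg_r (N (asg s j))); [lra|].
      specialize (HN0 i). nra.
  - intros j Hj. destruct (Ps j Hj) as [Hpos Hcmp]. destruct (Hge j Hj) as [G1 G2]. specialize (Hold j Hj).
    (* True occupancies are at most [N], so the true rate is at least the one measured with [N]. *)
    unfold rate. fold B. fold (N (asg s j)).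
    apply (Rmult_le_reg_r (N (asg s j) * INR (cnt A s' (asg s' j)))); [apply Rmult_lt_0_compat; lra|].
    replace (lam_at s j / N (asg s j) * (N (asg s j) * INR (cnt A s' (asg s' j))))
      with (lam_at s j * INR (cnt A s' (asg s' j))) by (field; lra).
    replace (lam_at s' j / INR (cnt A s' (asg s' j)) * (N (asg s j) * INR (cnt A s' (asg s' j))))
      with (lam_at s' j * N (asg s j)) by (field; lra).
    apply Rle_trans with (lam_at s j * N (asg s' j)); auto. apply Rmult_le_compat_l; [apply lam_ge0|auto].
Qed.

Lemma nash_shrink k : forall A A' s, length A = (length A' + k)%nat ->
  NoDup A -> NoDup A' -> incl A' A -> incl A (seq 0 n) -> nash A s ->
  exists s', nash A' s' /\ forall j, In j A' -> rate A s j <= rate A' s' j.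
Proof.
  induction k; intros A A' s Hlen HnA HnA' Hinc HA HN.
  - assert (HP : Permutation A A').
    { apply Permutation_sym, NoDup_Permutation_bis; auto; lia. }
    exists s. split; [eapply nash_perm; eauto|]. intros j Hj. unfold rate.
    rewrite (cnt_perm A A' s _ HP). lra.
  - assert (exists l, In l A /\ ~ In l A') as [l [Hl Hl']].
    { apply NNPP. intros Hc. assert (incl A A').
      { intros x Hx. apply NNPP. intros Hx'. apply Hc; eauto. }
      pose proof (NoDup_incl_length HnA H). lia. }
    destruct (in_split l A Hl) as [A1 [A2 HA12]].
    set (A0 := A1 ++ A2).
    assert (HP : Permutation A (l :: A0)) by (rewrite HA12; apply Permutation_sym, Permutation_middle).
    assert (HnA0 : NoDup (l :: A0)) by (eapply Permutation_NoDup; eauto).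
    assert (Hinc0 : incl (l :: A0) (seq 0 n)).
    { intros x Hx. apply HA. eapply Permutation_in; [apply Permutation_sym; eauto|auto]. }
    destruct (nash_remove A0 s l) as [s1 [N1 R1]]; auto.
    { eapply nash_perm; eauto. }
    destruct (IHk A0 A' s1) as [s2 [N2 R2]]; auto.
    + apply Permutation_length in HP. simpl in HP. lia.
    + inversion HnA0; auto.
    + intros x Hx. assert (In x (l :: A0)) as [->|] by (eapply Permutation_in; eauto); auto. tauto.
    + intros x Hx; apply Hinc0; right; auto.
    + exists s2. split; auto. intros j Hj. eapply Rle_trans; [|apply R2; auto].
      eapply Rle_trans; [|apply R1].
      * unfold rate. rewrite (cnt_perm A (l :: A0) s _ HP). lra.
      * assert (In j (l :: A0)) as [->|] by (eapply Permutation_in; [exact HP|auto]); auto. tauto.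
Qed.

Lemma nash_continue A A' s : NoDup A -> NoDup A' -> incl A' A -> incl A (seq 0 n) -> nash A s ->
  exists s', nash A' s' /\ forall j, In j A' -> rate A s j <= rate A' s' j.
Proof.
  intros HnA HnA' Hinc HA HN. pose proof (NoDup_incl_length HnA' Hinc).
  apply (nash_shrink (length A - length A') A A' s); auto. lia.
Qed.

End Nash.

(** * The round machine *)


Lemma Rleb_true x y : Rleb x y = true <-> x <= y.
Proof. unfold Rleb. destruct (Rle_dec x y); split; intros; auto; try discriminate; contradiction. Qed.

Lemma Rltb_true x y : Rltb x y = true <-> x < y.
Proof. unfold Rltb. destruct (Rlt_dec x y); split; intros; auto; try discriminate; contradiction. Qed.

Lemma filter_length_incl {X} (P Q : X -> bool) A : (forall x, In x A -> P x = true -> Q x = true) ->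
  (length (filter P A) <= length (filter Q A))%nat.
Proof.
  induction A; intros H; simpl; auto.
  assert (IH := IHA (fun x Hx => H x (or_intror Hx))). assert (Ha := H a (or_introl eq_refl)).
  destruct (P a); [rewrite Ha by auto; simpl; lia|]. destruct (Q a); simpl; lia.
Qed.

Lemma filter_length_strict {X} (P Q : X -> bool) A z : (forall x, In x A -> P x = true -> Q x = true) ->
  In z A -> Q z = true -> P z = false -> (length (filter P A) < length (filter Q A))%nat.
Proof.
  induction A; intros H Hz Qz Pz; simpl; [destruct Hz|].
  assert (H' := fun x Hx => H x (or_intror Hx)). assert (Ha := H a (or_introl eq_refl)).
  destruct Hz as [->|Hz].
  - rewrite Qz, Pz. simpl. pose proof (filter_length_incl P Q A H'). lia.
  - specialize (IHA H' Hz Qz Pz). destruct (P a); [rewrite Ha by auto; simpl; lia|]. destruct (Q a); simpl; lia.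
Qed.

(** [beta] is the growth factor of local time per round, [delta] the threshold below which a slot is
    skipped relative to [theta]. Their product [1/50] is the fraction of [theta_j] that skipping can
    cost. *)
Definition beta : R := 51 / 50.
Definition delta : R := 1 / 51.

(* [sc]: schedule emitted so far, up to time [tm]; [al]: jobs alive; [ph]: predictions are in use;
   [loc]: time since the start of the phase; [sg]: current assignment. *)
Record st := mkSt
  { sc : schedule; tm : R; al : list nat; ph : bool; loc : R; sg : list nat }.

Section Machine.
Variables (lam : nat -> nat -> R) (m n g : nat) (phat : nat -> R).

(* Geometric rounds cannot start at local time 0; each phase idles for this negligible time first. *)
Definition tau0 : R := / (1000 * (1 + lsum (seq 0 n) (fun j => lsum (seq 0 m) (fun i => lam i j)))).

Definition theta (b : bool) (j : nat) : R := if b then Rmax 1 (phat j) else 1.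

(** Choosing by [epsilon] makes the assignment, here and in [nextsg], a function of the sets alive
    and the previous assignment alone, so equal histories give equal assignments. *)
Definition nash0 (A : list nat) : list nat := epsilon (inhabits []) (fun s => nash lam m n A s).

Definition nextsg (s A A' : list nat) : list nat :=
  epsilon (inhabits []) (fun s' => nash lam m n A' s' /\
     forall j, In j A' -> rate lam A s j <= rate lam A' s' j).

Definition rnk (x : st) (j : nat) : nat :=
  length (filter (fun l => Nat.ltb l j && Nat.eqb (asg (sg x) l) (asg (sg x) j)) (al x)).

Definition width (x : st) (j : nat) : R :=
  (beta - 1) * loc x / INR (cnt (al x) (sg x) (asg (sg x) j)).

Definition slot (x : st) (j : nat) : seg :=
  mkSeg (asg (sg x) j) j (tm x + INR (rnk x j) * width x j) (tm x + INR (S (rnk x j)) * width x j).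

Definition exec (x : st) (j : nat) : bool :=
  Rleb (delta * theta (ph x) j) (rate lam (al x) (sg x) j * loc x).

(* Slots are not cut when their job completes, so a round depends only on the jobs alive at its start. *)
Definition emit (x : st) : schedule := map (slot x) (filter (exec x) (al x)).

(* The test [Rleb] is not strict because [nonclairvoyant] does not let an algorithm react to a job whose
   size equals the work it has received. *)
Definition round (p : nat -> R) (x : st) : st :=
  let S' := sc x ++ emit x in
  let t' := tm x + (beta - 1) * loc x in
  let A' := filter (fun j => Rleb (work lam S' j t') (p j)) (al x) in
  mkSt S' t' A' (ph x) (beta * loc x) (nextsg (sg x) (al x) A').

Definition switch (x : st) : bool := ph x && Nat.leb (length (al x)) (51 * g).

Definition step (p : nat -> R) (x : st) : st :=
  if switch x then mkSt (sc x) (tm x + tau0) (al x) false tau0 (nash0 (al x)) else round p x.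

Hypothesis lam_ge0 : forall i j, 0 <= lam i j.
Hypothesis lam_pos : forall j, (j < n)%nat -> exists i, (i < m)%nat /\ 0 < lam i j.

Lemma tau0_pos : 0 < tau0.
Proof.
  apply Rinv_0_lt_compat.
  assert (0 <= lsum (seq 0 n) (fun j => lsum (seq 0 m) (fun i => lam i j))); [|lra].
  apply lsum_nonneg; intros. apply lsum_nonneg; auto.
Qed.

(** A job whose work equals its size still counts as alive; it leaves only once its work strictly
    exceeds [p j]. *)
Definition inv (p : nat -> R) (x : st) : Prop :=
  ((forall s, In s (sc x) -> (sm s < m)%nat /\ (sj s < n)%nat /\ 0 <= ss s /\ ss s < se s /\ se s <= tm x) /\
   ForallOrdPairs compat (sc x)) /\
  (NoDup (al x) /\ (forall j, In j (al x) <-> (j < n)%nat /\ work lam (sc x) j (tm x) <= p j)) /\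
  nash lam m n (al x) (sg x) /\ 0 < loc x /\ 0 <= tm x.

Lemma nash0_spec A : NoDup A -> incl A (seq 0 n) -> nash lam m n A (nash0 A).
Proof. intros. unfold nash0. apply epsilon_spec. apply nash_exists; auto. Qed.

Lemma nextsg_spec s A A' : NoDup A -> NoDup A' -> incl A' A -> incl A (seq 0 n) -> nash lam m n A s ->
  nash lam m n A' (nextsg s A A') /\
  forall j, In j A' -> rate lam A s j <= rate lam A' (nextsg s A A') j.
Proof. intros. unfold nextsg. apply epsilon_spec. apply nash_continue; auto. Qed.

Lemma inv_incl p x : inv p x -> incl (al x) (seq 0 n).
Proof. intros (_ & (_ & H) & _) j Hj. apply H in Hj. apply in_seq; lia. Qed.

Lemma width_pos p x j : inv p x -> In j (al x) -> 0 < width x j.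
Proof.
  intros (_ & _ & _ & Hl & _) Hj. unfold width, beta.
  pose proof (INR_cnt_pos (al x) (sg x) j Hj). apply Rdiv_lt_0_compat; lra.
Qed.

Lemma rnk_lt_cnt x j : In j (al x) -> (S (rnk x j) <= cnt (al x) (sg x) (asg (sg x) j))%nat.
Proof.
  intros Hj. unfold rnk, cnt. apply (filter_length_strict _ _ _ j).
  - intros y _ H. apply andb_prop in H; tauto.
  - auto.
  - apply Nat.eqb_refl.
  - rewrite Nat.ltb_irrefl; auto.
Qed.

Lemma rnk_lt x l j : In l (al x) -> (l < j)%nat -> asg (sg x) l = asg (sg x) j ->
  (S (rnk x l) <= rnk x j)%nat.
Proof.
  intros Hl Hlj Hs. unfold rnk. apply (filter_length_strict _ _ _ l); auto.
  - intros y _ H. apply andb_prop in H. destruct H as [H1 H2]. apply Nat.ltb_lt in H1.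
    rewrite <- Hs, H2, andb_true_r. apply Nat.ltb_lt; lia.
  - rewrite Hs, Nat.eqb_refl, andb_true_r. apply Nat.ltb_lt; auto.
  - rewrite Nat.ltb_irrefl; auto.
Qed.

Lemma slot_bounds p x j : inv p x -> In j (al x) ->
  tm x <= ss (slot x j) /\ se (slot x j) = ss (slot x j) + width x j /\
  se (slot x j) <= tm x + (beta - 1) * loc x.
Proof.
  intros HI Hj. pose proof (width_pos p x j HI Hj) as Hw. pose proof (pos_INR (rnk x j)).
  change (se (slot x j)) with (tm x + INR (S (rnk x j)) * width x j).
  change (ss (slot x j)) with (tm x + INR (rnk x j) * width x j). split; [nra|split; [rewrite S_INR; ring|]].
  apply Rplus_le_compat_l.
  apply Rle_trans with (INR (cnt (al x) (sg x) (asg (sg x) j)) * width x j).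
  - apply Rmult_le_compat_r; [lra|]. apply le_INR, rnk_lt_cnt; auto.
  - pose proof (INR_cnt_pos (al x) (sg x) j Hj). unfold width. right. field. lra.
Qed.

(** The width of a slot is the length of the round divided by the occupancy, so running at full
    speed in it yields [rate] times the length of the round. *)
Lemma work_emit p x j : inv p x -> In j (al x) ->
  work lam (emit x) j (tm x + (beta - 1) * loc x) =
  if exec x j then rate lam (al x) (sg x) j * ((beta - 1) * loc x) else 0.
Proof.
  intros HI Hj. rewrite workE. unfold emit. rewrite lsum_map, lsum_filter.
  set (t := tm x + (beta - 1) * loc x).
  rewrite (lsum_ext (al x) _ (fun l => if Nat.eqb l j then
     (if exec x l then lam (asg (sg x) l) l * overlap (ss (slot x l)) (se (slot x l)) 0 t else 0) else 0)).
  - rewrite (lsum_pick (al x) j (fun l => if exec x l then lam (asg (sg x) l) l * overlap (ss (slot x l)) (se (slot x l)) 0 t else 0));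
      auto; [|destruct HI as (_ & (H & _) & _); auto].
    destruct (exec x j); auto. destruct (slot_bounds p x j HI Hj) as (B1 & B2 & B3).
    pose proof (width_pos p x j HI Hj). destruct HI as (_ & _ & _ & _ & Ht).
    rewrite overlap_inside by (unfold t; lra).
    replace (se (slot x j) - ss (slot x j)) with (width x j) by lra.
    pose proof (INR_cnt_pos (al x) (sg x) j Hj). unfold width, rate, lam_at. field. lra.
  - intros l Hl. destruct (exec x l); [|destruct (Nat.eqb l j); auto].
    simpl. destruct (Nat.eqb_spec l j); subst; auto.
Qed.

Lemma work_emit_dead x j t : ~ In j (al x) -> work lam (emit x) j t = 0.
Proof.
  intros Hj. rewrite workE. rewrite (lsum_ext _ _ (fun _ => 0)); [rewrite lsum_const; lra|].
  intros s Hs. apply in_map_iff in Hs. destruct Hs as [l [<- Hl]]. apply filter_In in Hl.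
  simpl. destruct (Nat.eqb_spec l j); auto. subst; tauto.
Qed.

Lemma sc_work_after p x j t : inv p x -> tm x <= t -> work lam (sc x) j t = work lam (sc x) j (tm x).
Proof. intros ((H & _) & _) Ht. apply work_after; auto. intros s Hs. apply H in Hs. tauto. Qed.

Lemma emit_bounds p x s : inv p x -> In s (emit x) ->
  (sm s < m)%nat /\ (sj s < n)%nat /\ tm x <= ss s /\ ss s < se s /\ se s <= tm (round p x).
Proof.
  intros HI Hs. apply in_map_iff in Hs. destruct Hs as [j [<- Hj]]. apply filter_In in Hj.
  destruct Hj as [Hj _].
  destruct (slot_bounds p x j HI Hj) as (B1 & B2 & B3). pose proof (width_pos p x j HI Hj).
  assert (Hjn : (j < n)%nat) by (apply (inv_incl p x HI), in_seq in Hj; lia).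
  destruct HI as (_ & _ & (Hc & _) & _).
  repeat split; simpl; auto; try lra.
  - eapply asg_codes; eauto.
  - simpl in *. lra.
Qed.

Lemma round_work_dead p x j : inv p x -> ~ In j (al x) ->
  work lam (sc (round p x)) j (tm (round p x)) = work lam (sc x) j (tm x).
Proof.
  intros HI Hj. simpl. rewrite work_app, work_emit_dead by auto.
  rewrite (sc_work_after p x); auto; [lra|]. destruct HI as (_ & _ & _ & Hl & _). unfold beta. lra.
Qed.

Lemma round_work p x j : inv p x -> In j (al x) ->
  work lam (sc (round p x)) j (tm (round p x)) = work lam (sc x) j (tm x) +
   (if exec x j then rate lam (al x) (sg x) j * ((beta - 1) * loc x) else 0).
Proof.
  intros HI Hj. simpl. rewrite work_app, (work_emit p x j HI Hj).
  rewrite (sc_work_after p x); auto. destruct HI as (_ & _ & _ & Hl & _). unfold beta. lra.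
Qed.

Lemma al_round p x j : In j (al (round p x)) <->
  In j (al x) /\ work lam (sc (round p x)) j (tm (round p x)) <= p j.
Proof. simpl. rewrite filter_In, Rleb_true. tauto. Qed.

Lemma round_nash p x : inv p x -> nash lam m n (al (round p x)) (sg (round p x)) /\
  forall j, In j (al (round p x)) -> rate lam (al x) (sg x) j <= rate lam (al (round p x)) (sg (round p x)) j.
Proof.
  intros HI. apply nextsg_spec.
  - apply HI.
  - apply NoDup_filter, HI.
  - apply incl_filter.
  - eapply inv_incl; eauto.
  - apply HI.
Qed.

Lemma round_inv p x : inv p x -> inv p (round p x).
Proof.
  intros HI. pose proof HI as ((H1 & H2) & (H3 & H4) & H5 & H6 & H7).
  assert (Htm : tm x <= tm (round p x)) by (simpl; unfold beta; lra).
  split; [split|split; [split|split; [|split]]].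
  - simpl sc. intros s Hs. apply in_app_iff in Hs. destruct Hs as [Hs|Hs].
    + destruct (H1 s Hs) as (?&?&?&?&?). repeat split; auto. lra.
    + destruct (emit_bounds p x s HI Hs) as (?&?&?&?&?). repeat split; auto. lra.
  - simpl sc. apply ForallOrdPairs_app; auto.
    + unfold emit. apply ForallOrdPairs_map. apply NoDup_ForallOrdPairs; [apply NoDup_filter; auto|].
      intros l j Hl Hj Hne. apply filter_In in Hl, Hj. destruct Hl as [Hl _], Hj as [Hj _].
      intros [Hc|Hc]; simpl in Hc; [|congruence].
      assert (Hw : width x l = width x j) by (unfold width; rewrite Hc; auto).
      pose proof (width_pos p x j HI Hj) as Hwp.
      change (tm x + INR (S (rnk x l)) * width x l <= tm x + INR (rnk x j) * width x j \/
              tm x + INR (S (rnk x j)) * width x j <= tm x + INR (rnk x l) * width x l).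
      destruct (Nat.lt_gt_cases l j) as [Hd _]. destruct (Hd Hne) as [Hlt|Hlt].
      * left. pose proof (rnk_lt x l j Hl Hlt Hc) as Hr. apply le_INR in Hr. rewrite Hw.
        apply Rplus_le_compat_l. apply Rmult_le_compat_r; [lra|]. exact Hr.
      * right. pose proof (rnk_lt x j l Hj Hlt (eq_sym Hc)) as Hr. apply le_INR in Hr. rewrite Hw.
        apply Rplus_le_compat_l. apply Rmult_le_compat_r; [lra|]. exact Hr.
    + intros s s' Hs Hs'. destruct (H1 s Hs) as (?&?&?&?&?).
      destruct (emit_bounds p x s' HI Hs') as (?&?&?&?&?). intros _. left. lra.
  - apply NoDup_filter; auto.
  - intros j. rewrite al_round, H4. split; [tauto|]. intros [Hj Hw]. split; auto. split; auto.
    destruct (in_dec Nat.eq_dec j (al x)) as [Hi|Hi]; [apply H4 in Hi; tauto|].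
    rewrite round_work_dead in Hw; auto.
  - apply round_nash; auto.
  - simpl. unfold beta. lra.
  - lra.
Qed.

Lemma step_inv p x : inv p x -> inv p (step p x).
Proof.
  intros HI. unfold step. destruct (switch x); [|apply round_inv; auto].
  pose proof tau0_pos as Ht.
  pose proof HI as ((H1 & H2) & (H3 & H4) & H5 & H6 & H7).
  split; [split|split; [split|split; [|split]]]; simpl; auto; try lra.
  - intros s Hs. destruct (H1 s Hs) as (?&?&?&?&?). repeat split; auto. lra.
  - intros j. rewrite H4, (sc_work_after p x j (tm x + tau0)) by (auto; lra). tauto.
  - apply nash0_spec; auto. eapply inv_incl; eauto.
Qed.

(** * Non-clairvoyance of the round machine *)

Definition valid_sizes (p : nat -> R) : Prop := forall j, (j < n)%nat -> 1 <= p j.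

(** Both size vectors answer every comparison of work with size before [t] alike; states depend on
    the sizes through such comparisons only. *)
Definition informed (S : schedule) (p p' : nat -> R) (t : R) : Prop :=
  forall u j, u < t -> (j < n)%nat -> (work lam S j u <= p j <-> work lam S j u <= p' j).

(** Either the state is reached before [t] and is the same for both size vectors, or both schedules
    already extend to [t] and agree before it. The second case persists, because later steps append
    only later segments. *)
Definition online (X : (nat -> R) -> st) : Prop :=
  forall p p' t, valid_sizes p -> valid_sizes p' -> informed (sc (X p)) p p' t ->
    (tm (X p) < t /\ X p' = X p) \/
    (t <= tm (X p) /\ t <= tm (X p') /\
     forall i s, s < t -> state (sc (X p)) i s = state (sc (X p')) i s).

Lemma state_app S S' i s : (forall x, In x S' -> s < ss x) -> state (S ++ S') i s = state S i s.
Proof.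
  intros H. unfold state.
  enough (forall f : seg -> bool, (forall x, In x S' -> f x = false) -> find f (S ++ S') = find f S) as E.
  - rewrite E; auto. intros x Hx. specialize (H x Hx).
    assert (Rleb (ss x) s = false) as ->.
    { unfold Rleb. destruct (Rle_dec (ss x) s); auto; lra. }
    rewrite andb_false_r; auto.
  - intros f Hf. induction S; simpl.
    + clear H. induction S'; simpl; auto. rewrite Hf by (left; auto). apply IHS'; intros; apply Hf; right; auto.
    + rewrite IHS; auto.
Qed.

Lemma step_sc p x : inv p x -> tm x <= tm (step p x) /\
  exists E, sc (step p x) = sc x ++ E /\ forall s, In s E -> tm x <= ss s.
Proof.
  intros HI. unfold step. destruct (switch x).
  - simpl. pose proof tau0_pos. split; [lra|]. exists []. rewrite app_nil_r. split; auto. intros s [].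
  - split; [destruct HI as (_ & _ & _ & Hl & _); simpl; unfold beta; lra|].
    exists (emit x). split; auto. intros s Hs. apply (emit_bounds p x s HI Hs).
Qed.

Lemma online_step X : (forall p, valid_sizes p -> inv p (X p)) -> online X -> online (fun p => step p (X p)).
Proof.
  intros HI HX p p' t Vp Vp' Hinf.
  pose proof (HI p Vp) as Ip. pose proof (HI p' Vp') as Ip'.
  destruct (step_sc p (X p) Ip) as [Ht [E [HE HsE]]].
  destruct (step_sc p' (X p') Ip') as [Ht' [E' [HE' HsE']]].
  (* The appended segments [E] do no work before [tm (X p)], and from then on the work of the
     shorter schedule is frozen, so a later [u] can be replaced by [tm (X p)]. *)
  assert (Hinf0 : informed (sc (X p)) p p' t).
  { intros u j Hu Hj. destruct (Rle_or_lt u (tm (X p))) as [Hc|Hc].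
    - specialize (Hinf u j Hu Hj). rewrite HE, work_app in Hinf.
      rewrite (work_before lam E) in Hinf by (intros s Hs; specialize (HsE s Hs); lra).
      rewrite Rplus_0_r in Hinf. exact Hinf.
    - specialize (Hinf (tm (X p)) j ltac:(lra) Hj). rewrite HE, work_app in Hinf.
      rewrite (work_before lam E) in Hinf by auto.
      rewrite Rplus_0_r in Hinf. rewrite (sc_work_after p (X p)) by (auto; lra). exact Hinf. }
  destruct (HX p p' t Vp Vp' Hinf0) as [[H1 H2]|(H1 & H2 & H3)].
  - rewrite H2 in *. destruct (Rlt_or_le (tm (step p (X p))) t) as [Hlt|Hle].
    + left. split; auto. unfold step in *. destruct (switch (X p)); auto.
      unfold round. assert (EA : filter (fun j => Rleb (work lam (sc (X p) ++ emit (X p)) j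
          (tm (X p) + (beta - 1) * loc (X p))) (p' j)) (al (X p)) =
        filter (fun j => Rleb (work lam (sc (X p) ++ emit (X p)) j
          (tm (X p) + (beta - 1) * loc (X p))) (p j)) (al (X p))).
      { apply filter_ext_in. intros j Hj. apply eq_true_iff_eq. rewrite !Rleb_true. symmetry.
        apply Hinf; auto. apply (inv_incl p _ Ip), in_seq in Hj; lia. }
      rewrite EA. reflexivity.
    (* The step ends at or after [t]: only its filter of jobs alive reads the sizes, so segments and
       end time agree even if the survivors differ. *)
    + right. assert (Es : sc (step p' (X p)) = sc (step p (X p)) /\ tm (step p' (X p)) = tm (step p (X p))).
      { unfold step. destruct (switch (X p)); auto. }
      destruct Es as [Es1 Es2]. rewrite Es1, Es2. auto.
  - right. split; [lra|split; [lra|]]. intros i s Hs. rewrite HE, HE', !state_app; auto.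
    + intros y Hy. specialize (HsE' y Hy). lra.
    + intros y Hy. specialize (HsE y Hy). lra.
Qed.

Fixpoint iterate {X : Type} (k : nat) (f : X -> X) (x : X) : X :=
  match k with O => x | S k => f (iterate k f x) end.

Lemma iterate_inv p k x : inv p x -> inv p (iterate k (step p) x).
Proof. intros H; induction k; simpl; auto. apply step_inv; auto. Qed.

Lemma iterate_online k X : (forall p, valid_sizes p -> inv p (X p)) -> online X ->
  online (fun p => iterate k (step p) (X p)).
Proof.
  intros HI HX; induction k; simpl; auto.
  apply (online_step (fun p => iterate k (step p) (X p))); auto.
  intros; apply iterate_inv; auto.
Qed.

Lemma step_done p x : al x = [] -> al (step p x) = [] /\ sc (step p x) = sc x.
Proof.
  intros H. unfold step. destruct (switch x); simpl; auto. unfold emit. rewrite H. simpl.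
  rewrite app_nil_r; auto.
Qed.

Lemma iterate_done p x k k' : al (iterate k (step p) x) = [] -> (k <= k')%nat ->
  al (iterate k' (step p) x) = [] /\ sc (iterate k' (step p) x) = sc (iterate k (step p) x).
Proof.
  intros H Hk. induction Hk; simpl; auto.
  destruct IHHk as [H1 H2]. destruct (step_done p _ H1). split; congruence.
Qed.

End Machine.

(** * Analysis of a phase *)


Lemma overlap_additive a b c d e : a <= b -> c <= d -> d <= e ->
  overlap a b c e = overlap a b c d + overlap a b d e.
Proof. intros; minmax. Qed.

Lemma overlap_zero a b c d : b <= c -> overlap a b c d = 0.
Proof. intros; minmax. Qed.

Definition mem (j : nat) (A : list nat) : bool := if in_dec Nat.eq_dec j A then true else false.

Lemma mem_true j A : mem j A = true <-> In j A.
Proof. unfold mem. destruct (in_dec Nat.eq_dec j A); split; intros; auto; try discriminate; contradiction. Qed.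

Lemma lsum_sublist (A B : list nat) f : NoDup A -> NoDup B -> incl A B ->
  lsum A f = lsum B (fun x => if mem x A then f x else 0).
Proof.
  intros HA HB H. rewrite <- lsum_filter. apply lsum_perm. apply NoDup_Permutation; auto.
  - apply NoDup_filter; auto.
  - intros x. rewrite filter_In, mem_true. split; [intros; split; auto|tauto].
Qed.

Lemma lsum_seq_S k (f : nat -> R) : lsum (seq 0 (S k)) f = lsum (seq 0 k) f + f k.
Proof. rewrite seq_S, lsum_app. unfold lsum at 2; simpl. lra. Qed.

Lemma lsum_filter_length {X} (P : X -> bool) (L : list X) : INR (length (filter P L)) = lsum L (fun x => bool2R (P x)).
Proof. rewrite <- (Rmult_1_r (INR _)), <- lsum_const, lsum_filter. reflexivity. Qed.

Definition cst1 : R := / ln beta.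
(* [2601 = beta / ((beta - 1) * delta)]. *)
Definition cst0 : R := 1 + ln 2601 * cst1.

Lemma ln_beta_pos : 0 < ln beta.
Proof. rewrite <- ln_1. apply ln_increasing; unfold beta; lra. Qed.

Lemma cst1_pos : 0 < cst1.
Proof. apply Rinv_0_lt_compat, ln_beta_pos. Qed.

Lemma cst0_pos : 0 < cst0.
Proof.
  unfold cst0. pose proof cst1_pos. assert (0 < ln 2601) by (rewrite <- ln_1; apply ln_increasing; lra).
  nra.
Qed.

Lemma ln_ge0 x : 1 <= x -> 0 <= ln x.
Proof. intros H. rewrite <- ln_1. destruct (Req_dec x 1); [subst; lra|]. left; apply ln_increasing; lra. Qed.

Lemma ln_mono x y : 0 < x -> x <= y -> ln x <= ln y.
Proof. intros H [Hl|He]; [left; apply ln_increasing; auto|subst; lra]. Qed.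

Section Phase.
Variables (lam : nat -> nat -> R) (m n : nat) (phat p : nat -> R) (y : st).
Hypothesis lam_ge0 : forall i j, 0 <= lam i j.
Hypothesis lam_pos : forall j, (j < n)%nat -> exists i, (i < m)%nat /\ 0 < lam i j.
Hypothesis p_ge1 : forall j, (j < n)%nat -> 1 <= p j.
Hypothesis y_inv : inv lam m n p y.

Local Notation X r := (iterate r (round lam m n phat p) y).
Local Notation wk r j := (work lam (sc (X r)) j (tm (X r))).
Local Notation rt r j := (rate lam (al (X r)) (sg (X r)) j).
Local Notation th j := (theta phat (ph y) j).

Lemma phase_inv r : inv lam m n p (X r).
Proof. induction r; simpl; auto. apply round_inv; auto. Qed.

Lemma phase_loc r : loc (X r) = loc y * beta ^ r.
Proof. induction r; [simpl; ring|]. change (loc (X (S r))) with (beta * loc (X r)). rewrite IHr; simpl; ring. Qed.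

Lemma phase_ph r : ph (X r) = ph y.
Proof. induction r; auto. Qed.

Lemma phase_loc_pos r : 0 < loc (X r).
Proof. apply (phase_inv r). Qed.

Lemma phase_loc_S r : loc (X (S r)) = beta * loc (X r).
Proof. reflexivity. Qed.

Lemma phase_loc_le r r' : (r <= r')%nat -> loc (X r) <= loc (X r').
Proof.
  induction 1; [lra|]. rewrite phase_loc_S. pose proof (phase_loc_pos m0). unfold beta in *. lra.
Qed.

Lemma phase_al_S r : incl (al (X (S r))) (al (X r)).
Proof. intros j Hj. change (X (S r)) with (round lam m n phat p (X r)) in Hj. apply al_round in Hj. tauto. Qed.

Lemma phase_al_le r r' : (r <= r')%nat -> incl (al (X r')) (al (X r)).
Proof. induction 1; [apply incl_refl|]. intros j Hj. apply IHle, phase_al_S; auto. Qed.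

Lemma theta_ge1 j : 1 <= th j.
Proof. unfold theta. destruct (ph y); [apply Rmax_l|lra]. Qed.

Lemma phase_rate_S r j : In j (al (X (S r))) -> rt r j <= rt (S r) j.
Proof. apply (round_nash lam m n phat lam_ge0 lam_pos p (X r) (phase_inv r)). Qed.

Lemma phase_rate_le r r' j : (r <= r')%nat -> In j (al (X r')) -> rt r j <= rt r' j.
Proof.
  induction 1; intros Hj; [lra|]. eapply Rle_trans; [|apply phase_rate_S; auto].
  apply IHle, phase_al_S; auto.
Qed.

Lemma phase_rate_pos r j : In j (al (X r)) -> 0 < rt r j.
Proof. intros Hj. eapply rate_pos; eauto. apply phase_inv. Qed.

Lemma phase_work_S r j : In j (al (X r)) ->
  wk (S r) j = wk r j + (if exec lam phat (X r) j then rt r j * ((beta - 1) * loc (X r)) else 0).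
Proof. apply (round_work lam m n phat p (X r)); auto. apply phase_inv. Qed.

Lemma phase_work_le_p r j : In j (al (X r)) -> wk r j <= p j.
Proof. intros Hj. destruct (phase_inv r) as (_ & (_ & H) & _). apply H in Hj. tauto. Qed.

Lemma exec_true r j : exec lam phat (X r) j = true <-> delta * th j <= rt r j * loc (X r).
Proof. unfold exec. rewrite Rleb_true, phase_ph. tauto. Qed.

(* A skipped slot is small, and by monotonicity of the rates so is everything skipped before it. *)
Lemma phase_progress a r j : (a <= r)%nat -> In j (al (X r)) ->
  rt a j * (loc (X r) - loc (X a)) <= wk r j - wk a j + beta * delta * th j.
Proof.
  intros Har. induction Har as [|r Har IH]; intros Hj.
  - pose proof (theta_ge1 j). unfold beta, delta. nra.
  - pose proof (phase_al_S r j Hj) as Hj'. specialize (IH Hj').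
    pose proof (phase_work_S r j Hj') as Hw. pose proof (phase_rate_le a r j Har Hj') as Hr.
    pose proof (phase_loc_pos r) as Hl. pose proof (phase_loc_le a r Har).
    pose proof (phase_loc_pos a) as Hla.
    assert (Hra : 0 < rt a j) by (apply phase_rate_pos; eapply phase_al_le; eauto).
    rewrite phase_loc_S.
    destruct (exec lam phat (X r) j) eqn:E.
    + assert (rt a j * ((beta - 1) * loc (X r)) <= rt r j * ((beta - 1) * loc (X r))).
      { apply Rmult_le_compat_r; auto. unfold beta; nra. }
      rewrite Hw. nra.
    + assert (rt r j * loc (X r) < delta * th j).
      { destruct (Rlt_or_le (rt r j * loc (X r)) (delta * th j)) as [|Hc]; auto.
        apply exec_true in Hc. congruence. }
      assert (Hmono : wk a j <= wk r j).
      { clear - Har Hj' lam_ge0 y_inv lam_pos p_ge1. induction Har; [lra|].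
        pose proof (phase_al_S _ _ Hj') as Hj2. specialize (IHHar Hj2).
        pose proof (phase_work_S _ _ Hj2) as Q. pose proof (phase_rate_pos _ _ Hj2).
        pose proof (phase_loc_pos m0). rewrite Q.
        destruct (exec lam phat (X m0) j); [|lra].
        assert (0 <= rt m0 j * ((beta - 1) * loc (X m0))); [|lra].
        apply Rmult_le_pos; [lra|]. unfold beta; nra. }
      rewrite Hw. assert (rt a j * loc (X r) <= rt r j * loc (X r)) by (apply Rmult_le_compat_r; lra).
      assert (0 < rt a j * loc (X a)) by (apply Rmult_lt_0_compat; auto).
      unfold beta in *. nra.
Qed.

(** Local time grows geometrically, whereas by [phase_progress] a job alive bounds it in terms of
    [p j], [theta] and its initial rate. *)
Lemma phase_dies j : In j (al y) -> exists R0, forall r, (R0 <= r)%nat -> ~ In j (al (X r)).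
Proof.
  intros Hj. assert (Hr0 : 0 < rt 0%nat j) by (apply phase_rate_pos; auto).
  assert (Hl : 0 < loc y) by apply (phase_loc_pos 0).
  destruct (INR_unbounded ((p j + beta * delta * th j) / (rt 0%nat j * loc y * (beta - 1)))) as [R0 HR0].
  exists R0. intros r Hr Hin.
  pose proof (phase_progress 0 r j ltac:(lia) Hin) as Q.
  pose proof (phase_work_le_p r j Hin).
  assert (0 <= wk 0%nat j) by (apply work_nonneg; auto).
  rewrite phase_loc in Q. change (loc (X 0%nat)) with (loc y) in Q.
  assert (B : 1 + INR r * (beta - 1) <= beta ^ r).
  { replace beta with (1 + (beta - 1)) at 2 by ring. apply poly. unfold beta; lra. }
  assert (INR R0 <= INR r) by (apply le_INR; auto).
  assert (Hd : 0 < rt 0%nat j * loc y * (beta - 1)).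
  { apply Rmult_lt_0_compat; [apply Rmult_lt_0_compat; auto|unfold beta; lra]. }
  apply (Rmult_lt_compat_r _ _ _ Hd) in HR0.
  replace ((p j + beta * delta * th j) / (rt 0%nat j * loc y * (beta - 1)) * (rt 0%nat j * loc y * (beta - 1)))
    with (p j + beta * delta * th j) in HR0 by (field; repeat split; unfold beta; lra).
  assert (INR R0 * (rt 0%nat j * loc y * (beta - 1)) <= INR r * (rt 0%nat j * loc y * (beta - 1)))
    by (apply Rmult_le_compat_r; lra).
  assert (rt 0%nat j * (loc y * (INR r * (beta - 1))) <= rt 0%nat j * (loc y * beta ^ r - loc y)).
  { apply Rmult_le_compat_l; [lra|]. nra. }
  nra.
Qed.

Lemma phase_terminates : exists r, al (X r) = [].
Proof.
  assert (forall L, incl L (al y) -> exists R0, forall j, In j L -> forall r, (R0 <= r)%nat -> ~ In j (al (X r))) as H.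
  { induction L as [|j L IH]; intros HL.
    - exists O. intros j [].
    - destruct IH as [R1 H1]; [intros x Hx; apply HL; right; auto|].
      destruct (phase_dies j (HL j (or_introl eq_refl))) as [R2 H2].
      exists (Nat.max R1 R2). intros x [<-|Hx] r Hr; [apply H2; lia|apply H1; auto; lia]. }
  destruct (H (al y) (incl_refl _)) as [r Hr]. exists r.
  destruct (al (X r)) as [|j A] eqn:E; auto. exfalso.
  assert (Hj : In j (al (X r))) by (rewrite E; left; auto).
  apply (Hr j (phase_al_le 0 r ltac:(lia) j Hj) r); auto.
Qed.

(** * Number of slots used by a job *)

Definition runs (r : nat) (j : nat) : nat :=
  length (filter (fun k => mem j (al (X k)) && exec lam phat (X k) j) (seq 0 r)).

Lemma runs_S r j : runs (S r) j =
  (runs r j + if mem j (al (X r)) && exec lam phat (X r) j then 1 else 0)%nat.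
Proof.
  unfold runs. rewrite seq_S, filter_app, length_app. f_equal. cbn [filter plus].
  destruct (mem j (al (X r)) && exec lam phat (X r) j); auto.
Qed.

Lemma phase_length r : INR (length (sc (X r))) =
  INR (length (sc y)) + lsum (al y) (fun j => INR (runs r j)).
Proof.
  induction r.
  - unfold runs. simpl. rewrite lsum_const. lra.
  - change (sc (X (S r))) with (sc (X r) ++ emit lam phat (X r)).
    rewrite length_app, plus_INR, IHr. unfold emit. rewrite length_map, lsum_filter_length.
    rewrite (lsum_sublist (al (X r)) (al y)); [|apply (phase_inv r)|apply y_inv|apply (phase_al_le 0 r); lia].
    rewrite Rplus_assoc, <- lsum_plus. f_equal. apply lsum_ext. intros j Hj.
    rewrite runs_S, plus_INR. destruct (mem j (al (X r))); simpl; [|lra].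
    destruct (exec lam phat (X r) j); simpl; lra.
Qed.

(** The first executed slot has [rate * loc] at least [delta * theta], and this product grows by a
    factor of at least [beta] per round since rates never drop. The second bound uses only the work
    of the last executed slot, hence the extra factor [beta]. *)
Lemma runs_growth r j : In j (al (X r)) -> (1 <= runs r j)%nat ->
  delta * th j * beta ^ runs r j <= rt r j * loc (X r) /\
  (beta - 1) * delta * th j * beta ^ runs r j <= beta * wk r j.
Proof.
  induction r; intros Hj Hk; [unfold runs in Hk; simpl in Hk; lia|].
  pose proof (phase_al_S r j Hj) as Hj'. specialize (IHr Hj').
  pose proof (phase_work_S r j Hj') as Hw. pose proof (phase_rate_S r j Hj) as Hr.
  pose proof (phase_loc_pos r) as Hl. pose proof (phase_rate_pos r j Hj') as Hrp.
  assert (Hw0 : 0 <= wk r j) by (apply work_nonneg; auto).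
  rewrite runs_S in *. rewrite (proj2 (mem_true j (al (X r))) Hj') in *. cbn [andb] in *.
  rewrite phase_loc_S.
  assert (G : rt r j * loc (X r) * beta <= rt (S r) j * (beta * loc (X r))).
  { replace (rt r j * loc (X r) * beta) with (rt r j * (beta * loc (X r))) by ring.
    apply Rmult_le_compat_r; auto. unfold beta; lra. }
  assert (P0 : 0 < rt r j * loc (X r)) by (apply Rmult_lt_0_compat; auto).
  destruct (exec lam phat (X r) j) eqn:E.
  - apply exec_true in E. rewrite Hw.
    assert (K : delta * th j * beta ^ runs r j <= rt r j * loc (X r)).
    { destruct (Nat.eq_dec (runs r j) 0) as [->|]; [simpl; lra|apply IHr; lia]. }
    rewrite pow_add, pow_1. split.
    + apply Rle_trans with (rt r j * loc (X r) * beta); auto. unfold beta in *. nra.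
    + unfold beta in *. nra.
  - rewrite Nat.add_0_r in *. destruct (IHr Hk) as [K1 K2]. split.
    + apply Rle_trans with (rt r j * loc (X r)); auto. unfold beta in *. nra.
    + rewrite Hw, Rplus_0_r. auto.
Qed.

Lemma runs_le r j : (j < n)%nat -> INR (runs r j) <= cst0 + cst1 * ln (p j / th j + 1).
Proof.
  intros Hjn. pose proof (theta_ge1 j) as Hth. pose proof (p_ge1 j Hjn) as Hp.
  assert (Hq : 0 < p j / th j) by (apply Rdiv_lt_0_compat; lra).
  assert (Hln : 0 <= ln (p j / th j + 1)) by (apply ln_ge0; lra).
  pose proof cst1_pos as Hc1. pose proof ln_beta_pos as Hb.
  induction r.
  - unfold runs. simpl. pose proof cst0_pos. nra.
  - rewrite runs_S, plus_INR. destruct (mem j (al (X r)) && exec lam phat (X r) j) eqn:E; [|simpl; lra].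
    apply andb_prop in E. destruct E as [E _]. apply mem_true in E.
    (* Growth is used just before round [r], when [j] is still alive and has at most [p j] units;
       the summand 1 of [cst0] counts the run of round [r] itself. *)
    enough (INR (runs r j) <= cst1 * (ln 2601 + ln (p j / th j + 1))) by (unfold cst0; simpl; lra).
    destruct (Nat.eq_dec (runs r j) 0) as [->|Hk].
    { simpl. assert (0 < ln 2601) by (rewrite <- ln_1; apply ln_increasing; lra). nra. }
    destruct (runs_growth r j E ltac:(lia)) as [_ G]. pose proof (phase_work_le_p r j E) as Hw.
    assert (B : beta ^ runs r j <= 2601 * (p j / th j + 1)).
    { apply (Rmult_le_reg_r (th j)); [lra|].
      replace (2601 * (p j / th j + 1) * th j) with (2601 * (p j + th j)) by (field; lra).
      unfold beta, delta in *. nra. }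
    apply ln_mono in B; [|apply pow_lt; unfold beta; lra].
    rewrite ln_mult in B by lra. rewrite ln_pow in B by (unfold beta; lra).
    unfold cst1. apply (Rmult_le_reg_r (ln beta)); auto.
    replace (/ ln beta * (ln 2601 + ln (p j / th j + 1)) * ln beta) with (ln 2601 + ln (p j / th j + 1))
      by (field; lra). auto.
Qed.

(** * Cost of a phase by dual fitting *)

Definition span (r : nat) : R :=
  lsum (seq 0 r) (fun k => INR (length (al (X k))) * ((beta - 1) * loc (X k))).

Definition life (r j : nat) : R :=
  lsum (seq 0 r) (fun k => if mem j (al (X k)) then (beta - 1) * loc (X k) else 0).

Lemma life_alive r j : In j (al y) -> (forall k, (k < r)%nat -> In j (al (X k))) ->
  life r j = loc (X r) - loc y.
Proof.
  intros Hj. induction r; intros H.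
  - unfold life, lsum; simpl. lra.
  - unfold life in *. rewrite lsum_seq_S, IHr by (intros; apply H; lia).
    rewrite (proj2 (mem_true j (al (X r)))) by (apply H; lia). rewrite phase_loc_S. ring.
Qed.

Lemma life_spec r j : In j (al y) -> exists k, (k <= r)%nat /\ In j (al (X k)) /\
  life (S r) j = loc (X (S k)) - loc y.
Proof.
  intros Hj. induction r.
  - exists O. split; auto. split; auto. apply life_alive; auto.
    intros k Hk. replace k with O by lia. auto.
  - destruct (in_dec Nat.eq_dec j (al (X (S r)))) as [Hi|Hi].
    + exists (S r). split; auto. split; auto. apply life_alive; auto.
      intros k Hk. apply (phase_al_le k (S r)); auto. lia.
    + destruct IHr as [k (H1 & H2 & H3)]. exists k. split; [lia|split; auto].
      rewrite <- H3. unfold life. rewrite (lsum_seq_S (S r)).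
      destruct (mem j (al (X (S r)))) eqn:E; [apply mem_true in E; tauto|]. lra.
Qed.

Definition honest (j : nat) : bool := Rleb (th j) (p j).

Lemma span_life r :
  lsum (seq 0 r) (fun k => INR (length (filter honest (al (X k)))) * ((beta - 1) * loc (X k))) =
  lsum (filter honest (al y)) (life r).
Proof.
  unfold life. rewrite lsum_swap. apply lsum_ext. intros k _.
  rewrite lsum_filter_length. rewrite Rmult_comm, <- lsum_scal.
  rewrite (lsum_sublist (al (X k)) (al y)); [|apply (phase_inv k)|apply y_inv|apply (phase_al_le 0 k); lia].
  rewrite lsum_filter. apply lsum_ext. intros j _.
  destruct (mem j (al (X k))), (honest j); unfold bool2R; lra.
Qed.

Lemma span_honest r gl : (length (filter (fun j => negb (honest j)) (al y)) <= gl)%nat ->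
  (forall k, (k < r)%nat -> (51 * gl < length (al (X k)))%nat) ->
  50 * span r <= 51 * lsum (filter honest (al y)) (life r).
Proof.
  intros Hg Hr. rewrite <- span_life. unfold span. rewrite <- !lsum_scal. apply lsum_le.
  intros k Hk. apply in_seq in Hk. specialize (Hr k ltac:(lia)).
  rewrite <- (Rmult_assoc 50), <- (Rmult_assoc 51). apply Rmult_le_compat_r.
  { pose proof (phase_loc_pos k). unfold beta; lra. }
  assert (H1 : (length (filter honest (al (X k))) + length (filter (fun j => negb (honest j)) (al (X k))) =
    length (al (X k)))%nat) by apply filter_length.
  assert (H2 : (length (filter (fun j => negb (honest j)) (al (X k))) <=
     length (filter (fun j => negb (honest j)) (al y)))%nat).
  { apply NoDup_incl_length; [apply NoDup_filter, (phase_inv k)|].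
    intros j Hj. apply filter_In in Hj. apply filter_In. split; [|tauto]. apply (phase_al_le 0 k); [lia|tauto]. }
  (* More than [51 * gl] jobs are alive and at most [gl] of them are not honest. *)
  assert (H3 : (50 * length (al (X k)) <= 51 * length (filter honest (al (X k))))%nat) by lia.
  apply le_INR in H3. rewrite !mult_INR in H3.
  replace (INR 50) with 50 in H3 by (simpl; lra). replace (INR 51) with 51 in H3 by (simpl; lra). exact H3.
Qed.

Definition kappa : R := 2 / 5.
(* [kappa * (1 + beta * delta)], the loss due to skipped slots included. *)
Definition kappa' : R := 51 / 125.

(** If [R] is the last counted round at whose start [j] is alive, the value equals
    [kappa * (loc (X R) - loc y)]. It refers to the start of that round because there the work of
    [j] is still at most [p j]; dividing by [beta] is the price. *)
Definition phase_alpha (r j : nat) : R :=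
  if mem j (al y) && honest j then kappa * (life r j - (beta - 1) * loc y) / beta else 0.

(** The occupancies of the algorithm on a time axis compressed by [kappa]: every job alive in round
    [k] puts height [kappa'] on its machine. *)
Definition phase_blocks (r : nat) : list block :=
  flat_map (fun k => map (fun l => mkBlock (asg (sg (X k)) l) kappa'
      (kappa * (loc (X k) - loc y)) (kappa * (loc (X (S k)) - loc y))) (al (X k))) (seq 0 r).

Lemma phase_overlap r a b : 0 <= a -> a <= b -> b <= kappa * (loc (X r) - loc y) ->
  lsum (seq 0 r) (fun k => overlap a b (kappa * (loc (X k) - loc y)) (kappa * (loc (X (S k)) - loc y))) = b - a.
Proof.
  intros Ha Hab Hb.
  rewrite <- (overlap_inside a b 0 (kappa * (loc (X r) - loc y))) by auto. clear Hb.
  induction r.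
  - unfold lsum; simpl. rewrite Rminus_diag, Rmult_0_r. unfold overlap, Rmax, Rmin.
    repeat destruct (Rle_dec _ _); lra.
  - rewrite lsum_seq_S, IHr. symmetry. apply overlap_additive; auto.
    + pose proof (phase_loc_le 0 r ltac:(lia)) as H. change (loc (X 0%nat)) with (loc y) in H. unfold kappa. lra.
    + pose proof (phase_loc_le r (S r) ltac:(lia)). unfold kappa. lra.
Qed.

Lemma phase_nash r i j : In j (al (X r)) -> (i < m)%nat ->
  lam i j <= rt r j * (INR (cnt (al (X r)) (sg (X r)) i) + 1).
Proof.
  intros Hj Hi. destruct (phase_inv r) as (_ & _ & (_ & HN) & _).
  destruct (HN j Hj) as [_ H]. specialize (H i Hi).
  pose proof (INR_cnt_pos (al (X r)) (sg (X r)) j Hj).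
  apply (Rmult_le_reg_r (INR (cnt (al (X r)) (sg (X r)) (asg (sg (X r)) j)))); [lra|].
  eapply Rle_trans; [exact H|]. right. unfold rate. field. lra.
Qed.

Lemma phase_dual S' C' r : feasible m n lam p S' C' ->
  lsum (filter honest (al y)) (phase_alpha (S r)) <= (1 + kappa') * sumR n C' + kappa * kappa' * span (S r).
Proof.
  intros HF.
  assert (Hlmono : forall k, loc (X k) <= loc (X (S k))) by (intros; apply phase_loc_le; lia).
  pose proof (opt_dual m n lam p S' C' (phase_alpha (S r)) (phase_blocks (S r)) kappa'
    lam_ge0 p_ge1 HF ltac:(unfold kappa'; lra)) as D.
  replace (lsum (filter honest (al y)) (phase_alpha (S r))) with (sumR n (phase_alpha (S r))).
  replace (kappa * kappa' * span (S r)) with (lsum (phase_blocks (S r)) (fun x => bw x * (bv x - bu x))).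
  - apply D.
    + intros x Hx. apply in_flat_map in Hx. destruct Hx as [k [_ Hx]]. apply in_map_iff in Hx.
      destruct Hx as [l [<- _]]. simpl. split; [unfold kappa'; lra|]. specialize (Hlmono k). simpl in Hlmono. unfold kappa; lra.
    + intros i j a b Hi Hj Hlt Ha Hab Hb. unfold phase_alpha in *.
      assert (HC0 : 0 <= C' j) by lra.
      destruct (mem j (al y) && honest j) eqn:E; [|lra]. apply andb_prop in E. destruct E as [E1 E2].
      apply mem_true in E1. apply Rleb_true in E2.
      destruct (life_spec r j E1) as [R (HR & HjR & HL)]. rewrite HL in *.
      replace (kappa * (loc (X (S R)) - loc y - (beta - 1) * loc y) / beta) with (kappa * (loc (X R) - loc y)) in *
        by (rewrite phase_loc_S; field; unfold beta; lra).
      set (ov := fun k => overlap a b (kappa * (loc (X k) - loc y)) (kappa * (loc (X (S k)) - loc y))).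
      assert (Hov0 : forall k, 0 <= ov k) by (intros; apply overlap_nonneg).
      set (nn := fun k => INR (cnt (al (X k)) (sg (X k)) i)).
      assert (Hb' : lsum (phase_blocks (S r)) (fun x => if Nat.eqb (bm x) i then bw x * overlap a b (bu x) (bv x) else 0) =
        lsum (seq 0 (S r)) (fun k => kappa' * nn k * ov k)).
      { unfold phase_blocks. rewrite lsum_flat_map. apply lsum_ext. intros k _. rewrite lsum_map. cbn [bm bw bu bv].
        fold (ov k). unfold nn. rewrite cnt_lsum.
        replace (kappa' * lsum (al (X k)) (fun l => bool2R (Nat.eqb (asg (sg (X k)) l) i)) * ov k)
          with (kappa' * ov k * lsum (al (X k)) (fun l => bool2R (Nat.eqb (asg (sg (X k)) l) i))) by ring.
        rewrite <- lsum_scal. apply lsum_ext. intros l _. unfold bool2R. destruct (Nat.eqb _ i); lra. }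
      rewrite Hb'. clear Hb'.
      assert (HovR : lsum (seq 0 R) ov = b - a) by (apply phase_overlap; lra).
      assert (Hpj : 1 <= p j) by (apply p_ge1; auto).
      apply Rle_trans with (p j * (lsum (seq 0 R) (fun k => kappa' * nn k * ov k) + kappa' * (b - a))).
      * rewrite <- HovR, <- !lsum_scal, <- lsum_plus, <- lsum_scal. apply lsum_le.
        intros k Hk. apply in_seq in Hk.
        (* A compressed window starting at or after [b] is not met. Otherwise it starts before
           [b <= C' j], so [phase_alpha - C' j] is at most [kappa * (loc (X R) - loc (X k))], to
           which progress from round [k] to [R] applies. *)
        destruct (Rle_or_lt b (kappa * (loc (X k) - loc y))) as [Hz|Hz].
        { replace (ov k) with 0 by (symmetry; apply overlap_zero; auto). lra. }
        enough ((kappa * (loc (X R) - loc y) - C' j) * lam i j <= p j * (kappa' * (nn k + 1))).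
        { specialize (Hov0 k). nra. }
        assert (Hjk : In j (al (X k))) by (apply (phase_al_le k R); auto; lia).
        pose proof (phase_progress k R j ltac:(lia) HjR) as Hpr.
        pose proof (phase_work_le_p R j HjR). assert (0 <= wk k j) by (apply work_nonneg; auto).
        pose proof (phase_nash k i j Hjk Hi) as Hna. fold (nn k) in Hna.
        (* Honesty enters here: the skipped amount is at most [theta_j / 50 <= p j / 50]. *)
        assert (Hpr' : rt k j * (loc (X R) - loc (X k)) <= 51 / 50 * p j) by (unfold beta, delta in Hpr; lra).
        pose proof (phase_loc_le k R ltac:(lia)).
        assert (0 <= nn k) by apply pos_INR.
        apply Rle_trans with (kappa * (loc (X R) - loc (X k)) * lam i j).
        { apply Rmult_le_compat_r; auto. lra. }
        apply Rle_trans with (kappa * (loc (X R) - loc (X k)) * (rt k j * (nn k + 1))).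
        { apply Rmult_le_compat_l; auto. unfold kappa; nra. }
        replace (kappa * (loc (X R) - loc (X k)) * (rt k j * (nn k + 1))) with
          (kappa * (nn k + 1) * (rt k j * (loc (X R) - loc (X k)))) by ring.
        apply Rle_trans with (kappa * (nn k + 1) * (51 / 50 * p j)).
        { apply Rmult_le_compat_l; auto. unfold kappa; nra. }
        unfold kappa, kappa'. right. field.
      * apply Rmult_le_compat_l; [lra|]. apply Rplus_le_compat_r.
        replace (S r) with (R + (S r - R))%nat by lia. rewrite seq_app, lsum_app.
        assert (0 <= lsum (seq (0 + R) (S r - R)) (fun k => kappa' * nn k * ov k)); [|lra].
        apply lsum_nonneg. intros k _. specialize (Hov0 k). assert (0 <= nn k) by apply pos_INR.
        unfold kappa'. apply Rmult_le_pos; auto. nra.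
  - unfold phase_blocks, span. rewrite lsum_flat_map, <- lsum_scal. apply lsum_ext. intros k _.
    rewrite lsum_map. cbn [bm bw bu bv]. rewrite lsum_const, phase_loc_S. ring.
  - rewrite sumR_lsum.
    rewrite (lsum_sublist (filter honest (al y)) (seq 0 n)).
    + apply lsum_ext. intros j _. destruct (mem j (filter honest (al y))) eqn:E; auto.
      unfold phase_alpha. destruct (mem j (al y) && honest j) eqn:E2; auto. exfalso.
      apply andb_prop in E2. destruct E2 as [E2 E3]. apply mem_true in E2.
      assert (mem j (filter honest (al y)) = true) by (apply mem_true, filter_In; auto). congruence.
    + apply NoDup_filter, y_inv.
    + apply seq_NoDup.
    + intros j Hj. apply filter_In in Hj. eapply inv_incl; [exact y_inv|tauto].
Qed.

Lemma phase_cost S' C' r gl : feasible m n lam p S' C' ->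
  (length (filter (fun j => negb (honest j)) (al y)) <= gl)%nat ->
  (forall k, (k < r)%nat -> (51 * gl < length (al (X k)))%nat) ->
  span r <= 32 / 5 * sumR n C' + INR n * loc y / 10.
Proof.
  intros HF Hg Hr.
  assert (Hl : 0 < loc y) by apply (phase_loc_pos 0).
  assert (HC0 : 0 <= sumR n C').
  { rewrite sumR_lsum. apply lsum_nonneg. intros j Hj. apply in_seq in Hj. destruct HF as [_ HC].
    destruct (HC j ltac:(lia)) as [H1 _]. destruct (Rle_or_lt 0 (C' j)); auto.
    rewrite work_le0 in H1 by lra. pose proof (p_ge1 j ltac:(lia)). lra. }
  pose proof (pos_INR n) as Hn.
  destruct r as [|r]; [unfold span, lsum; simpl; nra|].
  pose proof (span_honest (S r) gl Hg Hr) as H1.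
  pose proof (phase_dual S' C' r HF) as H2.
  assert (H3 : lsum (filter honest (al y)) (life (S r)) =
    beta / kappa * lsum (filter honest (al y)) (phase_alpha (S r)) +
    INR (length (filter honest (al y))) * ((beta - 1) * loc y)).
  { rewrite <- lsum_const, <- lsum_scal, <- lsum_plus. apply lsum_ext. intros j Hj. unfold phase_alpha.
    apply filter_In in Hj. destruct Hj as [Hj1 Hj2]. rewrite Hj2, (proj2 (mem_true j (al y)) Hj1). cbn [andb].
    unfold beta, kappa. field. }
  assert (H4 : INR (length (filter honest (al y))) <= INR n).
  { apply le_INR. rewrite <- (length_seq n 0). apply NoDup_incl_length; [apply NoDup_filter, y_inv|].
    intros j Hj. apply filter_In in Hj. eapply inv_incl; [exact y_inv|tauto]. }
  assert (H5 : INR (length (filter honest (al y))) * ((beta - 1) * loc y) <= INR n * ((beta - 1) * loc y)).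
  { apply Rmult_le_compat_r; auto. unfold beta; lra. }
  (* Eliminating the dual values leaves [span] with coefficient [50/51 - beta * kappa'] against
     [beta / kappa * (1 + kappa')] times the optimum; the quotient is below 6.37. *)
  rewrite H3 in H1. unfold beta, kappa, kappa' in *.
  assert (0 <= INR n * loc y) by nra.
  lra.
Qed.

End Phase.

(** * The nonpreemptive first stage *)


(** Isolates row and column [j] of a symmetric matrix, so that two assignments differing only at [j]
    can be compared. *)
Lemma lsum_double (L : list nat) (h : nat -> nat -> R) j : NoDup L -> In j L ->
  (forall x y, h x y = h y x) ->
  lsum L (fun x => lsum L (fun y => h x y)) =
  lsum L (fun x => lsum L (fun y => if Nat.eqb x j || Nat.eqb y j then 0 else h x y)) +
  2 * lsum L (fun y => h j y) - h j j.
Proof.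
  intros HL Hj Hs.
  rewrite (lsum_ext L _ (fun x => lsum L (fun y => if Nat.eqb x j || Nat.eqb y j then 0 else h x y) +
     ((if Nat.eqb x j then lsum L (fun y => h j y) - h j j else 0) + h j x))).
  - rewrite lsum_plus, lsum_plus, (lsum_pick L j (fun _ => lsum L (fun y => h j y) - h j j)); auto.
    change (lsum L (fun y => h j y)) with (lsum L (h j)). ring.
  - intros x Hx. destruct (Nat.eqb_spec x j) as [->|Hne].
    + cbn [orb]. rewrite lsum_const. ring.
    + cbn [orb]. rewrite (lsum_ext L (fun y => h x y) (fun y => (if Nat.eqb y j then 0 else h x y) + (if Nat.eqb y j then h j x else 0))).
      * rewrite lsum_plus, (lsum_pick L j (fun _ => h j x)); auto. ring.
      * intros y Hy. destruct (Nat.eqb_spec y j) as [->|]; [rewrite Hs|]; ring.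
Qed.

(** Exceeding 1 makes [ln quantum] positive, so one job of at least this size lets [ln p_max] pay
    for interruptions. The excess worsens the ratio of the first stage. *)
Definition quantum : R := 11 / 10.

Section Stage.
Variables (lam : nat -> nat -> R) (m n : nat).
Hypothesis lam_ge0 : forall i j, 0 <= lam i j.
Hypothesis lam_pos : forall j, (j < n)%nat -> exists i, (i < m)%nat /\ 0 < lam i j.

Definition dur (s : list nat) (j : nat) : R := quantum / lam_at lam s j.

Definition shared (s : list nat) (j l : nat) : R :=
  if Nat.eqb (asg s j) (asg s l) then Rmin (dur s j) (dur s l) else 0.

(** Twice the total completion time when every machine runs its jobs shortest first. Two jobs on one
    machine cost the shorter duration, counted at both [(j, l)] and [(l, j)]; the last sum doubles
    the diagonal. *)
Definition spt_cost2 (s : list nat) : R :=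
  lsum (seq 0 n) (fun j => lsum (seq 0 n) (fun l => shared s j l)) + lsum (seq 0 n) (dur s).

Definition feasible_code (s : list nat) : Prop :=
  In s (codes m n) /\ forall j, (j < n)%nat -> 0 < lam_at lam s j.

Definition spt : list nat := epsilon (inhabits [])
  (fun s => feasible_code s /\ forall s', feasible_code s' -> spt_cost2 s <= spt_cost2 s').

Lemma spt_spec : feasible_code spt /\ forall s', feasible_code s' -> spt_cost2 spt <= spt_cost2 s'.
Proof.
  unfold spt. apply epsilon_spec.
  destruct (list_argmax (codes m n) (fun s => forall j, (j < n)%nat -> 0 < lam_at lam s j) (fun s => - spt_cost2 s))
    as [s (H1 & H2 & H3)].
  - destruct (positive_codes lam m n lam_pos) as [s Hs]; exists s; auto.
  - exists s. split; [split; auto|]. intros s' [H4 H5]. specialize (H3 s' H4 H5). lra.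
Qed.

Lemma shared_sym s j l : shared s j l = shared s l j.
Proof. unfold shared. rewrite Nat.eqb_sym. destruct (Nat.eqb (asg s l) (asg s j)); auto. apply Rmin_comm. Qed.

Local Notation d j := (dur spt j).

Lemma dur_pos j : (j < n)%nat -> 0 < d j.
Proof. intros Hj. apply Rdiv_lt_0_compat; [unfold quantum; lra|]. apply spt_spec; auto. Qed.

(** Shortest first with ties broken by index. The relation is reflexive, so that [fin j] includes
    the duration of [j] itself. *)
Definition prec (l j : nat) : bool :=
  Nat.eqb (asg spt l) (asg spt j) && (Rltb (d l) (d j) || (Rleb (d l) (d j) && Nat.leb l j)).

Definition fin (j : nat) : R := lsum (seq 0 n) (fun l => if prec l j then d l else 0).
Definition start (j : nat) : R := fin j - d j.

Lemma precP l j : prec l j = true <->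
  asg spt l = asg spt j /\ (d l < d j \/ (d l = d j /\ (l <= j)%nat)).
Proof.
  unfold prec. rewrite andb_true_iff, orb_true_iff, andb_true_iff, Nat.eqb_eq, Rltb_true, Rleb_true, Nat.leb_le.
  split; intros [H1 H2]; split; auto.
  - destruct H2 as [|[H2 H3]]; auto. destruct H2; auto.
  - destruct H2 as [|[H2 H3]]; auto. right; split; auto; lra.
Qed.

Lemma prec_total l j : asg spt l = asg spt j -> prec l j = true \/ prec j l = true.
Proof.
  intros H. rewrite !precP. destruct (Rtotal_order (d l) (d j)) as [|[|]]; [left; auto| |right; auto].
  destruct (Nat.le_ge_cases l j); [left|right]; split; auto.
Qed.

Lemma start_nonneg j : (j < n)%nat -> 0 <= start j.
Proof.
  intros Hj. unfold start, fin.
  rewrite <- (lsum_pick (seq 0 n) j (fun l => d l)); [|apply seq_NoDup|apply in_seq; lia].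
  enough (lsum (seq 0 n) (fun x => if Nat.eqb x j then d x else 0) <= lsum (seq 0 n) (fun l => if prec l j then d l else 0)) by lra.
  apply lsum_le. intros x Hx. apply in_seq in Hx. destruct (Nat.eqb_spec x j) as [->|].
  - assert (prec j j = true) as -> by (apply precP; auto). lra.
  - pose proof (dur_pos x ltac:(lia)). destruct (prec x j); lra.
Qed.

Lemma fin_le_start l j : (l < n)%nat -> (j < n)%nat -> l <> j -> prec l j = true -> fin l <= start j.
Proof.
  intros Hl Hj Hne Hp. unfold start, fin.
  rewrite <- (lsum_pick (seq 0 n) j (fun l => d l)); [|apply seq_NoDup|apply in_seq; lia].
  enough (lsum (seq 0 n) (fun x => (if prec x l then d x else 0) + (if Nat.eqb x j then d x else 0)) <=
     lsum (seq 0 n) (fun x => if prec x j then d x else 0)) by (rewrite lsum_plus in H; lra).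
  apply lsum_le. intros x Hx. apply in_seq in Hx. pose proof (dur_pos x ltac:(lia)) as Hd.
  apply precP in Hp. destruct Hp as [Hp1 Hp2].
  destruct (Nat.eqb_spec x j) as [->|Hxj].
  - assert (prec j j = true) as -> by (apply precP; auto).
    destruct (prec j l) eqn:E; [|lra]. apply precP in E. destruct E as [_ [E|[E1 E2]]]; exfalso.
    + destruct Hp2 as [|[]]; lra.
    + destruct Hp2 as [|[? ?]]; [lra|lia].
  - destruct (prec x l) eqn:E; [|destruct (prec x j); lra].
    assert (prec x j = true) as ->; [|lra]. apply precP. apply precP in E. destruct E as [E1 E2].
    split; [congruence|]. destruct Hp2 as [|[? ?]], E2 as [|[? ?]]; try (left; lra). right; split; [lra|lia].
Qed.

Lemma slots_disjoint l j : (l < n)%nat -> (j < n)%nat -> l <> j -> asg spt l = asg spt j ->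
  fin l <= start j \/ fin j <= start l.
Proof.
  intros Hl Hj Hne H. destruct (prec_total l j H); [left|right]; apply fin_le_start; auto.
Qed.

Lemma fin_sum : 2 * lsum (seq 0 n) fin = spt_cost2 spt.
Proof.
  unfold spt_cost2, fin. set (L := seq 0 n).
  replace (2 * lsum L (fun j => lsum L (fun l => if prec l j then d l else 0))) with
    (lsum L (fun j => lsum L (fun l => if prec l j then d l else 0)) +
     lsum L (fun j => lsum L (fun l => if prec j l then d j else 0)))
    by (rewrite (lsum_swap L L (fun j l => if prec j l then d j else 0)); ring).
  rewrite <- !lsum_plus. apply lsum_ext. intros j Hj.
  rewrite <- lsum_plus.
  transitivity (lsum L (fun l => shared spt j l + (if Nat.eqb l j then d l else 0))).
  2:{ rewrite lsum_plus, (lsum_pick L j (fun l => d l)); auto. apply seq_NoDup. }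
  apply lsum_ext. intros l _. unfold shared.
  destruct (Nat.eqb_spec l j) as [->|Hne].
  { rewrite Nat.eqb_refl. assert (prec j j = true) as -> by (apply precP; auto). rewrite Rmin_left; lra. }
  destruct (Nat.eqb_spec (asg spt j) (asg spt l)) as [He|He].
  2:{ destruct (prec l j) eqn:E1; [apply precP in E1; destruct E1; congruence|].
      destruct (prec j l) eqn:E2; [apply precP in E2; destruct E2; congruence|]. lra. }
  destruct (prec l j) eqn:E1, (prec j l) eqn:E2.
  - apply precP in E1, E2. destruct E1 as [_ [|[]]], E2 as [_ [|[]]]; try lra. lia.
  - apply precP in E1. destruct E1 as [_ E1]. rewrite Rmin_right; [lra|]. destruct E1 as [|[]]; lra.
  - apply precP in E2. destruct E2 as [_ E2]. rewrite Rmin_left; [lra|]. destruct E2 as [|[]]; lra.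
  - destruct (prec_total l j (eq_sym He)); congruence.
Qed.

Definition contrib (j : nat) : R := lsum (seq 0 n) (fun l => shared spt j l).

(** Twice the total of [fin] is the total of [contrib] plus all durations, and [contrib j] already
    contains the duration of [j]. *)
Lemma fin_le_contrib : lsum (seq 0 n) fin <= lsum (seq 0 n) contrib.
Proof.
  pose proof fin_sum as H. unfold spt_cost2 in H. change (lsum (seq 0 n) (fun j => lsum (seq 0 n) (fun l => shared spt j l)))
    with (lsum (seq 0 n) contrib) in H.
  enough (lsum (seq 0 n) (dur spt) <= lsum (seq 0 n) contrib) by lra.
  apply lsum_le. intros j Hj. unfold contrib.
  rewrite <- (lsum_pick (seq 0 n) j (fun l => d l)); [|apply seq_NoDup|auto].
  apply in_seq in Hj. apply lsum_le. intros l Hl. apply in_seq in Hl. unfold shared.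
  pose proof (dur_pos l ltac:(lia)). pose proof (dur_pos j ltac:(lia)).
  destruct (Nat.eqb_spec l j) as [->|].
  - rewrite Nat.eqb_refl, Rmin_left; lra.
  - destruct (Nat.eqb (asg spt j) (asg spt l)); [|lra]. apply Rlt_le, Rmin_glb_lt; auto.
Qed.

(** Local optimality, in the role of the equilibrium condition: moving [j] to [i] does not lower
    [spt_cost2]. Pairs without [j] cancel, and so do the diagonal and duration terms. *)
Lemma contrib_le j i : (j < n)%nat -> (i < m)%nat -> 0 < lam i j ->
  contrib j <= quantum / lam i j +
    lsum (seq 0 n) (fun l => if Nat.eqb (asg spt l) i then Rmin (quantum / lam i j) (d l) else 0).
Proof.
  intros Hj Hi Hl. set (a := quantum / lam i j).
  assert (Ha : 0 < a) by (apply Rdiv_lt_0_compat; auto; unfold quantum; lra).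
  destruct spt_spec as [[Hc Hpos] Hmin].
  assert (Hlen : length spt = n) by (apply codesP in Hc; tauto).
  set (s' := upd spt j i).
  assert (Hup : forall x, (x < n)%nat -> asg s' x = if Nat.eqb x j then i else asg spt x)
    by (intros; apply asg_upd; lia).
  assert (Hd' : forall x, (x < n)%nat -> dur s' x = if Nat.eqb x j then a else d x).
  { intros x Hx. unfold dur, lam_at. rewrite Hup by auto. destruct (Nat.eqb_spec x j); subst; auto. }
  specialize (Hmin s'). lapply Hmin; clear Hmin.
  2:{ split; [apply upd_codes; auto|]. intros x Hx. unfold lam_at. rewrite Hup by auto.
      destruct (Nat.eqb_spec x j); subst; auto. apply Hpos; auto. }
  intros Hmin. unfold spt_cost2 in Hmin. set (L := seq 0 n) in *.
  assert (HL : NoDup L) by apply seq_NoDup. assert (HjL : In j L) by (apply in_seq; lia).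
  rewrite (lsum_double L (shared spt) j HL HjL (shared_sym spt)) in Hmin.
  rewrite (lsum_double L (shared s') j HL HjL (shared_sym s')) in Hmin.
  assert (Hself : forall s, shared s j j = dur s j).
  { intros s. unfold shared. rewrite Nat.eqb_refl, Rmin_left; lra. }
  rewrite !Hself in Hmin.
  replace (lsum L (fun x => lsum L (fun y => if Nat.eqb x j || Nat.eqb y j then 0 else shared s' x y))) with
    (lsum L (fun x => lsum L (fun y => if Nat.eqb x j || Nat.eqb y j then 0 else shared spt x y))) in Hmin.
  2:{ apply lsum_ext. intros x Hx. apply lsum_ext. intros y Hy. apply in_seq in Hx, Hy.
      unfold shared. rewrite !Hup, !Hd' by lia.
      destruct (Nat.eqb x j), (Nat.eqb y j); auto. }
  replace (lsum L (dur s')) with (lsum L (dur spt) + (a - d j)) in Hmin.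
  2:{ rewrite <- (lsum_pick L j (fun _ => a - d j)), <- lsum_plus by auto. apply lsum_ext. intros x Hx.
      apply in_seq in Hx. rewrite Hd' by lia. destruct (Nat.eqb_spec x j); subst; lra. }
  rewrite (Hd' j Hj), Nat.eqb_refl in Hmin.
  assert (contrib j <= lsum L (fun l => shared s' j l)) by (unfold contrib; fold L; lra).
  eapply Rle_trans; [exact H|].
  apply Rle_trans with (lsum L (fun l => (if Nat.eqb l j then a else 0) +
    (if Nat.eqb (asg spt l) i then Rmin a (d l) else 0))).
  2:{ rewrite lsum_plus, (lsum_pick L j (fun _ => a)) by auto. lra. }
  apply lsum_le. intros l Hl'. apply in_seq in Hl'. unfold shared. rewrite !Hup, !Hd', Nat.eqb_refl by lia.
  pose proof (dur_pos l ltac:(lia)).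
  destruct (Nat.eqb_spec l j) as [->|].
  - rewrite Nat.eqb_refl, Rmin_left by lra. assert (0 <= Rmin a (d j)) by (apply Rmin_glb; lra).
    destruct (Nat.eqb (asg spt j) i); lra.
  - rewrite Nat.eqb_sym. destruct (Nat.eqb (asg spt l) i); lra.
Qed.

Lemma machine_load i s : 0 <= s ->
  lsum (seq 0 n) (fun l => if Nat.eqb (asg spt l) i && Rleb (fin l) s then d l else 0) <= s.
Proof.
  intros Hs. rewrite <- lsum_filter. set (L := filter _ _).
  assert (HL : forall l, In l L -> (l < n)%nat /\ asg spt l = i /\ fin l <= s).
  { intros l Hl. unfold L in Hl. rewrite filter_In, in_seq, andb_true_iff, Nat.eqb_eq, Rleb_true in Hl. split; [lia|tauto]. }
  rewrite (lsum_ext L _ (fun l => overlap (start l) (fin l) 0 s)).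
  - apply Rle_trans with (s - 0); [|lra]. apply disjoint_overlap_le; auto.
    + apply NoDup_ForallOrdPairs; [apply NoDup_filter, seq_NoDup|]. intros x y Hx Hy Hne.
      destruct (HL x Hx) as (? & ? & ?), (HL y Hy) as (? & ? & ?). apply slots_disjoint; auto. congruence.
    + intros l Hl. destruct (HL l Hl) as (? & _). pose proof (dur_pos l H). unfold start. lra.
  - intros l Hl. destruct (HL l Hl) as (? & _ & ?). pose proof (dur_pos l H). pose proof (start_nonneg l H).
    rewrite overlap_inside; auto; unfold start; lra.
Qed.

(** Dual fitting with [contrib] in place of completion times, since local optimality bounds
    [contrib]. As [p j >= 1], the processed amount [quantum] is at most [quantum * p j]. The ratio
    is [(1 + q) / (kappa * (1 - q))] with [q = quantum * kappa], that is 45/7. *)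
Lemma stage_cost p S' C' : (forall j, (j < n)%nat -> 1 <= p j) -> feasible m n lam p S' C' ->
  lsum (seq 0 n) fin <= 643 / 100 * sumR n C'.
Proof.
  intros p_ge1 HF. set (L := seq 0 n).
  set (V := map (fun l => mkBlock (asg spt l) (quantum * kappa) 0 (kappa * fin l)) L).
  assert (Hfin : forall l, (l < n)%nat -> 0 < fin l).
  { intros l Hl. pose proof (start_nonneg l Hl). pose proof (dur_pos l Hl). unfold start in *. lra. }
  pose proof (opt_dual m n lam p S' C' (fun j => kappa * contrib j) V (quantum * kappa) lam_ge0 p_ge1 HF
    ltac:(unfold quantum, kappa; lra)) as D.
  assert (E : lsum V (fun x => bw x * (bv x - bu x)) = quantum * kappa * kappa * lsum L fin).
  { unfold V. rewrite lsum_map, <- lsum_scal. apply lsum_ext. intros; cbn [bw bv bu]. ring. }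
  rewrite E in D. clear E.
  rewrite sumR_lsum in D. fold L in D. rewrite lsum_scal in D.
  pose proof fin_le_contrib as F. fold L in F.
  enough (kappa * lsum L contrib <= (1 + quantum * kappa) * sumR n C' + quantum * kappa * kappa * lsum L fin).
  { assert (0 <= sumR n C').
    { rewrite sumR_lsum. apply lsum_nonneg. intros j Hj. apply in_seq in Hj. destruct HF as [_ HC].
      destruct (HC j ltac:(lia)) as [H1 _]. destruct (Rle_or_lt 0 (C' j)); auto.
      rewrite work_le0 in H1 by lra. pose proof (p_ge1 j ltac:(lia)). lra. }
    unfold quantum, kappa in *. lra. }
  apply D; clear D.
  - intros x Hx. apply in_map_iff in Hx. destruct Hx as [l [<- Hl]]. apply in_seq in Hl. cbn [bw bu bv].
    specialize (Hfin l ltac:(lia)). unfold quantum, kappa. split; lra.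
  - intros i j a b Hi Hj Hlt Ha Hab Hb. specialize (p_ge1 j Hj).
    unfold V. rewrite lsum_map. cbn [bm bw bu bv].
    set (ld := lsum L (fun l => if Nat.eqb (asg spt l) i then quantum * kappa * overlap a b 0 (kappa * fin l) else 0)).
    assert (Hld : 0 <= ld).
    { apply lsum_nonneg. intros l _. destruct (Nat.eqb (asg spt l) i); [|lra].
      apply Rmult_le_pos; [unfold quantum, kappa; lra|apply overlap_nonneg]. }
    assert (Hqk : 0 <= quantum * kappa * (b - a)) by (unfold quantum, kappa; lra).
    destruct (Req_dec (lam i j) 0) as [H0|H0].
    { rewrite H0. replace ((kappa * contrib j - C' j) * 0 * (b - a)) with 0 by ring.
      apply Rmult_le_pos; lra. }
    assert (Hlij : 0 < lam i j) by (pose proof (lam_ge0 i j); lra).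
    pose proof (contrib_le j i Hj Hi Hlij) as Hc. fold L in Hc. set (q := quantum / lam i j) in *.
    set (s := C' j / kappa). assert (Hs : 0 <= s) by (unfold s, kappa; apply Rmult_le_pos; lra).
    assert (Hks : kappa * s = C' j) by (unfold s, kappa; field).
    (* Jobs of machine [i] ending by [s] have total length at most [s]. Each of the [N] later ones
       adds at most [q], and its block covers all of [[a, b]] because [b <= kappa * s]. *)
    set (N := lsum L (fun l => if Nat.eqb (asg spt l) i && negb (Rleb (fin l) s) then 1 else 0)).
    assert (Hc2 : contrib j <= q + s + q * N).
    { eapply Rle_trans; [exact Hc|]. rewrite Rplus_assoc. apply Rplus_le_compat_l.
      pose proof (machine_load i s Hs) as HM. fold L in HM.
      apply Rle_trans with (lsum L (fun l => if Nat.eqb (asg spt l) i && Rleb (fin l) s then d l else 0) + q * N); [|lra].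
      unfold N. rewrite <- lsum_scal, <- lsum_plus. apply lsum_le. intros l _.
      destruct (Nat.eqb (asg spt l) i); cbn [andb]; [|lra].
      pose proof (Rmin_l q (d l)). pose proof (Rmin_r q (d l)).
      destruct (Rleb (fin l) s); cbn [negb]; lra. }
    assert (Hov : quantum * kappa * N * (b - a) <= ld).
    { unfold N, ld. replace (quantum * kappa * lsum L (fun l => if Nat.eqb (asg spt l) i && negb (Rleb (fin l) s) then 1 else 0) * (b - a))
        with (quantum * kappa * (b - a) * lsum L (fun l => if Nat.eqb (asg spt l) i && negb (Rleb (fin l) s) then 1 else 0)) by ring.
      rewrite <- lsum_scal. apply lsum_le. intros l _.
      pose proof (overlap_nonneg a b 0 (kappa * fin l)) as Ho.
      destruct (Nat.eqb (asg spt l) i); cbn [andb]; [|lra].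
      destruct (Rleb (fin l) s) eqn:El; cbn [negb].
      { rewrite Rmult_0_r. apply Rmult_le_pos; [unfold quantum, kappa; lra|auto]. }
      assert (s < fin l).
      { destruct (Rlt_or_le s (fin l)) as [|Hx]; auto. apply Rleb_true in Hx. congruence. }
      rewrite overlap_inside; [lra|auto|auto|]. apply Rle_trans with (kappa * s); [lra|].
      unfold kappa; lra. }
    apply Rle_trans with (quantum * kappa * (1 + N) * (b - a)).
    + apply Rmult_le_compat_r; [lra|].
      replace (quantum * kappa * (1 + N)) with (kappa * (q + q * N) * lam i j) by (unfold q; field; lra).
      apply Rmult_le_compat_r; [lra|]. rewrite <- Hks. unfold kappa in *. lra.
    + nra.
Qed.

(** * Abandoning the nonpreemptive schedule *)

Definition prefix (t : R) : schedule :=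
  map (fun j => mkSeg (asg spt j) j (start j) (Rmin (fin j) t)) (filter (fun j => Rltb (start j) t) (seq 0 n)).

(** Bounds every [fin]; the summand 1 keeps it positive when there are no jobs. *)
Definition horizon : R := 1 + lsum (seq 0 n) fin.

(** The first end of a slot whose job is not shorter than [quantum]. Size exactly [quantum] counts
    as long, matching the nonstrict test of [round]. *)
Definition stop (p : nat -> R) : R :=
  fold_right Rmin horizon (map fin (filter (fun j => Rleb quantum (p j)) (seq 0 n))).

Lemma fold_min_le (L : list R) h : fold_right Rmin h L <= h /\ forall x, In x L -> fold_right Rmin h L <= x.
Proof.
  induction L as [|a L [IH1 IH2]]; simpl.
  - split; [lra|]. intros x [].
  - pose proof (Rmin_l a (fold_right Rmin h L)). pose proof (Rmin_r a (fold_right Rmin h L)).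
    split; [lra|]. intros x [<-|Hx]; auto. specialize (IH2 x Hx). lra.
Qed.

Lemma fold_min_in (L : list R) h : fold_right Rmin h L = h \/ In (fold_right Rmin h L) L.
Proof.
  induction L as [|a L IH]; simpl; auto.
  set (r := fold_right Rmin h L) in *. unfold Rmin. destruct (Rle_dec a r); tauto.
Qed.

Lemma fin_pos j : (j < n)%nat -> 0 < fin j.
Proof. intros Hj. pose proof (start_nonneg j Hj). pose proof (dur_pos j Hj). unfold start in *. lra. Qed.

Lemma fin_le_horizon j : (j < n)%nat -> fin j <= horizon.
Proof.
  intros Hj. unfold horizon.
  enough (fin j <= lsum (seq 0 n) fin) by lra.
  rewrite <- (lsum_pick (seq 0 n) j fin) at 1; [|apply seq_NoDup|apply in_seq; lia].
  apply lsum_le. intros x Hx. apply in_seq in Hx. pose proof (fin_pos x ltac:(lia)). destruct (Nat.eqb x j); lra.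
Qed.

Lemma stop_le_horizon p : stop p <= horizon.
Proof. apply (proj1 (fold_min_le _ _)). Qed.

Lemma stop_le_fin p j : (j < n)%nat -> quantum <= p j -> stop p <= fin j.
Proof.
  intros Hj Hq. apply (proj2 (fold_min_le _ _)). apply in_map. apply filter_In. split; [apply in_seq; lia|]. apply Rleb_true; auto.
Qed.

Lemma stop_cases p : stop p = horizon \/ exists j, (j < n)%nat /\ quantum <= p j /\ stop p = fin j.
Proof.
  destruct (fold_min_in (map fin (filter (fun j => Rleb quantum (p j)) (seq 0 n))) horizon) as [H|H]; [left; auto|right].
  apply in_map_iff in H. destruct H as [j [H1 H2]]. apply filter_In in H2. destruct H2 as [H2 H3].
  apply in_seq in H2. apply Rleb_true in H3. exists j. split; [lia|split; auto].
Qed.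

Lemma stop_pos p : 0 < stop p.
Proof.
  destruct (stop_cases p) as [->|[j (Hj & _ & ->)]]; [|apply fin_pos; auto].
  unfold horizon. enough (0 <= lsum (seq 0 n) fin) by lra. apply lsum_nonneg. intros x Hx. apply in_seq in Hx.
  apply Rlt_le, fin_pos; lia.
Qed.

Lemma prefix_bounds t s : In s (prefix t) ->
  (sj s < n)%nat /\ sm s = asg spt (sj s) /\ ss s = start (sj s) /\ se s = Rmin (fin (sj s)) t /\ start (sj s) < t.
Proof.
  intros Hs. apply in_map_iff in Hs. destruct Hs as [j [<- Hj]]. apply filter_In in Hj. destruct Hj as [Hj Ht].
  apply in_seq in Hj. apply Rltb_true in Ht. simpl. repeat split; auto. lia.
Qed.

Lemma prefix_work t j u : 0 < t -> (j < n)%nat ->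
  work lam (prefix t) j u = lam_at lam spt j * Rmax 0 (Rmin (fin j) (Rmin t u) - start j).
Proof.
  intros Ht Hj. rewrite workE. unfold prefix. rewrite lsum_map, lsum_filter. cbn [sj sm ss se].
  rewrite (lsum_ext (seq 0 n) _ (fun l => if Nat.eqb l j then
    (if Rltb (start l) t then lam (asg spt l) l * overlap (start l) (Rmin (fin l) t) 0 u else 0) else 0)).
  - rewrite (lsum_pick (seq 0 n) j (fun l => if Rltb (start l) t then lam (asg spt l) l * overlap (start l) (Rmin (fin l) t) 0 u else 0));
      [|apply seq_NoDup|apply in_seq; lia].
    pose proof (start_nonneg j Hj). unfold lam_at.
    assert (start j < fin j) by (pose proof (dur_pos j Hj); unfold start; lra).
    unfold Rltb. destruct (Rlt_dec (start j) t).
    + f_equal. minmax.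
    + replace (Rmax 0 (Rmin (fin j) (Rmin t u) - start j)) with 0; [ring|]. minmax.
  - intros l _. destruct (Rltb (start l) t), (Nat.eqb_spec l j); subst; auto.
Qed.

Lemma prefix_work_fin t j u : (j < n)%nat -> fin j <= t -> fin j <= u -> work lam (prefix t) j u = quantum.
Proof.
  intros Hj Ht Hu. pose proof (fin_pos j Hj). pose proof (dur_pos j Hj) as Hd. rewrite prefix_work by (auto; lra).
  rewrite Rmin_left by (apply Rmin_glb; lra). unfold start. rewrite Rmax_right by lra.
  replace (fin j - (fin j - d j)) with (d j) by ring. unfold dur. field.
  apply Rgt_not_eq, spt_spec; auto.
Qed.

Lemma prefix_work_after t j u : 0 < t -> (j < n)%nat -> t <= u -> work lam (prefix t) j u = work lam (prefix t) j t.
Proof. intros Ht Hj Hu. rewrite !prefix_work by auto. rewrite (Rmin_left t u), (Rmin_left t t) by lra. auto. Qed.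

Lemma find_map_filter (f : seg -> bool) (h : nat -> seg) (P : nat -> bool) (L : list nat) :
  (forall j, sj (h j) = j) ->
  match find f (map h (filter P L)) with Some x => Some (sj x) | None => None end =
  find (fun j => P j && f (h j)) L.
Proof.
  intros H. induction L as [|j L IH]; simpl; auto.
  destruct (P j); simpl; auto. destruct (f (h j)); auto.
Qed.

Lemma prefix_state t t' i s : s < t -> s < t' -> state (prefix t) i s = state (prefix t') i s.
Proof.
  intros H H'. unfold state, prefix. rewrite !find_map_filter by auto. cbn [sm ss se].
  assert (E : forall r, s < r -> (fun j => Rltb (start j) r && (Nat.eqb (asg spt j) i && Rleb (start j) s && Rltb s (Rmin (fin j) r)))
    = (fun j => Nat.eqb (asg spt j) i && Rleb (start j) s && Rltb s (fin j))).
  { intros r Hr. extensionality j. apply eq_true_iff_eq. rewrite !andb_true_iff, !Rltb_true, !Rleb_true.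
    split.
    - intros (H1 & H2 & H3). split; auto. pose proof (Rmin_l (fin j) r). lra.
    - intros [[H1 H2] H3]. split; [lra|]. repeat split; auto. apply Rmin_glb_lt; auto. }
  rewrite (E t H), (E t' H'). auto.
Qed.

Definition stage_alive (p : nat -> R) : list nat :=
  filter (fun j => Rleb (work lam (prefix (stop p)) j (stop p)) (p j)) (seq 0 n).

Definition stage_state (p : nat -> R) : st :=
  mkSt (prefix (stop p)) (stop p + tau0 lam m n) (stage_alive p) false (tau0 lam m n)
    (nash0 lam m n (stage_alive p)).

Lemma stage_inv p : inv lam m n p (stage_state p).
Proof.
  pose proof (stop_pos p) as Ht. pose proof (tau0_pos lam m n lam_ge0) as Ht0.
  split; [split|split; [split|split; [|split]]]; simpl.
  - intros s Hs. destruct (prefix_bounds _ _ Hs) as (H1 & H2 & H3 & H4 & H5).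
    rewrite H2, H3, H4. pose proof (start_nonneg (sj s) H1). pose proof (dur_pos (sj s) H1).
    split; [eapply asg_codes; [apply spt_spec|auto]|]. split; auto. split; auto.
    split; [apply Rmin_glb_lt; auto; unfold start; lra|]. pose proof (Rmin_r (fin (sj s)) (stop p)). lra.
  - unfold prefix. apply ForallOrdPairs_map. apply NoDup_ForallOrdPairs; [apply NoDup_filter, seq_NoDup|].
    intros l j Hl Hj Hne [Hc|Hc]; simpl in Hc; [|congruence]. simpl.
    apply filter_In in Hl, Hj. destruct Hl as [Hl _], Hj as [Hj _]. apply in_seq in Hl, Hj.
    pose proof (Rmin_l (fin l) (stop p)). pose proof (Rmin_l (fin j) (stop p)).
    destruct (slots_disjoint l j ltac:(lia) ltac:(lia) Hne Hc); [left|right]; lra.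
  - apply NoDup_filter, seq_NoDup.
  - intros j. unfold stage_alive. rewrite filter_In, in_seq, Rleb_true. split.
    + intros [H1 H2]. split; [lia|]. rewrite prefix_work_after; auto; [lia|lra].
    + intros [H1 H2]. rewrite prefix_work_after in H2; auto; [|lra]. split; auto; lia.
  - apply nash0_spec; auto; [apply NoDup_filter, seq_NoDup|apply incl_filter].
  - auto.
  - lra.
Qed.

Lemma stage_online : online lam n stage_state.
Proof.
  intros p p' t Vp Vp' Hinf. simpl in Hinf.
  (* At time [fin j] the work is exactly [quantum], so comparing it with the size is the very test
     that [stop] performs. *)
  assert (Hq : forall j, (j < n)%nat -> fin j < t -> fin j <= stop p -> (quantum <= p j <-> quantum <= p' j)).
  { intros j Hj Hf Hs. specialize (Hinf (fin j) j Hf Hj). rewrite prefix_work_fin in Hinf; auto; lra. }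
  assert (Hlow : forall j, (j < n)%nat -> quantum <= p' j -> fin j < t -> stop p <= fin j).
  { intros j Hj Hp' Hf. destruct (Rle_or_lt (stop p) (fin j)) as [|Hlt]; auto.
    apply stop_le_fin; auto. apply Hq; auto; lra. }
  destruct (Rlt_or_le (stop p) t) as [Hlt|Hle].
  - assert (Es : stop p' = stop p).
    { apply Rle_antisym.
      - destruct (stop_cases p) as [->|[j (Hj & Hp & Es)]]; [apply stop_le_horizon|].
        rewrite Es. apply stop_le_fin; auto. apply Hq; auto; lra.
      - destruct (stop_cases p') as [->|[j (Hj & Hp & Es)]]; [apply stop_le_horizon|].
        rewrite Es. destruct (Rlt_or_le (fin j) t); [apply Hlow; auto|lra]. }
    assert (E : stage_state p' = stage_state p).
    { unfold stage_state. assert (stage_alive p' = stage_alive p) as ->; [|rewrite Es; auto].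
      unfold stage_alive. rewrite Es. apply filter_ext_in. intros j Hj. apply in_seq in Hj.
      apply eq_true_iff_eq. rewrite !Rleb_true. symmetry. apply Hinf; auto; lia. }
    destruct (Rlt_or_le (tm (stage_state p)) t); [left; auto|right]. rewrite E. auto.
  - right. pose proof (tau0_pos lam m n lam_ge0) as Ht0. simpl.
    assert (t <= stop p').
    { destruct (stop_cases p') as [->|[j (Hj & Hp & ->)]]; [pose proof (stop_le_horizon p); lra|].
      destruct (Rle_or_lt t (fin j)) as [|Hf]; auto. specialize (Hlow j Hj Hp Hf). lra. }
    split; [lra|split; [lra|]]. intros i s Hs. apply prefix_state; lra.
Qed.

End Stage.

(** No rate exceeds the sum [B] of all rates plus 1, so a job of size at least 1 needs time [1 / B],
    a thousand times [tau0]. *)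
Lemma opt_tau0 lam m n p S' C' : (forall i j, 0 <= lam i j) -> (forall j, (j < n)%nat -> 1 <= p j) ->
  feasible m n lam p S' C' -> INR n * tau0 lam m n <= sumR n C' / 1000.
Proof.
  intros lam_ge0 p_ge1 [Hval HC].
  apply valid_scheduleE in Hval. destruct Hval as [Hok Hpair].
  set (B := 1 + lsum (seq 0 n) (fun j => lsum (seq 0 m) (fun i => lam i j))).
  assert (Hlam : forall i j, (i < m)%nat -> (j < n)%nat -> lam i j <= B).
  { intros i j Hi Hj. apply Rle_trans with (lsum (seq 0 m) (fun i => lam i j)).
    - rewrite <- (lsum_pick (seq 0 m) i (fun i => lam i j)); [|apply seq_NoDup|apply in_seq; lia].
      apply lsum_le. intros x _. destruct (Nat.eqb x i); [lra|auto].
    - apply Rle_trans with (lsum (seq 0 n) (fun j => lsum (seq 0 m) (fun i => lam i j))); [|unfold B; lra].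
      rewrite <- (lsum_pick (seq 0 n) j (fun j => lsum (seq 0 m) (fun i => lam i j))); [|apply seq_NoDup|apply in_seq; lia].
      apply lsum_le. intros x _. destruct (Nat.eqb x j); [lra|]. apply lsum_nonneg; auto. }
  assert (HB : 1 <= B).
  { unfold B. enough (0 <= lsum (seq 0 n) (fun j => lsum (seq 0 m) (fun i => lam i j))) by lra.
    apply lsum_nonneg; intros; apply lsum_nonneg; auto. }
  unfold tau0. fold B.
  assert (Hj : forall j, (j < n)%nat -> 1 <= B * C' j).
  { intros j Hj. destruct (HC j Hj) as [Hw _]. pose proof (p_ge1 j Hj).
    assert (HC0 : 0 <= C' j).
    { destruct (Rle_or_lt 0 (C' j)); auto. rewrite work_le0 in Hw by lra. lra. }
    apply Rle_trans with (work lam S' j (C' j)); [lra|]. rewrite workE.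
    apply Rle_trans with (lsum S' (fun s => B * (if Nat.eqb (sj s) j then overlap (ss s) (se s) 0 (C' j) else 0))).
    - apply lsum_le. intros s Hs. destruct (Hok s Hs) as (H1 & H2 & _). destruct (Nat.eqb_spec (sj s) j); [|lra].
      apply Rmult_le_compat_r; [apply overlap_nonneg|]. apply Hlam; auto.
    - rewrite lsum_scal. apply Rmult_le_compat_l; [lra|]. rewrite <- lsum_filter.
      apply Rle_trans with (C' j - 0); [|lra]. apply disjoint_overlap_le; auto.
      + eapply ForallOrdPairs_impl; [|apply ForallOrdPairs_filter; exact Hpair].
        intros x y Hx Hy Hc. apply filter_In in Hx, Hy. apply Hc. right.
        destruct Hx as [_ Hx], Hy as [_ Hy]. apply Nat.eqb_eq in Hx, Hy. congruence.
      + intros s Hs. apply filter_In in Hs. destruct (Hok s); [tauto|]. lra. }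
  rewrite sumR_lsum. replace n with (length (seq 0 n)) at 1 by apply length_seq.
  rewrite <- lsum_const. unfold Rdiv. rewrite (Rmult_comm (lsum _ C')), <- lsum_scal.
  apply lsum_le. intros j Hj'. apply in_seq in Hj'. specialize (Hj j ltac:(lia)).
  rewrite Rinv_mult. apply Rmult_le_compat_l; [lra|]. apply (Rmult_le_reg_l B); [lra|].
  rewrite Rinv_r by lra. auto.
Qed.

(** * The algorithm *)


Lemma iterate_add {X : Type} (f : X -> X) a b x : iterate (a + b) f x = iterate a f (iterate b f x).
Proof. induction a; simpl; congruence. Qed.

Lemma least_nat (P : nat -> Prop) : (exists k, P k) -> exists k, P k /\ forall i, (i < k)%nat -> ~ P i.
Proof.
  intros [k Hk]. induction k as [k IH] using (well_founded_induction Wf_nat.lt_wf).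
  destruct (classic (exists i, (i < k)%nat /\ P i)) as [[i [Hi Pi]]|Hn]; [eauto|].
  exists k. split; auto. intros i Hi Pi. apply Hn. eauto.
Qed.

Lemma maxR_ge q k j : (j < k)%nat -> q j <= maxR k q.
Proof.
  induction k; intros H; [lia|]. simpl. destruct (Nat.eq_dec j k) as [->|]; [apply Rmax_r|].
  eapply Rle_trans; [apply IHk; lia|apply Rmax_l].
Qed.

Lemma ln_max_nonneg n p : valid_sizes n p -> 0 <= ln (maxR n p).
Proof.
  intros Vp. destruct n as [|n].
  (* Without jobs [maxR] is 0, where [ln] takes its default value 0. *)
  - simpl. unfold ln. destruct (Rlt_dec 0 0) as [H|H]; [exfalso; lra|apply Rle_refl].
  - apply ln_ge0. eapply Rle_trans; [apply (Vp 0%nat); lia|]. apply maxR_ge; lia.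
Qed.

Definition budget (n : nat) (phat p : nat -> R) : R := sumR n (fun j => ln (p j / phat j + 1)).

Lemma budget_term_nonneg n phat p j : valid_sizes n p -> (forall j, (j < n)%nat -> 0 < phat j) ->
  (j < n)%nat -> 0 <= ln (p j / phat j + 1).
Proof.
  intros Vp Hphat Hj. apply ln_ge0. pose proof (Hphat j Hj). pose proof (Vp j Hj).
  assert (0 < p j / phat j) by (apply Rdiv_lt_0_compat; lra). lra.
Qed.

Lemma ln_2_le_1 : ln 2 <= 1.
Proof.
  rewrite <- (ln_exp 1). apply ln_mono; [lra|]. pose proof (exp_ineq1 1 ltac:(lra)). lra.
Qed.

Lemma ln_quantum_pos : 0 < ln quantum.
Proof. rewrite <- ln_1. apply ln_increasing; unfold quantum; lra. Qed.

Lemma countN_le k f : (countN k f <= k)%nat.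
Proof. unfold countN. rewrite <- (length_seq k 0) at 2. apply filter_length_le. Qed.

Lemma countN_zero k f : (forall i, (i < k)%nat -> f i = false) -> countN k f = O.
Proof.
  intros H. unfold countN. destruct (filter f (seq 0 k)) as [|i L] eqn:E; auto.
  assert (Hi : In i (filter f (seq 0 k))) by (rewrite E; left; auto).
  apply filter_In in Hi. destruct Hi as [Hi1 Hi2]. apply in_seq in Hi1. rewrite H in Hi2 by lia. discriminate.
Qed.

Lemma num_le_length S C : INR (num_preempt_migr S C) <= 2 * INR (length S).
Proof.
  unfold num_preempt_migr. rewrite plus_INR.
  pose proof (le_INR _ _ (countN_le (length S) (is_preemption S C))).
  pose proof (le_INR _ _ (countN_le (length S) (is_migration S C))). lra.
Qed.

Section Algorithm.
Variables (lam : nat -> nat -> R) (m n g : nat) (phat : nat -> R).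

Definition prediction_state : st :=
  mkSt [] (tau0 lam m n) (seq 0 n) true (tau0 lam m n) (nash0 lam m n (seq 0 n)).

Definition initial (p : nat -> R) : st :=
  if Nat.leb n (51 * g) then stage_state lam m n p else prediction_state.

Definition run (p : nat -> R) (k : nat) : st := iterate k (step lam m n g phat p) (initial p).

(** This number depends on the sizes but reveals nothing: once no job is alive, further steps add no
    segments. *)
Definition steps_needed (p : nat -> R) : nat := epsilon (inhabits O) (fun k => al (run p k) = []).

Definition params_ok : Prop :=
  (forall i j, 0 <= lam i j) /\ (forall j, (j < n)%nat -> exists i, (i < m)%nat /\ 0 < lam i j).

Hypothesis lam_ge0 : forall i j, 0 <= lam i j.
Hypothesis lam_pos : forall j, (j < n)%nat -> exists i, (i < m)%nat /\ 0 < lam i j.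

Local Notation stp p := (step lam m n g phat p).
Local Notation rnd p := (round lam m n phat p).

Lemma prediction_inv p : valid_sizes n p -> inv lam m n p prediction_state.
Proof.
  intros Vp. pose proof (tau0_pos lam m n lam_ge0) as Ht.
  split; [split|split; [split|split; [|split]]]; simpl; auto; try lra.
  - intros s [].
  - constructor.
  - apply seq_NoDup.
  - intros j. rewrite in_seq. split.
    + intros H. specialize (Vp j ltac:(lia)). split; [lia|lra].
    + lia.
  - apply nash0_spec; auto; [apply seq_NoDup|apply incl_refl].
Qed.

Lemma initial_inv p : valid_sizes n p -> inv lam m n p (initial p).
Proof.
  intros Vp. unfold initial. destruct (Nat.leb n (51 * g)); [apply stage_inv|apply prediction_inv]; auto.
Qed.

Lemma initial_online : online lam n initial.
Proof.
  unfold initial. destruct (Nat.leb n (51 * g)).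
  - apply (stage_online lam m n lam_ge0 lam_pos).
  - intros p p' t _ _ _. destruct (Rlt_or_le (tm prediction_state) t); auto.
Qed.

Lemma run_inv p k : valid_sizes n p -> inv lam m n p (run p k).
Proof. intros Vp. apply iterate_inv; auto. apply initial_inv; auto. Qed.

Lemma iterate_round_ph p k x : ph (iterate k (rnd p) x) = ph x.
Proof. induction k; auto. Qed.

Lemma iterate_step_round p k x : (forall i, (i < k)%nat -> switch g (iterate i (rnd p) x) = false) ->
  iterate k (stp p) x = iterate k (rnd p) x.
Proof.
  induction k; intros H; auto. simpl. rewrite IHk by (intros; apply H; lia).
  unfold step. rewrite (H k) by lia. auto.
Qed.

Lemma iterate_step_round_false p k x : ph x = false -> iterate k (stp p) x = iterate k (rnd p) x.
Proof.
  intros H. apply iterate_step_round. intros i _. unfold switch. rewrite iterate_round_ph, H. auto.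
Qed.

Lemma second_phase p x : valid_sizes n p -> inv lam m n p x -> ph x = false ->
  exists r, al (iterate r (rnd p) x) = [] /\ forall k, (k < r)%nat -> al (iterate k (rnd p) x) <> [].
Proof. intros Vp HI Hp. apply (least_nat (fun k => al (iterate k (rnd p) x) = [])). eapply phase_terminates; eauto. Qed.

Lemma first_phase p : valid_sizes n p ->
  exists r, (length (al (iterate r (rnd p) prediction_state)) <= 51 * g)%nat /\
    (forall k, (k < r)%nat -> (51 * g < length (al (iterate k (rnd p) prediction_state)))%nat).
Proof.
  intros Vp. destruct (least_nat (fun k => (length (al (iterate k (rnd p) prediction_state)) <= 51 * g)%nat)) as [r [H1 H2]].
  - destruct (phase_terminates lam m n phat p prediction_state lam_ge0 lam_pos (prediction_inv p Vp)) as [r Hr].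
    exists r. rewrite Hr. simpl. lia.
  - exists r. split; auto. intros k Hk. specialize (H2 k Hk). lia.
Qed.

Definition restart (x : st) : st :=
  mkSt (sc x) (tm x + tau0 lam m n) (al x) false (tau0 lam m n) (nash0 lam m n (al x)).

Lemma first_phase_restart p r :
  (length (al (iterate r (rnd p) prediction_state)) <= 51 * g)%nat ->
  (forall k, (k < r)%nat -> (51 * g < length (al (iterate k (rnd p) prediction_state)))%nat) ->
  iterate r (stp p) prediction_state = iterate r (rnd p) prediction_state /\
  iterate (S r) (stp p) prediction_state = restart (iterate r (rnd p) prediction_state).
Proof.
  intros H1 H2.
  assert (E : iterate r (stp p) prediction_state = iterate r (rnd p) prediction_state).
  { apply iterate_step_round. intros i Hi. unfold switch. apply andb_false_intro2.
    apply Nat.leb_gt. auto. }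
  split; auto. simpl. rewrite E. unfold step, switch. rewrite iterate_round_ph.
  apply Nat.leb_le in H1. rewrite H1. reflexivity.
Qed.

Lemma steps_needed_spec p : valid_sizes n p -> al (run p (steps_needed p)) = [].
Proof.
  intros Vp. unfold steps_needed. apply (epsilon_spec (inhabits O) (fun k => al (run p k) = [])).
  unfold run, initial. destruct (Nat.leb n (51 * g)).
  - destruct (second_phase p (stage_state lam m n p) Vp (stage_inv lam m n lam_ge0 lam_pos p) eq_refl) as [r [Hr _]].
    exists r. rewrite iterate_step_round_false; auto.
  - destruct (first_phase p Vp) as [r1 [H1 H2]].
    destruct (first_phase_restart p r1 H1 H2) as [E1 E2].
    assert (HI : inv lam m n p (iterate (S r1) (stp p) prediction_state)).
    { apply iterate_inv; auto. apply prediction_inv; auto. }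
    rewrite E2 in HI. destruct (second_phase p _ Vp HI eq_refl) as [r [Hr _]].
    exists (r + S r1)%nat. rewrite iterate_add, E2, iterate_step_round_false; auto.
Qed.

Definition final (p : nat -> R) : schedule := sc (run p (steps_needed p)).

Lemma final_run p k : valid_sizes n p -> al (run p k) = [] -> final p = sc (run p k).
Proof.
  intros Vp Hk. pose proof (steps_needed_spec p Vp) as HN. unfold final, run in *.
  destruct (Nat.le_ge_cases k (steps_needed p)) as [H|H].
  - apply (iterate_done lam m n g phat p _ k); auto.
  - symmetry. apply (iterate_done lam m n g phat p _ (steps_needed p)); auto.
Qed.

Lemma final_state p p' t : valid_sizes n p -> valid_sizes n p' -> informed lam n (final p) p p' t ->
  forall i s, s < t -> state (final p) i s = state (final p') i s.
Proof.
  intros Vp Vp' H i s Hs.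
  (* Both runs are compared after the same number of steps, large enough for either. *)
  set (k := Nat.max (steps_needed p) (steps_needed p')).
  assert (E : final p = sc (run p k)).
  { apply final_run; auto. apply (iterate_done lam m n g phat p _ (steps_needed p)); [apply steps_needed_spec; auto|unfold k; lia]. }
  assert (E' : final p' = sc (run p' k)).
  { apply final_run; auto. apply (iterate_done lam m n g phat p' _ (steps_needed p')); [apply steps_needed_spec; auto|unfold k; lia]. }
  rewrite E in *. rewrite E'.
  assert (HO : online lam n (fun p => run p k)).
  { apply (iterate_online lam m n g phat lam_ge0 lam_pos k initial); [intros; apply initial_inv; auto|apply initial_online]. }
  destruct (HO p p' t Vp Vp' H) as [[_ H2]|(_ & _ & H3)]; [|apply H3; auto].
  simpl in H2. rewrite H2. auto.
Qed.

Lemma iterate_sc_app p x k : inv lam m n p x -> exists E, sc (iterate k (stp p) x) = sc x ++ E.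
Proof.
  intros HI. induction k as [|k [E IH]]; [exists []; rewrite app_nil_r; auto|].
  destruct (step_sc lam m n g phat lam_ge0 p (iterate k (stp p) x)) as [_ [E' [HE _]]].
  { apply iterate_inv; auto. }
  exists (E ++ E'). change (sc (stp p (iterate k (stp p) x)) = sc x ++ E ++ E'). rewrite HE, IH, app_assoc. auto.
Qed.

(** * Competitive ratio of the whole run *)

Section Analysis.
Variables (p C : nat -> R).
Hypothesis p_ge1 : valid_sizes n p.
Hypothesis C_completes : forall j, (j < n)%nat -> completes lam (final p) p j (C j).

Lemma run_sc_app k : exists E, final p = sc (run p k) ++ E.
Proof.
  destruct (Nat.le_ge_cases k (steps_needed p)) as [H|H].
  - unfold final, run. replace (steps_needed p) with ((steps_needed p - k) + k)%nat by lia.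
    rewrite iterate_add. apply iterate_sc_app. apply run_inv; auto.
  - exists []. rewrite app_nil_r. apply final_run; auto.
    apply (iterate_done lam m n g phat p _ (steps_needed p)); auto. apply steps_needed_spec; auto.
Qed.

Lemma completion_le k j : (j < n)%nat -> ~ In j (al (run p k)) -> C j <= tm (run p k).
Proof.
  intros Hj Hn. apply (completes_le lam (final p) p j); auto.
  destruct (run_sc_app k) as [E ->]. rewrite work_app.
  pose proof (work_nonneg lam lam_ge0 E j (tm (run p k))).
  destruct (run_inv p k p_ge1) as (_ & (_ & HA) & _).
  destruct (Rle_or_lt (work lam (sc (run p k)) j (tm (run p k))) (p j)) as [Hc|]; [|lra].
  exfalso. apply Hn, HA. auto.
Qed.

(** The total completion time if all jobs alive completed right now. It grows by at most the number
    alive times the elapsed time and ends as the cost of the algorithm. *)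
Definition potential (x : st) : R := lsum (seq 0 n) (fun j => if mem j (al x) then tm x else C j).

Lemma potential_step x x' : NoDup (al x) -> incl (al x) (seq 0 n) -> incl (al x') (al x) -> tm x <= tm x' ->
  (forall j, (j < n)%nat -> ~ In j (al x') -> C j <= tm x') ->
  potential x' <= potential x + INR (length (al x)) * (tm x' - tm x).
Proof.
  intros H1 H2 H3 H4 H5. unfold potential.
  rewrite <- lsum_const, (lsum_sublist (al x) (seq 0 n)), <- lsum_plus by (auto; apply seq_NoDup).
  apply lsum_le. intros j Hj. apply in_seq in Hj.
  destruct (mem j (al x')) eqn:E'.
  - apply mem_true in E'. rewrite (proj2 (mem_true j (al x))) by auto. lra.
  - assert (Hn : ~ In j (al x')) by (intros Hin; apply mem_true in Hin; congruence).
    specialize (H5 j ltac:(lia) Hn). destruct (mem j (al x)); lra.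
Qed.

Lemma potential_phase y r : inv lam m n p y ->
  (forall k, (k <= r)%nat -> forall j, (j < n)%nat -> ~ In j (al (iterate k (rnd p) y)) -> C j <= tm (iterate k (rnd p) y)) ->
  potential (iterate r (rnd p) y) <= potential y + span lam m n phat p y r.
Proof.
  intros HI. induction r; intros H.
  - unfold span, lsum; simpl. lra.
  - assert (IH := IHr (fun k Hk => H k ltac:(lia))).
    pose proof (phase_inv lam m n phat p y lam_ge0 lam_pos HI r) as HIr.
    pose proof (phase_loc_pos lam m n phat p y lam_ge0 lam_pos HI r).
    assert (Ht : tm (iterate (S r) (rnd p) y) = tm (iterate r (rnd p) y) + (beta - 1) * loc (iterate r (rnd p) y))
      by reflexivity.
    assert (Q : potential (iterate (S r) (rnd p) y) <= potential (iterate r (rnd p) y) +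
      INR (length (al (iterate r (rnd p) y))) * (tm (iterate (S r) (rnd p) y) - tm (iterate r (rnd p) y))).
    { apply potential_step.
      - apply HIr.
      - eapply inv_incl; eauto.
      - apply incl_filter.
      - rewrite Ht. unfold beta; lra.
      - apply H; auto. }
    rewrite Ht in Q. unfold span in *. rewrite lsum_seq_S.
    replace (tm (iterate r (rnd p) y) + (beta - 1) * loc (iterate r (rnd p) y) - tm (iterate r (rnd p) y))
      with ((beta - 1) * loc (iterate r (rnd p) y)) in Q by ring. lra.
Qed.

Lemma potential_done x : al x = [] -> potential x = sumR n C.
Proof. intros H. unfold potential. rewrite H, sumR_lsum. auto. Qed.

(** With [theta = 1] every job is honest, so the phase bound applies with no exceptional jobs, up to
    the death of the last one. *)
Lemma second_phase_cost y S' C' k0 : inv lam m n p y -> ph y = false -> loc y = tau0 lam m n ->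
  y = run p k0 -> feasible m n lam p S' C' ->
  sumR n C <= potential y + 32 / 5 * sumR n C' + INR n * tau0 lam m n / 10.
Proof.
  intros HI Hph Hloc Hy HF.
  destruct (second_phase p y p_ge1 HI Hph) as [r [H1 H2]].
  rewrite <- (potential_done _ H1).
  assert (P := potential_phase y r HI).
  assert (Q := phase_cost lam m n phat p y lam_ge0 lam_pos p_ge1 HI S' C' r 0 HF).
  rewrite Hloc in Q. lapply P; clear P.
  - intros P. lapply Q; clear Q.
    + intros Q. lapply Q; clear Q.
      * intros Q. lra.
      * intros k Hk. specialize (H2 k Hk). destruct (al (iterate k (rnd p) y)); [congruence|simpl; lia].
    + assert (filter (fun j => negb (honest phat p y j)) (al y) = []) as ->; [|simpl; lia].
      destruct (filter (fun j => negb (honest phat p y j)) (al y)) as [|j L] eqn:E; auto. exfalso.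
      assert (Hj : In j (filter (fun j => negb (honest phat p y j)) (al y))) by (rewrite E; left; auto).
      apply filter_In in Hj. destruct Hj as [Hj1 Hj2].
      apply (inv_incl lam m n p y HI), in_seq in Hj1. pose proof (p_ge1 j ltac:(lia)).
      assert (honest phat p y j = true); [|rewrite H0 in Hj2; discriminate].
      unfold honest, theta. rewrite Hph. apply Rleb_true; auto.
  - intros k _ j Hj Hn. rewrite <- (iterate_step_round_false p k y Hph) in *.
    assert (E : iterate k (stp p) y = run p (k + k0)) by (unfold run; rewrite iterate_add, Hy; auto).
    rewrite E in *. apply completion_le; auto.
Qed.

(** A job alive cannot have ended its slot before [stop]: having received [quantum <= p j], it would
    have caused an earlier stop. A dead job completed by the end of its slot. *)
Lemma stage_potential : (n <= 51 * g)%nat ->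
  potential (initial p) <= lsum (seq 0 n) (fin lam m n) + INR n * tau0 lam m n.
Proof.
  intros Hn. pose proof (run_sc_app 0) as [E HE]. unfold run in HE. simpl in HE.
  replace (INR n * tau0 lam m n) with (lsum (seq 0 n) (fun _ => tau0 lam m n)) by (rewrite lsum_const, length_seq; auto).
  rewrite <- lsum_plus. unfold potential.
  pose proof (stop_pos lam m n lam_pos p) as Hst. pose proof (tau0_pos lam m n lam_ge0) as Ht0.
  unfold initial in *. apply Nat.leb_le in Hn. rewrite Hn in *. simpl in HE |- *.
  apply lsum_le. intros j Hj. apply in_seq in Hj. assert (Hjn : (j < n)%nat) by lia.
  pose proof (fin_pos lam m n lam_pos j Hjn) as Hf.
  destruct (mem j (stage_alive lam m n p)) eqn:Em.
  - apply mem_true, filter_In in Em. destruct Em as [_ Em]. apply Rleb_true in Em.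
    destruct (Rle_or_lt (stop lam m n p) (fin lam m n j)) as [|Hlt]; [lra|].
    rewrite prefix_work_fin in Em by (auto; lra).
    pose proof (stop_le_fin lam m n p j Hjn Em). lra.
  - assert (Hdead : p j < work lam (prefix lam m n (stop lam m n p)) j (stop lam m n p)).
    { destruct (Rlt_or_le (p j) (work lam (prefix lam m n (stop lam m n p)) j (stop lam m n p))) as [|Hc]; auto.
      assert (mem j (stage_alive lam m n p) = true); [|congruence].
      apply mem_true, filter_In. split; [apply in_seq; lia|]. apply Rleb_true; auto. }
    enough (C j <= fin lam m n j) by lra.
    destruct (Rle_or_lt (fin lam m n j) (stop lam m n p)) as [Hle|Hlt].
    + apply (completes_le lam (final p) p j); auto. rewrite HE, work_app.
      pose proof (work_nonneg lam lam_ge0 E j (fin lam m n j)).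
      rewrite prefix_work_fin in * by (auto; lra). lra.
    + enough (C j <= stop lam m n p) by lra.
      apply (completes_le lam (final p) p j); auto. rewrite HE, work_app.
      pose proof (work_nonneg lam lam_ge0 E j (stop lam m n p)). lra.
Qed.

Lemma opt_nonneg S' C' : feasible m n lam p S' C' -> 0 <= sumR n C'.
Proof.
  intros HF. pose proof (opt_tau0 lam m n p S' C' lam_ge0 p_ge1 HF).
  pose proof (tau0_pos lam m n lam_ge0). pose proof (pos_INR n). nra.
Qed.

(** The parts cost [643/100 + 32/5] or twice [32/5] times the optimum. Idle times add small
    multiples of [n * tau0], and the sum stays below 12.9. *)
Lemma competitive S' C' : (num_overpredicted n p phat <= g)%nat -> feasible m n lam p S' C' ->
  sumR n C <= 1448 / 100 * sumR n C'.
Proof.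
  intros Hg HF. pose proof (opt_nonneg S' C' HF) as Hopt.
  pose proof (opt_tau0 lam m n p S' C' lam_ge0 p_ge1 HF) as Htau.
  pose proof (tau0_pos lam m n lam_ge0) as Ht0.
  destruct (Nat.leb n (51 * g)) eqn:En.
  - assert (Hinit : initial p = stage_state lam m n p) by (unfold initial; rewrite En; auto).
    apply Nat.leb_le in En.
    pose proof (second_phase_cost (initial p) S' C' 0 (initial_inv p p_ge1)) as Q.
    rewrite Hinit in Q at 1 2. specialize (Q eq_refl eq_refl eq_refl HF).
    pose proof (stage_potential En). pose proof (stage_cost lam m n lam_ge0 lam_pos p S' C' p_ge1 HF). lra.
  - assert (Hinit : initial p = prediction_state) by (unfold initial; rewrite En; auto).
    destruct (first_phase p p_ge1) as [r [H1 H2]].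
    destruct (first_phase_restart p r H1 H2) as [E1 E2].
    pose proof (prediction_inv p p_ge1) as HI0.
    assert (Hrun : run p (S r) = restart (iterate r (rnd p) prediction_state)) by (unfold run; rewrite Hinit; exact E2).
    pose proof (run_inv p (S r) p_ge1) as HIr.
    set (x := iterate r (rnd p) prediction_state) in *.
    pose proof (second_phase_cost (restart x) S' C' (S r)) as Q.
    rewrite <- Hrun in Q at 1. specialize (Q HIr eq_refl eq_refl (eq_sym Hrun) HF).
    assert (Hx : inv lam m n p x) by (apply (phase_inv lam m n phat p prediction_state lam_ge0 lam_pos HI0 r)).
    assert (P1 : potential (restart x) <= potential x + INR (length (al x)) * (tm (restart x) - tm x)).
    { apply potential_step.
      - apply Hx.
      - eapply inv_incl; eauto.
      - apply incl_refl.
      - simpl. lra.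
      - intros j Hj Hn. rewrite <- Hrun in *. apply completion_le; auto. }
    replace (tm (restart x) - tm x) with (tau0 lam m n) in P1 by (simpl; ring).
    assert (Hlen : INR (length (al x)) <= INR n).
    { apply le_INR. rewrite <- (length_seq n 0). apply NoDup_incl_length; [apply Hx|]. eapply inv_incl; eauto. }
    assert (P2 := potential_phase prediction_state r HI0). lapply P2; clear P2.
    2:{ intros k Hk j Hj Hn.
        assert (Ek : run p k = iterate k (rnd p) prediction_state).
        { unfold run. rewrite Hinit. apply iterate_step_round. intros i Hi. unfold switch.
          apply andb_false_intro2, Nat.leb_gt, H2. lia. }
        rewrite <- Ek in *. apply completion_le; auto. }
    intros P2. fold x in P2.
    assert (P3 : potential prediction_state = INR n * tau0 lam m n).
    { unfold potential. simpl. rewrite (lsum_ext _ _ (fun _ => tau0 lam m n)).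
      - rewrite lsum_const, length_seq. auto.
      - intros j Hj. rewrite (proj2 (mem_true j (seq 0 n)) Hj). auto. }
    pose proof (phase_cost lam m n phat p prediction_state lam_ge0 lam_pos p_ge1 HI0 S' C' r g HF) as P4.
    lapply P4; clear P4.
    + intros P4. specialize (P4 H2). change (loc prediction_state) with (tau0 lam m n) in P4.
      assert (INR (length (al x)) * tau0 lam m n <= INR n * tau0 lam m n) by (apply Rmult_le_compat_r; lra).
      lra.
    (* Since [p j >= 1], a job with [Rmax 1 (phat j)] above [p j] has [phat j] above [p j]. *)
    + eapply Nat.le_trans; [|exact Hg]. unfold num_overpredicted, countN. simpl al.
      apply filter_length_incl. intros j Hj Hh. apply in_seq in Hj. pose proof (p_ge1 j ltac:(lia)).
      apply Rltb_true. destruct (Rlt_or_le (p j) (phat j)) as [|Hc]; auto. exfalso.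
      assert (honest phat p prediction_state j = true); [|rewrite H0 in Hh; discriminate].
      apply Rleb_true. unfold theta. simpl. apply Rmax_lub; auto.
Qed.

(** * Counting interruptions *)

Hypothesis phat_pos : forall j, (j < n)%nat -> 0 < phat j.

Lemma second_phase_length y S : inv lam m n p y -> ph y = false ->
  (exists r, S = sc (iterate r (rnd p) y)) ->
  INR (length S) <= INR (length (sc y)) +
    INR (length (al y)) * (cst0 + cst1 + cst1 * ln (maxR n p)).
Proof.
  intros HI Hph [r ->]. rewrite (phase_length lam m n phat p y lam_ge0 lam_pos HI).
  apply Rplus_le_compat_l. rewrite <- lsum_const. apply lsum_le. intros j Hj.
  apply (inv_incl lam m n p y HI), in_seq in Hj. assert (Hjn : (j < n)%nat) by lia.
  eapply Rle_trans; [apply runs_le; auto|]. unfold theta. rewrite Hph.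
  pose proof cst1_pos as Hc1. pose proof (p_ge1 j Hjn) as Hp. pose proof (maxR_ge p n j Hjn) as Hmx.
  assert (ln (p j / 1 + 1) <= 1 + ln (maxR n p)).
  { apply Rle_trans with (ln (2 * maxR n p)); [apply ln_mono; lra|]. rewrite ln_mult by lra. pose proof ln_2_le_1. lra. }
  nra.
Qed.

(** More than half of the jobs are not overpredicted, and each of these contributes at least
    [ln 2 >= 1/2] to the budget. Hence [n <= 4 * budget], which pays the constants per job; the
    second phase has at most [51 * g] jobs. *)
Lemma final_length_predicted : (num_overpredicted n p phat <= g)%nat -> (51 * g < n)%nat ->
  INR (length (final p)) <= (8 * cst0 + 51 * cst1) * (budget n phat p + INR g * ln (maxR n p)).
Proof.
  intros Hg Hn.
  assert (Hinit : initial p = prediction_state) by (unfold initial; rewrite (proj2 (Nat.leb_gt n (51 * g))); auto).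
  destruct (first_phase p p_ge1) as [r [H1 H2]].
  destruct (first_phase_restart p r H1 H2) as [E1 E2].
  pose proof (prediction_inv p p_ge1) as HI0.
  assert (Hrun : run p (S r) = restart (iterate r (rnd p) prediction_state)) by (unfold run; rewrite Hinit; exact E2).
  pose proof (run_inv p (S r) p_ge1) as HIr. rewrite Hrun in HIr.
  set (x := iterate r (rnd p) prediction_state) in *.
  destruct (second_phase p (restart x) p_ge1 HIr eq_refl) as [r2 [H3 _]].
  assert (Hfin : final p = sc (iterate r2 (rnd p) (restart x))).
  { assert (E : run p (r2 + S r) = iterate r2 (rnd p) (restart x)).
    { unfold run. rewrite iterate_add. fold (run p (S r)). rewrite Hrun.
      apply iterate_step_round_false; auto. }
    rewrite <- E. apply final_run; auto. rewrite E; auto. }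
  pose proof (second_phase_length (restart x) (final p) HIr eq_refl (ex_intro _ r2 Hfin)) as L2.
  simpl sc in L2. simpl al in L2.
  pose proof (phase_length lam m n phat p prediction_state lam_ge0 lam_pos HI0 r) as L1. fold x in L1.
  simpl in L1.
  pose proof cst1_pos as Hc1. pose proof cst0_pos as Hc0. pose proof (ln_max_nonneg n p p_ge1) as HM.
  assert (L3 : lsum (seq 0 n) (fun j => INR (runs lam m n phat p prediction_state r j)) <= INR n * cst0 + cst1 * budget n phat p).
  { unfold budget. rewrite sumR_lsum. replace (INR n * cst0) with (lsum (seq 0 n) (fun _ => cst0)) by (rewrite lsum_const, length_seq; auto).
    rewrite <- lsum_scal, <- lsum_plus. apply lsum_le. intros j Hj. apply in_seq in Hj.
    assert (Hjn : (j < n)%nat) by lia.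
    eapply Rle_trans; [apply runs_le; auto|]. apply Rplus_le_compat_l. apply Rmult_le_compat_l; [lra|].
    unfold theta. simpl ph. cbv iota. pose proof (phat_pos j Hjn). pose proof (p_ge1 j Hjn).
    pose proof (Rmax_l 1 (phat j)). pose proof (Rmax_r 1 (phat j)).
    apply ln_mono.
    - assert (0 < p j / Rmax 1 (phat j)) by (apply Rdiv_lt_0_compat; lra). lra.
    - apply Rplus_le_compat_r. unfold Rdiv. apply Rmult_le_compat_l; [lra|]. apply Rinv_le_contravar; auto. }
  assert (L4 : INR n <= 4 * budget n phat p).
  { unfold num_overpredicted, countN in Hg.
    pose proof (filter_length (fun j => Rltb (p j) (phat j)) (seq 0 n)) as Hf. rewrite length_seq in Hf.
    set (H := filter (fun j => negb (Rltb (p j) (phat j))) (seq 0 n)) in *.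
    assert (Hh : (n <= 2 * length H)%nat) by lia. apply le_INR in Hh. rewrite mult_INR in Hh. simpl (INR 2) in Hh.
    enough (INR (length H) * (1 / 2) <= budget n phat p) by lra.
    rewrite <- lsum_const. unfold H. rewrite lsum_filter. unfold budget. rewrite sumR_lsum. apply lsum_le.
    intros j Hj. apply in_seq in Hj. assert (Hjn : (j < n)%nat) by lia.
    pose proof (budget_term_nonneg n phat p j p_ge1 phat_pos Hjn). destruct (Rltb (p j) (phat j)) eqn:E; simpl; auto.
    assert (Hle : phat j <= p j).
    { destruct (Rle_or_lt (phat j) (p j)) as [|Hc]; auto. apply Rltb_true in Hc. congruence. }
    pose proof (phat_pos j Hjn).
    apply Rle_trans with (ln 2); [pose proof ln_lt_2; lra|]. apply ln_mono; [lra|].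
    enough (1 <= p j / phat j) by lra. apply (Rmult_le_reg_r (phat j)); auto.
    replace (p j / phat j * phat j) with (p j) by (field; lra). lra. }
  assert (L5 : INR (length (al x)) <= INR n).
  { apply le_INR. rewrite <- (length_seq n 0). apply NoDup_incl_length; [apply HIr|].
    apply (inv_incl lam m n p (restart x) HIr). }
  assert (L6 : INR (length (al x)) <= 51 * INR g).
  { apply le_INR in H1. rewrite mult_INR in H1. replace (INR 51) with 51 in H1 by (simpl; lra). exact H1. }
  assert (0 <= INR (length (al x))) by apply pos_INR.
  assert (M1 : INR (length (al x)) * (cst1 * ln (maxR n p)) <= 51 * INR g * (cst1 * ln (maxR n p))).
  { apply Rmult_le_compat_r; auto. apply Rmult_le_pos; lra. }
  assert (M2 : INR (length (al x)) * (cst0 + cst1) <= 4 * budget n phat p * (cst0 + cst1)).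
  { apply Rmult_le_compat_r; lra. }
  assert (M3 : INR n * cst0 <= 4 * budget n phat p * cst0) by (apply Rmult_le_compat_r; lra).
  assert (0 <= budget n phat p) by (pose proof (pos_INR n); lra).
  assert (0 <= INR g * ln (maxR n p)) by (apply Rmult_le_pos; auto; apply pos_INR).
  nra.
Qed.

(** One job of size at least [quantum] gives [ln p_max >= ln quantum], so the constants of the at
    most [51 * g] jobs can be charged to [g * ln p_max]. *)
Lemma final_length_blind : (n <= 51 * g)%nat -> (exists j, (j < n)%nat /\ quantum <= p j) ->
  INR (length (final p)) <= (51 * cst1 + 51 * (1 + cst0 + cst1) / ln quantum) * (INR g * ln (maxR n p)).
Proof.
  intros Hn [j0 [Hj0 Hq]].
  assert (Hinit : initial p = stage_state lam m n p) by (unfold initial; rewrite (proj2 (Nat.leb_le n (51 * g))); auto).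
  pose proof (initial_inv p p_ge1) as HI.
  assert (Hph : ph (initial p) = false) by (rewrite Hinit; auto).
  destruct (second_phase p (initial p) p_ge1 HI Hph) as [r [H3 _]].
  assert (Hfin : final p = sc (iterate r (rnd p) (initial p))).
  { assert (E : run p r = iterate r (rnd p) (initial p)) by (apply iterate_step_round_false; auto).
    rewrite <- E. apply final_run; auto. rewrite E; auto. }
  pose proof (second_phase_length (initial p) (final p) HI Hph (ex_intro _ r Hfin)) as L2.
  assert (L3 : INR (length (sc (initial p))) <= INR n).
  { apply le_INR. rewrite Hinit. simpl. unfold prefix. rewrite length_map.
    rewrite <- (length_seq n 0) at 2. apply filter_length_le. }
  assert (L4 : INR (length (al (initial p))) <= INR n).
  { apply le_INR. rewrite <- (length_seq n 0). apply NoDup_incl_length; [apply HI|]. eapply inv_incl; eauto. }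
  pose proof cst1_pos as Hc1. pose proof cst0_pos as Hc0. pose proof ln_quantum_pos as Hlq.
  assert (HM : ln quantum <= ln (maxR n p)).
  { apply ln_mono; [unfold quantum; lra|]. eapply Rle_trans; [exact Hq|]. apply maxR_ge; auto. }
  assert (L5 : INR n <= 51 * INR g).
  { apply le_INR in Hn. rewrite mult_INR in Hn. replace (INR 51) with 51 in Hn by (simpl; lra). exact Hn. }
  pose proof (pos_INR g) as Hg0. pose proof (pos_INR n).
  assert (M0 : INR (length (al (initial p))) * (cst0 + cst1 + cst1 * ln (maxR n p)) <=
     INR n * (cst0 + cst1 + cst1 * ln (maxR n p))).
  { apply Rmult_le_compat_r; auto. assert (0 <= cst1 * ln (maxR n p)) by (apply Rmult_le_pos; lra). lra. }
  assert (M1 : INR n * (1 + cst0 + cst1 + cst1 * ln (maxR n p)) <= 51 * INR g * (1 + cst0 + cst1 + cst1 * ln (maxR n p))).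
  { apply Rmult_le_compat_r; auto. assert (0 <= cst1 * ln (maxR n p)) by (apply Rmult_le_pos; lra). lra. }
  assert (M2 : 51 * INR g * (1 + cst0 + cst1) <= 51 * (1 + cst0 + cst1) / ln quantum * (INR g * ln (maxR n p))).
  { replace (51 * (1 + cst0 + cst1) / ln quantum * (INR g * ln (maxR n p))) with
      (51 * INR g * (1 + cst0 + cst1) * (ln (maxR n p) / ln quantum)) by (field; lra).
    rewrite <- (Rmult_1_r (51 * INR g * (1 + cst0 + cst1))) at 1. apply Rmult_le_compat_l.
    - apply Rmult_le_pos; lra.
    - apply (Rmult_le_reg_r (ln quantum)); auto.
      replace (ln (maxR n p) / ln quantum * ln quantum) with (ln (maxR n p)) by (field; lra). lra. }
  lra.
Qed.

(** The stage is never abandoned, so every job has a single segment, which ends no earlier than its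
    completion. *)
Lemma small_jobs_uninterrupted : (n <= 51 * g)%nat -> (forall j, (j < n)%nat -> p j < quantum) ->
  num_preempt_migr (final p) C = O.
Proof.
  intros Hn Hq.
  assert (Hinit : initial p = stage_state lam m n p) by (unfold initial; rewrite (proj2 (Nat.leb_le n (51 * g))); auto).
  set (t := stop lam m n p).
  assert (Ht : forall j, (j < n)%nat -> fin lam m n j <= t).
  { intros j Hj. unfold t. destruct (stop_cases lam m n p) as [->|[i (Hi & Hqi & _)]].
    - apply fin_le_horizon; auto.
    - specialize (Hq i Hi). lra. }
  assert (Hw : forall j u, (j < n)%nat -> fin lam m n j <= u -> work lam (prefix lam m n t) j u = quantum)
    by (intros; apply prefix_work_fin; auto).
  assert (Hal : al (run p 0) = []).
  { unfold run. simpl. rewrite Hinit. simpl. unfold stage_alive. fold t.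
    destruct (filter _ _) as [|j L] eqn:E; auto. exfalso.
    assert (Hj : In j (filter (fun j => Rleb (work lam (prefix lam m n t) j t) (p j)) (seq 0 n))) by (rewrite E; left; auto).
    apply filter_In in Hj. destruct Hj as [Hj1 Hj2]. apply in_seq in Hj1. apply Rleb_true in Hj2.
    rewrite Hw in Hj2 by (try apply Ht; lia). specialize (Hq j ltac:(lia)). lra. }
  assert (HS : final p = prefix lam m n t).
  { rewrite (final_run p 0 p_ge1 Hal). unfold run; simpl. rewrite Hinit. auto. }
  assert (HC : forall j, (j < n)%nat -> C j <= fin lam m n j).
  { intros j Hj. apply (completes_le lam (final p) p j); auto. rewrite HS, Hw by (auto; lra). apply Rlt_le; auto. }
  assert (Hnd : NoDup (map sj (final p))).
  { rewrite HS. unfold prefix. rewrite map_map. simpl. rewrite map_id. apply NoDup_filter, seq_NoDup. }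
  assert (Hseg : forall k, (k < length (final p))%nat -> C (sj (segk (final p) k)) <= se (segk (final p) k)).
  { intros k Hk. assert (Hin : In (segk (final p) k) (prefix lam m n t)) by (rewrite <- HS; apply nth_In; auto).
    destruct (prefix_bounds _ _ _ _ _ Hin) as (H1 & _ & _ & H4 & _). rewrite H4, Rmin_left by auto. auto. }
  unfold num_preempt_migr. rewrite !countN_zero; auto.
  - intros k' Hk'. destruct (is_migration (final p) C k') eqn:E; auto. exfalso.
    unfold is_migration in E. apply andb_prop in E. destruct E as [_ E].
    apply existsb_exists in E. destruct E as [k [Hk E]]. apply in_seq in Hk.
    repeat (apply andb_prop in E; destruct E as [E ?]).
    apply negb_true_iff, Nat.eqb_neq in E. apply E.
    match goal with H : Nat.eqb (sj _) (sj _) = true |- _ => apply Nat.eqb_eq in H; rename H into Hs end.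
    apply (proj1 (NoDup_nth (map sj (final p)) (sj seg0)) Hnd); rewrite ?length_map; try lia.
    rewrite !map_nth. exact Hs.
  - intros k Hk. unfold is_preemption. apply andb_false_intro1. specialize (Hseg k Hk).
    unfold Rltb. destruct (Rlt_dec _ _); auto. lra.
Qed.

End Analysis.
End Algorithm.

(** The factor 2 is there because a segment may count both as a preemption and as a migration; the
    sum dominates the constants of both cases. *)
Definition interruption_constant : R :=
  2 * (8 * cst0 + 51 * cst1 + 51 * (1 + cst0 + cst1) / ln quantum).

Lemma interruption_constant_pos :
  0 < 51 * (1 + cst0 + cst1) / ln quantum /\ 0 < interruption_constant.
Proof.
  pose proof cst0_pos. pose proof cst1_pos. pose proof ln_quantum_pos.
  assert (0 < 51 * (1 + cst0 + cst1) / ln quantum) by (apply Rdiv_lt_0_compat; lra).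
  unfold interruption_constant. split; lra.
Qed.

Lemma interruptions_le lam m n g phat p C :
  (forall i j, 0 <= lam i j) -> (forall j, (j < n)%nat -> exists i, (i < m)%nat /\ 0 < lam i j) ->
  valid_sizes n p -> (forall j, (j < n)%nat -> 0 < phat j) -> (num_overpredicted n p phat <= g)%nat ->
  (forall j, (j < n)%nat -> completes lam (final lam m n g phat p) p j (C j)) ->
  INR (num_preempt_migr (final lam m n g phat p) C) <=
  interruption_constant * (budget n phat p + INR g * ln (maxR n p)).
Proof.
  intros lam_ge0 lam_pos Vp Hphat Hg HC.
  destruct interruption_constant_pos as [K1 K2].
  pose proof cst0_pos. pose proof cst1_pos.
  assert (B1 : 0 <= budget n phat p).
  { unfold budget. rewrite sumR_lsum. apply lsum_nonneg. intros j Hj. apply in_seq in Hj.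
    apply (budget_term_nonneg n phat p j Vp Hphat); lia. }
  assert (B2 : 0 <= INR g * ln (maxR n p)).
  { apply Rmult_le_pos; [apply pos_INR|apply ln_max_nonneg; auto]. }
  assert (M : forall c, 2 * c <= interruption_constant ->
    2 * (c * (budget n phat p + INR g * ln (maxR n p))) <= interruption_constant * (budget n phat p + INR g * ln (maxR n p))).
  { intros c Hc. rewrite <- Rmult_assoc. apply Rmult_le_compat_r; lra. }
  pose proof (num_le_length (final lam m n g phat p) C) as HN.
  destruct (Nat.le_gt_cases n (51 * g)) as [Hn|Hn].
  - destruct (classic (exists j, (j < n)%nat /\ quantum <= p j)) as [He|He].
    + pose proof (final_length_blind lam m n g phat lam_ge0 lam_pos p Vp Hn He) as L.
      set (c := 51 * cst1 + 51 * (1 + cst0 + cst1) / ln quantum) in *.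
      assert (0 <= c) by (unfold c; lra).
      specialize (M c ltac:(unfold c, interruption_constant; lra)).
      assert (c * (INR g * ln (maxR n p)) <= c * (budget n phat p + INR g * ln (maxR n p)))
        by (apply Rmult_le_compat_l; lra).
      lra.
    + rewrite (small_jobs_uninterrupted lam m n g phat lam_ge0 lam_pos p C); auto.
      * simpl. apply Rmult_le_pos; lra.
      * intros j Hj. destruct (Rlt_or_le (p j) quantum); auto. exfalso; eauto.
  - pose proof (final_length_predicted lam m n g phat lam_ge0 lam_pos p Vp Hphat Hg Hn) as L.
    specialize (M (8 * cst0 + 51 * cst1) ltac:(unfold interruption_constant; lra)). lra.
Qed.

(** [nonclairvoyant] ranges over all rates, including negative ones and jobs that no machine can
    run; the empty schedule covers these. *)
Definition scheduler : algorithm := fun m n lam phat g p =>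
  if excluded_middle_informative (params_ok lam m n) then final lam m n g phat p else [].

(** A job completed before [t] has the same size in both vectors. For any other job, both sizes are
    at least the work done at every time before [t], so all comparisons succeed for both. *)
Lemma scheduler_nonclairvoyant : nonclairvoyant scheduler.
Proof.
  intros m n lam phat g p p' t Vp Vp' _ Hcons i s Hs. unfold scheduler in *.
  destruct (excluded_middle_informative (params_ok lam m n)) as [[H1 H2]|]; auto.
  apply (final_state lam m n g phat H1 H2 p p' t); auto.
  intros u j Hu Hj. destruct (Hcons j Hj) as [[_ ->]|[Hnc Hw]]; [tauto|].
  assert (work lam (final lam m n g phat p) j u < p j).
  { destruct (Rlt_or_le (work lam (final lam m n g phat p) j u) (p j)) as [|Hc]; auto.
    exfalso. apply Hnc. exists u; auto. }
  assert (work lam (final lam m n g phat p) j u <= work lam (final lam m n g phat p) j t)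
    by (apply work_mono; auto; lra).
  split; lra.
Qed.

Theorem mainTheorem8 :
  exists K : R, 0 < K /\
  exists eps0 : R, 0 < eps0 /\
  forall eps : R, 0 < eps < eps0 ->
  exists A : algorithm, nonclairvoyant A /\
  forall (m n : nat) (lam : nat -> nat -> R) (phat p : nat -> R) (g : nat),
    (forall i j, 0 <= lam i j) ->
    (forall j, (j < n)%nat -> exists i, (i < m)%nat /\ 0 < lam i j) ->
    (forall j, (j < n)%nat -> 1 <= p j) ->
    (forall j, (j < n)%nat -> 0 < phat j) ->
    (num_overpredicted n p phat <= g)%nat ->
    exists C : nat -> R,
      feasible m n lam p (A m n lam phat g p) C /\
      (forall (S' : schedule) (C' : nat -> R), feasible m n lam p S' C' ->
         total_completion n C <= (1448 / 100) * (1 + eps) * total_completion n C') /\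
      INR (num_preempt_migr (A m n lam phat g p) C) <=
        K / eps ^ 3 *
        (sumR n (fun j => ln (p j / phat j + 1)) + INR g / eps * ln (maxR n p)).
Proof.
  destruct interruption_constant_pos as [_ HK].
  exists interruption_constant. split; auto. exists 1. split; [lra|]. intros eps [He0 He1].
  exists scheduler. split; [apply scheduler_nonclairvoyant|].
  intros m n lam phat p g lam_ge0 lam_pos Vp Hphat Hg.
  assert (EA : scheduler m n lam phat g p = final lam m n g phat p).
  { unfold scheduler. destruct (excluded_middle_informative (params_ok lam m n)) as [|H]; auto.
    exfalso. apply H. split; auto. }
  rewrite EA.
  pose proof (run_inv lam m n g phat lam_ge0 lam_pos p (steps_needed lam m n g phat p) Vp) as HI.
  pose proof (steps_needed_spec lam m n g phat lam_ge0 lam_pos p Vp) as Hdone.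
  destruct (choice (fun j c => (j < n)%nat -> completes lam (final lam m n g phat p) p j c)) as [C HC].
  { intros j. destruct (Nat.lt_ge_cases j n) as [Hj|Hj]; [|exists 0; lia].
    destruct (completes_exists lam lam_ge0 (final lam m n g phat p) p j
      (tm (run lam m n g phat p (steps_needed lam m n g phat p)))) as [c Hc]; [specialize (Vp j Hj); lra| |exists c; auto].
    destruct (Rle_or_lt (p j) (work lam (final lam m n g phat p) j (tm (run lam m n g phat p (steps_needed lam m n g phat p)))))
      as [|Hlt]; auto. exfalso.
    destruct HI as (_ & (_ & HA) & _). rewrite Hdone in HA. apply (proj2 (HA j)). split; auto.
    apply Rlt_le, Hlt. }
  exists C. split; [|split].
  - split; auto. apply valid_scheduleE. destruct HI as ((H1 & H2) & _). split; auto.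
    intros s Hs. destruct (H1 s Hs) as (? & ? & ? & ? & ?). auto.
  - intros S' C' HF. unfold total_completion.
    pose proof (competitive lam m n g phat lam_ge0 lam_pos p C Vp HC S' C' Hg HF).
    pose proof (opt_nonneg lam m n lam_ge0 p Vp S' C' HF).
    assert (0 <= eps * sumR n C') by (apply Rmult_le_pos; lra). lra.
  - pose proof (interruptions_le lam m n g phat p C lam_ge0 lam_pos Vp Hphat Hg HC) as HN.
    eapply Rle_trans; [exact HN|]. fold (budget n phat p).
    assert (B1 : 0 <= budget n phat p).
    { unfold budget. rewrite sumR_lsum. apply lsum_nonneg. intros j Hj. apply in_seq in Hj.
      apply (budget_term_nonneg n phat p j Vp Hphat); lia. }
    pose proof (ln_max_nonneg n p Vp) as HL. pose proof (pos_INR g) as Hg0.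
    assert (He3 : 0 < eps ^ 3 <= 1).
    { split; [apply pow_lt; auto|]. rewrite <- (pow1 3). apply pow_incr; lra. }
    (* For [eps < 1] the factors [1 / eps ^ 3] and [1 / eps] only weaken the bound already
       proved. *)
    assert (Hinv : forall e, 0 < e <= 1 -> 1 <= / e).
    { intros e He. rewrite <- Rinv_1 at 1. apply Rinv_le_contravar; lra. }
    apply Rmult_le_compat.
    + lra.
    + assert (0 <= INR g * ln (maxR n p)) by (apply Rmult_le_pos; auto). lra.
    + unfold Rdiv. specialize (Hinv (eps ^ 3) He3). nra.
    + apply Rplus_le_compat_l. apply Rmult_le_compat_r; auto. unfold Rdiv.
      specialize (Hinv eps ltac:(lra)). nra.
Qed.
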